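(* Under the setting described in the context, there exists a compactly supported probability measure $\mu$ on $\mathbb{R}$, symmetric about $0$, such that \[ \lim_{N\to\infty}\mathrm{ESD}\big((N\varepsilon_N)^{-1/2}A_N\big)=\mu\quad\text{weakly in probability}. \] Furthermore, if $\min_{0\le x,y\le 1}f(x,y)>0$, then $\mu$ is absolutely continuous with respect to Lebesgue measure.
   Context: Let $f\colon[0,1]\times[0,1]\to[0,\infty)$ be continuous with $f(x,y)=f(y,x)$ for all $x,y\in[0,1]$. Let $(\varepsilon_N)_{N\ge1}$ be positive reals with $\lim_{N\to\infty}\varepsilon_N=0$ and $\lim_{N\to\infty}N\varepsilon_N=\infty$. For each $N$ (large enough that $\varepsilon_N\max f\le1$), let $\mathbb{G}_N$ be the random simple graph on vertex set $\{1,\dots,N\}$ in which, for every pair $1\le i<j\le N$, the edge $\{i,j\}$ is present with probability $\varepsilon_N f(i/N,j/N)$, independently over pairs. Let $A_N$ be its adjacency matrix: $A_N$ is symmetric with zero diagonal, and $A_N(i,j)\in\{0,1\}$ indicates an edge between $i$ and $j$. For a real symmetric $N\times N$ matrix $M$ with eigenvalues $\lambda_1,\dots,\lambda_N$ (with multiplicity), $\mathrm{ESD}(M)=\frac1N\sum_{i=1}^N\delta_{\lambda_i}$. Random probability measures $\eta_N$ converge weakly in probability to a deterministic probability measure $\eta$ if $\int g\,d\eta_N\to\int g\,d\eta$ in probability for every bounded continuous $g\colon\mathbb{R}\to\mathbb{R}$. *)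

(* Defs.v *)
From HB Require Import structures.
From mathcomp Require Import all_boot all_order all_algebra.
From mathcomp Require Import all_classical all_reals all_analysis.
Set Implicit Arguments. Unset Strict Implicit. Unset Printing Implicit Defensive.
Import Order.TTheory GRing.Theory Num.Theory.
Import numFieldNormedType.Exports.
Local Open Scope classical_set_scope.
Local Open Scope ring_scope.

Section RandomGraph.
Variable R : realType.

(* Eigenvalues (with multiplicity) of a square matrix whose characteristic
   polynomial splits over R (true for real symmetric matrices): a sequence s
   of size n with char_poly M = prod_(x <- s) ('X - x).  Chosen by classical
   choice; it is unique up to permutation when it exists. *)
Definition spectrum (n : nat) (M : 'M[R]_n) : seq R :=
  xget [::] [set s : seq R | size s = n /\
                 char_poly M = \prod_(x <- s) ('X - x%:P)].

Definition esd_int (n : nat) (M : 'M[R]_n) (g : R -> R) : R :=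
  n%:R^-1 * \sum_(x <- spectrum M) g x.

(* Vertices 1..N are represented by ordinals i : 'I_N, vertex i+1.
   A graph on {1..N} is a set of pairs (i,j) with i < j (its edge set). *)
Definition is_graph (N : nat) (G : {set 'I_N * 'I_N}) : bool :=
  [forall ij in G, (ij.1 < ij.2)%N].

Definition adjacency (N : nat) (G : {set 'I_N * 'I_N}) : 'M[R]_N :=
  \matrix_(i, j) ((((i, j) \in G) || ((j, i) \in G)) : nat)%:R.

Definition edge_prob (f : R -> R -> R) (eps : nat -> R) (N : nat)
  (i j : 'I_N) : R :=
  eps N * f (i.+1%:R / N%:R) (j.+1%:R / N%:R).

(* Probability that the random graph G_N equals G (independent edges). *)
Definition graph_weight (f : R -> R -> R) (eps : nat -> R) (N : nat)
  (G : {set 'I_N * 'I_N}) : R :=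
  \prod_(ij : 'I_N * 'I_N | (ij.1 < ij.2)%N)
     (if ij \in G then edge_prob f eps ij.1 ij.2
      else 1 - edge_prob f eps ij.1 ij.2).

Definition graph_prob (f : R -> R -> R) (eps : nat -> R) (N : nat)
  (E : {set 'I_N * 'I_N} -> bool) : R :=
  \sum_(G : {set 'I_N * 'I_N} | is_graph G && E G) graph_weight f eps G.

End RandomGraph.

(* Main.v *)
(** Let H = A_N / sqrt(N eps_N) and z = E + i eta.  By the Schur complement formula
    and a variance computation over the independent edges at one vertex, the
    diagonal g_i of (H - z)^-1 solves
      -1/g_i = z + (1/N) sum_j f(i/N, j/N) g_j
    up to errors that vanish in L^2.  For large eta this equation is a contraction,
    uniformly over refinements of the grid, so the averages of the g_i concentrate
    and converge; it is invariant under u -> -conj u for imaginary z, so the odd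
    part of the limit vanishes.  The functions 1/(x^2+s) and x/(x^2+s) generate,
    through partial fractions and Weierstrass approximation, all bounded continuous
    functions up to e (1 + x^2), and the second moments of the spectral
    distributions are bounded; this gives the limit of all linear statistics, and
    mu by Riesz representation.
    Near the real axis, a Schur test for the kernel |g_i| f_ij |g_j| / N bounds
    |z|^2 (1/N) sum_i |g_i|^2 by 6 + o(1), so that the imaginary part of the
    Stieltjes transform of mu is O(eta) for large |E|, and mu has no mass there.
    If f >= delta > 0, taking imaginary parts in the equation bounds that imaginary
    part by delta^(-1/2), so that mu has a bounded density. *)
Require Import Defs.
From HB Require Import structures.
From mathcomp Require Import all_boot all_order all_algebra.
From mathcomp Require Import all_classical all_reals all_analysis.
From mathcomp Require Import spectral sesquilinear mxpoly complex.
From mathcomp Require Import measurable_realfun.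
From mathcomp Require Import ring lra.
Set Implicit Arguments.
Unset Strict Implicit.
Unset Printing Implicit Defensive.
Import Order.TTheory GRing.Theory Num.Theory.
Import numFieldNormedType.Exports.
Import complex.ComplexField.Normc.
Local Open Scope classical_set_scope.
Local Open Scope ring_scope.

(** * Resolvents of real symmetric matrices *)

Section Resolvent.
Variable R : realType.
Local Notation K := R[i].
Implicit Types (x y z : K) (n : nat).

Local Notation toC := (real_complex R).
Local Notation conjc := (@complex.conjc R).

(** Two scales govern the errors. The edge probabilities are at most [eps N * C], so the means along
    a row have small l^2 norm because [eps N] tends to 0. The entries have squared size
    [1 / (N * eps N)], so sums of their squares concentrate because [N * eps N] tends to infinity.
    The stability estimate is deterministic: at one large spectral parameter it compares any graph
    on [N] vertices with any graph on [N'] vertices, the errors being their defects in the equation.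
    Averaging over the second graph yields concentration and the Cauchy property at once; neither a
    martingale argument nor a solution of the limiting equation enters. The contraction is lost near
    the real axis. There one-sided bounds replace it, in a fixed order of limits: first [N] tends to
    infinity at fixed [z], which kills errors whose coefficients blow up with [1 / Im z], and only
    then does [Im z] shrink. *)

Lemma ReD x y : complex.Re (x + y) = complex.Re x + complex.Re y.
Proof. by case: x; case: y. Qed.

Lemma ImD x y : complex.Im (x + y) = complex.Im x + complex.Im y.
Proof. by case: x; case: y. Qed.

Lemma ReN x : complex.Re (- x) = - complex.Re x.
Proof. by case: x. Qed.

Lemma ImN x : complex.Im (- x) = - complex.Im x.
Proof. by case: x. Qed.

Lemma Re_sum (I : Type) (r : seq I) (P : pred I) (F : I -> K) :
  complex.Re (\sum_(i <- r | P i) F i) = \sum_(i <- r | P i) complex.Re (F i).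
Proof. by apply: (big_morph _ ReD). Qed.

Lemma Im_sum (I : Type) (r : seq I) (P : pred I) (F : I -> K) :
  complex.Im (\sum_(i <- r | P i) F i) = \sum_(i <- r | P i) complex.Im (F i).
Proof. by apply: (big_morph _ ImD). Qed.

Lemma ReZ (a : R) x : complex.Re (toC a * x) = a * complex.Re x.
Proof. by case: x => u v /=; rewrite mul0r subr0. Qed.

Lemma ImZ (a : R) x : complex.Im (toC a * x) = a * complex.Im x.
Proof. by case: x => u v /=; rewrite mul0r addr0. Qed.

Lemma normc2E x : normc x ^+ 2 = complex.Re x ^+ 2 + complex.Im x ^+ 2.
Proof. by case: x => u v /=; rewrite sqr_sqrtr // addr_ge0 // sqr_ge0. Qed.

Lemma normc_ge0 x : 0 <= normc x.
Proof. by case: x => u v /=; rewrite sqrtr_ge0. Qed.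

Lemma ler_Re_normc x : `|complex.Re x| <= normc x.
Proof.
rewrite -(ler_pXn2r (n := 2)) ?nnegrE ?normc_ge0 // real_normK ?num_real //.
by rewrite normc2E lerDl sqr_ge0.
Qed.

Lemma ler_Im_normc x : `|complex.Im x| <= normc x.
Proof.
rewrite -(ler_pXn2r (n := 2)) ?nnegrE ?normc_ge0 // real_normK ?num_real //.
by rewrite normc2E lerDr sqr_ge0.
Qed.

Lemma normc_toC (a : R) : normc (toC a) = `|a|.
Proof. by rewrite /= expr0n /= addr0 sqrtr_sqr. Qed.

Lemma normcJ x : normc (conjc x) = normc x.
Proof. by case: x => u v /=; rewrite sqrrN. Qed.

Lemma normcN' x : normc (- x) = normc x.
Proof. by case: x => u v /=; rewrite !sqrrN. Qed.

Lemma ler_normc_sum (I : Type) (r : seq I) (P : pred I) (F : I -> K) :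
  normc (\sum_(i <- r | P i) F i) <= \sum_(i <- r | P i) normc (F i).
Proof.
elim/big_rec2 : _ => [|i b c _ h]; first by rewrite normc0.
by apply: le_trans (le_normcD _ _) _; rewrite lerD2l.
Qed.

Lemma mulcJ x : x * conjc x = toC (normc x ^+ 2).
Proof.
by rewrite normc2E; case: x => u v; apply/eqP; rewrite eq_complex /=;
   apply/andP; split; apply/eqP; ring.
Qed.

Definition shiftmx n (H : 'M[R]_n) z : 'M[K]_n := map_mx toC H - z%:M.

Definition resolvent n (H : 'M[R]_n) z : 'M[K]_n := invmx (shiftmx H z).

Definition rnorm2 n (w : 'rV[K]_n) : R := \sum_j normc (w 0 j) ^+ 2.

Lemma rnorm2_ge0 n (w : 'rV[K]_n) : 0 <= rnorm2 w.
Proof. by apply: sumr_ge0 => i _; rewrite sqr_ge0. Qed.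

Section Fixed.
Variables (n : nat) (H : 'M[R]_n) (z : K).
Hypothesis Hsym : H^T = H.
Hypothesis z_gt0 : 0 < complex.Im z.
Local Notation eta := (complex.Im z).
Local Notation G := (resolvent H z).

Lemma Hsym_entry i j : H i j = H j i.
Proof. by rewrite -[in LHS]Hsym mxE. Qed.

(** A real symmetric [H] has a real quadratic form, so only the shift by [z] contributes.
    Invertibility, the norm bound and the Ward identity all come from this. *)
Lemma Im_quad_shiftmx (w : 'rV[K]_n) :
  complex.Im (\sum_j (w *m shiftmx H z) 0 j * conjc (w 0 j)) = - eta * rnorm2 w.
Proof.
have -> : \sum_j (w *m shiftmx H z) 0 j * conjc (w 0 j) =
   (\sum_j \sum_k w 0 k * toC (H k j) * conjc (w 0 j)) - z * toC (rnorm2 w).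
  rewrite /rnorm2 (rmorph_sum (real_complex R)) mulr_sumr -sumrB.
  apply: eq_bigr => j _.
  rewrite /shiftmx mulmxBr mxE mul_mx_scalar !mxE mulrBl mulr_suml -mulrA mulcJ.
  by congr (_ - _); apply: eq_bigr => k _; rewrite mxE.
rewrite ImD ImN [z * _]mulrC ImZ mulNr mulrC.
set S := \sum_j _; suff -> : complex.Im S = 0 by rewrite add0r.
have : conjc S = S.
  rewrite /S rmorph_sum exchange_big /=; apply: eq_bigr => j _.
  rewrite rmorph_sum /=; apply: eq_bigr => k _.
  have cM (a b : K) : conjc (a * b) = conjc a * conjc b by rewrite -rmorphM.
  rewrite !cM conjcK conjc_real (Hsym_entry j k).
  by rewrite mulrC mulrA mulrAC.
by case: S => u v /= [] /eqP; rewrite -subr_eq0 -opprD oppr_eq0 -mulr2n mulrn_eq0 /= => /eqP.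
Qed.

(** Young's inequality with weight [eta] on the terms of [Im_quad_shiftmx] leaves half of
    [eta * rnorm2 w] to be absorbed. *)
Lemma rnorm2_le_shiftmx (w : 'rV[K]_n) :
  eta ^+ 2 * rnorm2 w <= rnorm2 (w *m shiftmx H z).
Proof.
set v := w *m _.
have h : eta * rnorm2 w <= \sum_j (normc (v 0 j) ^+ 2 / (2 * eta) + eta / 2 * normc (w 0 j) ^+ 2).
  have -> : eta * rnorm2 w = - complex.Im (\sum_j v 0 j * conjc (w 0 j)).
    by rewrite Im_quad_shiftmx mulNr opprK.
  apply: le_trans (ler_norm _) _; rewrite normrN.
  apply: le_trans (ler_Im_normc _) _; apply: le_trans (ler_normc_sum _ _ _) _.
  apply: ler_sum => j _; rewrite normcM normcJ.
  set a := normc _; set b := normc _; rewrite -subr_ge0.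
  have -> : a ^+ 2 / (2 * eta) + eta / 2 * b ^+ 2 - a * b = (a - eta * b) ^+ 2 / (2 * eta).
    by field; rewrite gt_eqF.
  by rewrite divr_ge0 ?sqr_ge0 // mulr_ge0 // ltW.
move: h; rewrite big_split /= -mulr_suml -mulr_sumr -/(rnorm2 w) -/(rnorm2 v) => h.
have e2 : 0 < 2 * eta by rewrite mulr_gt0.
have := ler_wpM2l (ltW e2) h.
have -> : 2 * eta * (rnorm2 v / (2 * eta) + eta / 2 * rnorm2 w) =
   rnorm2 v + eta ^+ 2 * rnorm2 w by field; rewrite gt_eqF.
have -> : 2 * eta * (eta * rnorm2 w) = eta ^+ 2 * rnorm2 w + eta ^+ 2 * rnorm2 w by ring.
by rewrite lerD2r.
Qed.

Lemma shiftmx_unit : shiftmx H z \in unitmx.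
Proof.
rewrite -row_free_unit -kermx_eq0; apply/eqP/row_matrixP => i.
rewrite row0; set w := row i _.
have wM : w *m shiftmx H z = 0 by rewrite -row_mul mulmx_ker row0.
have := rnorm2_le_shiftmx w; rewrite wM.
have -> : rnorm2 (0 : 'rV[K]_n) = 0.
  by rewrite /rnorm2 big1 // => j _; rewrite mxE normc0 expr0n.
rewrite pmulr_rle0 ?exprn_gt0 // => w0.
have {w0}/eqP w0 : rnorm2 w == 0 by rewrite eq_le w0 rnorm2_ge0.
apply/rowP => j; rewrite [RHS]mxE.
apply: eq0_normc; apply/eqP; rewrite -sqrf_eq0; apply/eqP.
by apply: (psumr_eq0P _ w0) => // k _; rewrite sqr_ge0.
Qed.

Lemma resolventV : G *m shiftmx H z = 1%:M.
Proof. by rewrite mulVmx // shiftmx_unit. Qed.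

Lemma resolventVr : shiftmx H z *m G = 1%:M.
Proof. by rewrite mulmxV // shiftmx_unit. Qed.

Lemma resolvent_sym i j : G i j = G j i.
Proof.
suff h : G = G^T by rewrite [in LHS]h mxE.
rewrite /resolvent trmx_inv; congr invmx.
rewrite /shiftmx linearB /= tr_scalar_mx; congr (_ - _).
by apply/matrixP => a b; rewrite !mxE Hsym_entry.
Qed.

Lemma rnorm2_resolvent (w : 'rV[K]_n) : rnorm2 (w *m G) <= rnorm2 w / eta ^+ 2.
Proof.
rewrite ler_pdivlMr ?exprn_gt0 // mulrC.
by apply: le_trans (rnorm2_le_shiftmx _) _; rewrite -mulmxA resolventV mulmx1.
Qed.

(** [shiftmx H z] sends [row j G] to the [j]-th unit vector, so the quadratic form at this row is
    the conjugate of [G j j]. *)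
Lemma ward j : eta * (\sum_k normc (G j k) ^+ 2) = complex.Im (G j j).
Proof.
have := Im_quad_shiftmx (row j G).
rewrite -row_mul resolventV.
have -> : \sum_k (row j 1%:M) 0 k * conjc ((row j G) 0 k) = conjc (G j j).
  rewrite (bigD1 j) //= !mxE eqxx mul1r big1 ?addr0 // => k kj.
  by rewrite !mxE eq_sym (negbTE kj) mul0r.
have -> : rnorm2 (row j G) = \sum_k normc (G j k) ^+ 2.
  by apply: eq_bigr => k _; rewrite mxE.
rewrite mulNr => h; apply: oppr_inj; rewrite -h; by case: (G j j).
Qed.

(** Besides the approximate equation, the a priori bounds below use only this and [resolvent_neq0],
    never that the solution is a resolvent. *)
Lemma Im_resolvent_ge j : eta * normc (G j j) ^+ 2 <= complex.Im (G j j).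
Proof.
rewrite -ward ler_pM2l // (bigD1 j) //= lerDl sumr_ge0 // => k _.
by rewrite sqr_ge0.
Qed.

Lemma normc_resolvent_le j : normc (G j j) <= eta^-1.
Proof.
have [->|nz] := eqVneq (normc (G j j)) 0; first by rewrite invr_ge0 ltW.
have p : 0 < normc (G j j) by rewrite lt_def nz normc_ge0.
rewrite -[leRHS]mul1r ler_pdivlMr // -(ler_pM2r p) mul1r.
have -> : normc (G j j) * eta * normc (G j j) = eta * normc (G j j) ^+ 2 by ring.
apply: le_trans (Im_resolvent_ge j) _.
exact: le_trans (ler_norm _) (ler_Im_normc _).
Qed.

Lemma resolvent_neq0 j : G j j != 0.
Proof.
apply/eqP => g0; have := ward j; rewrite g0 /= => /eqP.
rewrite mulf_eq0 gt_eqF //= => /eqP s0.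
have z0 k : G j k = 0.
  apply: eq0_normc; apply/eqP; rewrite -sqrf_eq0; apply/eqP.
  by apply: (psumr_eq0P _ s0) => // l _; rewrite sqr_ge0.
have := resolventV => /matrixP /(_ j j); rewrite !mxE eqxx big1.
  by move/eqP; rewrite eq_sym oner_eq0.
by move=> k _; rewrite z0 mul0r.
Qed.

End Fixed.
End Resolvent.

(** * Schur complements and minors *)

Section Schur.
Variable R : realType.
Local Notation K := R[i].
Local Notation toC := (real_complex R).

(** The vertex is isolated by zeroing its row and column, not deleted, so that both resolvents live
    over the same index type. *)
Definition minormx n (i : 'I_n) (H : 'M[R]_n) : 'M[R]_n :=
  \matrix_(a, b) if (a == i) || (b == i) then 0 else H a b.

Lemma minormx_sym n (i : 'I_n) (H : 'M[R]_n) : H^T = H -> (minormx i H)^T = minormx i H.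
Proof.
by move=> Hs; apply/matrixP => a b; rewrite !mxE orbC (Hsym_entry Hs).
Qed.

Variables (n : nat) (H : 'M[R]_n) (z : K) (i : 'I_n).
Hypothesis Hsym : H^T = H.
Hypothesis z_gt0 : 0 < complex.Im z.
Hypothesis Hii : H i i = 0.
Local Notation G := (resolvent H z).
Local Notation Gm := (resolvent (minormx i H) z).

Lemma z_neq0 : z != 0.
Proof. by apply/eqP => z0; move: z_gt0; rewrite z0 ltxx. Qed.

Lemma resolvent_minor_eq0 k : k != i -> Gm i k = 0.
Proof.
move=> ki; have := resolventVr (minormx_sym i Hsym) z_gt0.
move=> /matrixP /(_ i k); rewrite !mxE (bigD1 i) //= !mxE !eqxx /= big1 ?addr0.
  rewrite eq_sym (negbTE ki) rmorph0 sub0r mulNr mulr1n => /eqP.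
  by rewrite oppr_eq0 mulf_eq0 (negbTE z_neq0) /= => /eqP.
by move=> b bi; rewrite !mxE eqxx /= rmorph0 eq_sym (negbTE bi) mulr0n subr0 mul0r.
Qed.

(** Second resolvent identity for [H] and its minor. Their difference lives on row and column [i],
    and the column part drops because [Gm i k = 0]. *)
Lemma resolvent_minorE j k : k != i ->
  G j k = Gm j k - G j i * \sum_b toC (H i b) * Gm b k.
Proof.
move=> ki.
have E : G = Gm - G *m map_mx toC (H - minormx i H) *m Gm.
  have -> : map_mx toC (H - minormx i H) = shiftmx H z - shiftmx (minormx i H) z.
    by rewrite /shiftmx map_mxB opprB addrA subrK.
  rewrite mulmxBr mulmxBl resolventV // mul1mx -mulmxA resolventVr //.
    by rewrite mulmx1 opprB addrC subrK.
  exact: minormx_sym.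
rewrite {1}E mxE [X in _ + X]mxE -mulmxA mxE (bigD1 i) //= [X in _ - (_ + X)]big1 ?addr0.
  congr (_ - _ * _); rewrite mxE; apply: eq_bigr => b _.
  by rewrite !mxE eqxx /= subr0.
move=> a ai; rewrite mxE (bigD1 i) //= resolvent_minor_eq0 // mulr0 add0r big1 ?mulr0 //.
by move=> b bi; rewrite !mxE (negbTE ai) (negbTE bi) /= subrr rmorph0 mul0r.
Qed.

Lemma resolvent_offdiag k : k != i ->
  G i k = - G i i * \sum_b toC (H i b) * Gm b k.
Proof.
by move=> ki; rewrite resolvent_minorE // resolvent_minor_eq0 // sub0r mulNr.
Qed.

(** The diagonal entry of [G (H - z) = 1], with the rest of row [i] of [G] expressed through the
    minor, which does not see the edges at [i]. *)
Lemma schur_complement :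
  - (G i i)^-1 = z + \sum_k \sum_b toC (H i b) * Gm b k * toC (H i k).
Proof.
have := resolventV Hsym z_gt0 => /matrixP /(_ i i); rewrite !mxE eqxx.
have -> : \sum_j G i j * shiftmx H z j i =
   - G i i * (z + \sum_k \sum_b toC (H i b) * Gm b k * toC (H i k)).
  rewrite (bigD1 i) //= !mxE Hii rmorph0 eqxx sub0r mulrDr mulr1n mulrN mulNr.
  congr (_ + _); rewrite [X in _ = _ * X](bigD1 i) //= [X in _ = _ * (X + _)]big1 ?add0r.
    rewrite mulr_sumr; apply: eq_bigr => k ki.
    rewrite resolvent_offdiag // -mulr_suml -mulrA; congr (_ * (_ * _)).
    by rewrite !mxE (Hsym_entry Hsym) (negbTE ki) mulr0n subr0.
  by move=> b _; rewrite Hii rmorph0 mulr0.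
rewrite mulNr => h; apply: (mulfI (resolvent_neq0 Hsym z_gt0 i)).
by rewrite mulrN divff ?resolvent_neq0 //; apply: oppr_inj; rewrite h opprK.
Qed.

(** With the Ward identity, the moduli of these differences sum over [j] to at most [1 / eta], so
    passing from the minor back to [H] costs only [O(1/n)]. *)
Lemma resolvent_minor_diag j : j != i -> G j j - Gm j j = G i j ^+ 2 / G i i.
Proof.
move=> ji; rewrite resolvent_minorE // addrAC subrr sub0r (resolvent_sym z Hsym j).
rewrite (resolvent_offdiag ji) // expr2 -!mulrA [X in - (_ * X)]mulrC.
set S := \sum_b _.
have g0 := resolvent_neq0 Hsym z_gt0 i.
by field.
Qed.

End Schur.
(** * Independent edges and quadratic forms *)

Section EdgeProbability.
Variables (R : realType) (n : nat).
Local Notation edge := ('I_n * 'I_n)%type.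
Implicit Types (G : {set edge}) (X Y : {set edge} -> R) (e : edge).

Definition wt (p : edge -> R) G : R :=
  \prod_(ij : edge | (ij.1 < ij.2)%N) (if ij \in G then p ij else 1 - p ij).

Variable p : edge -> R.
Hypothesis p01 : forall e, (e.1 < e.2)%N -> 0 <= p e <= 1.

Definition Ex X : R := \sum_(G : {set edge} | is_graph G) wt p G * X G.

Lemma wt_ge0 G : 0 <= wt p G.
Proof.
apply: prodr_ge0 => e /p01 /andP[p0 p1]; by case: ifP => _ //; rewrite subr_ge0.
Qed.

Lemma ExD X Y : Ex (fun G => X G + Y G) = Ex X + Ex Y.
Proof. by rewrite -big_split; apply: eq_bigr => G _; rewrite mulrDr. Qed.

Lemma ExZ (a : R) X : Ex (fun G => a * X G) = a * Ex X.
Proof. by rewrite mulr_sumr; apply: eq_bigr => G _; rewrite mulrCA. Qed.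

Lemma Ex_sum (I : Type) (r : seq I) (P : pred I) (F : I -> {set edge} -> R) :
  Ex (fun G => \sum_(i <- r | P i) F i G) = \sum_(i <- r | P i) Ex (F i).
Proof.
by rewrite /Ex exchange_big /=; apply: eq_bigr => G _; rewrite mulr_sumr.
Qed.

Lemma eq_Ex X Y : (forall G, is_graph G -> X G = Y G) -> Ex X = Ex Y.
Proof. by move=> h; apply: eq_bigr => G /h ->. Qed.

Lemma ler_Ex X Y : (forall G, is_graph G -> X G <= Y G) -> Ex X <= Ex Y.
Proof. by move=> h; apply: ler_sum => G /h XY; rewrite ler_wpM2l ?wt_ge0. Qed.

Lemma Ex_ge0 X : (forall G, is_graph G -> 0 <= X G) -> 0 <= Ex X.
Proof. by move=> h; apply: sumr_ge0 => G /h ?; rewrite mulr_ge0 ?wt_ge0. Qed.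

Lemma Ex_cst (a : R) : Ex (fun=> a) = a.
Proof.
rewrite /Ex -mulr_suml -[RHS]mul1r; congr (_ * _).
(* Expanding the product of [F + F'] over all ordered pairs gives all subsets; the values 0 and 1 at
   pairs that are not increasing kill every subset that is not a graph. *)
pose F (ij : edge) := if (ij.1 < ij.2)%N then p ij else 0.
pose F' (ij : edge) := if (ij.1 < ij.2)%N then 1 - p ij else 1.
transitivity (\prod_(ij : edge) (F ij + F' ij)); last first.
  by apply: big1 => ij _; rewrite /F /F'; case: ifP => _; rewrite ?add0r // addrC subrK.
rewrite bigA_distr /= [RHS](bigID (@is_graph n)) /=.
rewrite [X in _ = _ + X]big1 ?addr0.
  apply: eq_bigr => G /forallP gG; rewrite /wt big_mkcond /=.
  apply: eq_bigr => ij _; rewrite /F /F'; have := gG ij.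
  by case: (ij \in G) => //= ->.
move=> G /forallPn [ij]; rewrite negb_imply => /andP[ijG nlt].
by rewrite (bigD1 ij) //= ijG /F (negbTE nlt) mul0r.
Qed.

Lemma is_graphU1 e G : (e.1 < e.2)%N -> is_graph (e |: G) = is_graph (G :\ e).
Proof.
move=> he; apply/forallP/forallP => h ij; apply/implyP.
  by rewrite !inE => /andP[_ ijG]; apply: (implyP (h ij)); rewrite !inE ijG orbT.
rewrite !inE => /orP[/eqP -> //|ijG].
have [->//|ne] := eqVneq ij e; apply: (implyP (h ij)); by rewrite !inE ne.
Qed.

(** The hypothesis on [Y] says that it does not depend on [e]. Graphs with and without [e] are both
    indexed by the graphs without it, which factors the expectation. *)
Lemma Ex_edge_aux e (phi : bool -> R) Y : (e.1 < e.2)%N ->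
  (forall G, Y (e |: G) = Y (G :\ e)) ->
  Ex (fun G => phi (e \in G) * Y G) =
  (p e * phi true + (1 - p e) * phi false) *
  \sum_(G : {set edge} | is_graph G && (e \notin G))
     (\prod_(ij : edge | (ij.1 < ij.2)%N && (ij != e)) (if ij \in G then p ij else 1 - p ij)) * Y G.
Proof.
move=> he Yinv; rewrite /Ex (bigID (fun G => e \in G)) /= mulrDl; congr (_ + _).
  rewrite (reindex_onto (fun G => e |: G) (fun G => G :\ e)); last first.
    by move=> G /andP[_ eG]; rewrite finset.setD1K.
  have E G : (is_graph (e |: G) && (e \in e |: G)) && ((e |: G) :\ e == G) =
     is_graph G && (e \notin G).
    rewrite is_graphU1 // finset.setU11 andbT.
    have [eG|eG] := boolP (e \in G).
      rewrite andbF; apply/negP => /andP[_ /eqP] h.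
      by move: eG; rewrite -h !inE eqxx.
    have -> : G :\ e = G.
      by apply/setP => x; rewrite !inE; case: eqP => // ->; rewrite (negbTE eG).
    by rewrite finset.setU1K // eqxx.
  rewrite (eq_bigl _ _ E) mulr_sumr; apply: eq_bigr => G /andP[_ eG].
  rewrite /wt (bigD1 e) //= finset.setU11 Yinv.
  have -> : G :\ e = G.
    by apply/setP => x; rewrite !inE; case: eqP => // ->; rewrite (negbTE eG).
  set P := \prod_(_ | _) _; set P' := \prod_(_ | _) _.
  suff -> : P = P' by ring.
  by apply: eq_bigr => ij /andP[_ ne]; rewrite !inE (negbTE ne).
rewrite mulr_sumr; apply: eq_bigr => G /andP[_ eG].
rewrite /wt (bigD1 e) //= (negbTE eG); set P := \prod_(_ | _) _.
ring.
Qed.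

Lemma Ex_edge e (phi : bool -> R) Y : (e.1 < e.2)%N ->
  (forall G, Y (e |: G) = Y (G :\ e)) ->
  Ex (fun G => phi (e \in G) * Y G) =
  (p e * phi true + (1 - p e) * phi false) * Ex Y.
Proof.
move=> he Yinv; rewrite Ex_edge_aux //; congr (_ * _).
(* The case [phi = 1] identifies the remaining sum with [Ex Y]. *)
transitivity (Ex (fun G => (fun=> 1) (e \in G) * Y G)).
  by rewrite (@Ex_edge_aux e (fun=> 1)) // !mulr1 addrC subrK mul1r.
by apply: eq_Ex => G _; rewrite mul1r.
Qed.

Lemma Ex_orthogonal (I : finType) (P : pred I) (T : I -> {set edge} -> R) :
  (forall a b, P a -> P b -> a != b -> Ex (fun G => T a G * T b G) = 0) ->
  Ex (fun G => (\sum_(a | P a) T a G) ^+ 2) = \sum_(a | P a) Ex (fun G => T a G ^+ 2).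
Proof.
move=> orth.
transitivity (Ex (fun G => \sum_(a | P a) \sum_(b | P b) T a G * T b G)).
  by apply: eq_Ex => G _; rewrite expr2 mulr_suml; apply: eq_bigr => a _; rewrite mulr_sumr.
rewrite Ex_sum; apply: eq_bigr => a Pa; rewrite Ex_sum (bigD1 a) //= big1 ?addr0.
  by apply: eq_Ex => G _; rewrite expr2.
by move=> b /andP[Pb ba]; rewrite orth // eq_sym.
Qed.

End EdgeProbability.

(** * Quadratic forms in the edges at one vertex *)

Section QuadraticForm.
Variables (R : realType) (n : nat) (q : 'I_n -> 'I_n -> R) (i : 'I_n).
Local Notation edge := ('I_n * 'I_n)%type.
Implicit Types (G : {set edge}) (Y : {set edge} -> R) (j k : 'I_n).

Hypothesis q01 : forall j k, 0 <= q j k <= 1.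
Hypothesis qC : forall j k, q j k = q k j.
Local Notation pq := (fun e : edge => q e.1 e.2).
Local Notation E := (Ex pq).
Let pq01 (e : edge) : (e.1 < e.2)%N -> 0 <= pq e <= 1.
Proof. by move=> _; exact: q01. Qed.

Definition star j : edge := if (i < j)%N then (i, j) else (j, i).

(** Independence of the edges at [i], in the form that [Ex_edge] asks for. *)
Definition star_free (T : Type) (Y : {set edge} -> T) :=
  forall j G, j != i -> Y (star j |: G) = Y (G :\ star j).

Lemma star_lt j : j != i -> ((star j).1 < (star j).2)%N.
Proof.
move=> ji; rewrite /star; case: (ltnP i j) => [//|h] /=.
by rewrite ltn_neqAle (inj_eq val_inj) ji.
Qed.

Lemma q_star j : pq (star j) = q i j.
Proof. by rewrite /star; case: ifP. Qed.

Lemma star_eq j k : j != i -> (star j == star k) = (j == k).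
Proof.
move=> ji; apply/eqP/eqP => [|-> //]; rewrite /star.
by case: ifP => _; case: ifP => _ [] // ? ?; subst; rewrite ?eqxx in ji.
Qed.

Definition centred j G : R := (star j \in G)%:R - q i j.

Lemma centred_off j k G : j != i -> j != k ->
  centred k (star j |: G) = centred k (G :\ star j).
Proof.
move=> ji jk; by rewrite /centred !inE eq_sym star_eq // (negbTE jk).
Qed.

Lemma Ex_star (phi : R -> R) j Y : j != i ->
  (forall G, Y (star j |: G) = Y (G :\ star j)) ->
  E (fun G => phi (centred j G) * Y G) =
  (q i j * phi (1 - q i j) + (1 - q i j) * phi (- q i j)) * E Y.
Proof.
move=> ji Yf.
rewrite (@Ex_edge _ _ pq (star j) (fun b => phi (b%:R - q i j))) ?star_lt //.
by rewrite q_star sub0r.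
Qed.

Variables (c C kappa L : R).
Hypothesis c_gt0 : 0 < c.
Hypothesis L_gt0 : 0 < L.
Hypothesis q_kappa : forall j k, q j k <= kappa.
Hypothesis cq_le : forall j k, c * q j k <= C / n%:R.

(** Together with [drift] below, this splits an entry in row [i] of the scaled adjacency matrix into
    a centred part and its mean; [nvar] is the variance. *)
Definition noise j G := Num.sqrt c * centred j G.
Definition nvar j := c * (q i j * (1 - q i j)).

Let n_gt0 : (0 < n)%N. Proof. exact: leq_ltn_trans (ltn_ord i). Qed.
Let nR_gt0 : 0 < n%:R :> R. Proof. by rewrite ltr0n. Qed.
Let c_ge0 : 0 <= c. Proof. exact: ltW. Qed.
Let L_ge0 : 0 <= L. Proof. exact: ltW. Qed.
Let nR_ge0 : 0 <= n%:R :> R. Proof. exact: ltW. Qed.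
Let C_ge0 : 0 <= C.
Proof.
have : 0 <= C / n%:R.
  by apply: le_trans (cq_le i i); case/andP: (q01 i i) => h _; rewrite mulr_ge0 //.
by rewrite pmulr_lge0 ?invr_gt0.
Qed.
Let kappa_ge0 : 0 <= kappa.
Proof. by case/andP: (q01 i i) => h _; apply: le_trans h (q_kappa i i). Qed.
Let sqc : Num.sqrt c ^+ 2 = c. Proof. by rewrite sqr_sqrtr. Qed.

Lemma nvar_ge0 j : 0 <= nvar j.
Proof. by case/andP: (q01 i j) => h1 h2; rewrite !mulr_ge0 ?subr_ge0 //. Qed.

Lemma nvar_le j : nvar j <= C / n%:R.
Proof.
case/andP: (q01 i j) => h1 h2; apply: le_trans (cq_le i j).
by rewrite ler_wpM2l // ler_piMr // lerBlDr lerDl.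
Qed.

Lemma Ex_noise j Y : j != i -> (forall G, Y (star j |: G) = Y (G :\ star j)) ->
  E (fun G => noise j G * Y G) = 0.
Proof.
move=> ji Yf; rewrite /noise (Ex_star (fun x => Num.sqrt c * x)) //.
by apply/eqP; rewrite mulf_eq0; apply/orP; left; apply/eqP; ring.
Qed.

Lemma Ex_noise_sqr j Y : j != i -> (forall G, Y (star j |: G) = Y (G :\ star j)) ->
  E (fun G => noise j G ^+ 2 * Y G) = nvar j * E Y.
Proof.
move=> ji Yf; rewrite /noise (Ex_star (fun x => (Num.sqrt c * x) ^+ 2)) //.
by rewrite /nvar !exprMn sqc; congr (_ * _); ring.
Qed.

Lemma Ex_noise_sqr_centred j Y : j != i ->
  (forall G, Y (star j |: G) = Y (G :\ star j)) ->
  E (fun G => (noise j G ^+ 2 - nvar j) * Y G) = 0.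
Proof.
move=> ji Yf; rewrite /noise (Ex_star (fun x => (Num.sqrt c * x) ^+ 2 - nvar j)) //.
by rewrite /nvar !exprMn sqc; apply/eqP; rewrite mulf_eq0; apply/orP; left; apply/eqP; ring.
Qed.

(** The squared entry is of order [c] with probability [q], so its variance is of order
    [c * (c * q)]. The spare factor [c], which tends to 0 in the model, is what makes the squares
    concentrate. *)
Lemma Ex_noise_four j Y : j != i ->
  (forall G, Y (star j |: G) = Y (G :\ star j)) -> (forall G, 0 <= Y G) ->
  E (fun G => (noise j G ^+ 2 - nvar j) ^+ 2 * Y G) <= c * (C / n%:R) * E Y.
Proof.
move=> ji Yf Y0; rewrite /noise (Ex_star (fun x => ((Num.sqrt c * x) ^+ 2 - nvar j) ^+ 2)) //.
rewrite ler_wpM2r ?Ex_ge0 // !exprMn sqc /nvar.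
apply: le_trans (_ : c * (c * q i j) <= _); last by rewrite ler_wpM2l //.
case/andP: (q01 i j); set a := q i j => h1 h2.
have -> : a * (c * (1 - a) ^+ 2 - c * (a * (1 - a))) ^+ 2 +
    (1 - a) * (c * (- a) ^+ 2 - c * (a * (1 - a))) ^+ 2 =
    c * (c * a) * ((1 - a) * (1 - 2 * a) ^+ 2) by ring.
rewrite ler_piMr //; first by rewrite !mulr_ge0 //.
have : (1 - a) * (1 - 2 * a) ^+ 2 <= 1 * 1 by rewrite ler_pM ?sqr_ge0 //; nra.
by rewrite mulr1.
Qed.

Variable M : {set edge} -> 'M[R]_n.
Hypothesis Mfree : star_free M.
Hypothesis Msym : forall G j k, M G j k = M G k j.
Hypothesis Mop : forall G (v : 'I_n -> R),
  \sum_k (\sum_j v j * M G j k) ^+ 2 <= L ^+ 2 * \sum_j v j ^+ 2.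

Lemma op_row G j : \sum_k M G j k ^+ 2 <= L ^+ 2.
Proof.
have s1 (F : 'I_n -> R) : \sum_a (a == j)%:R * F a = F j.
  rewrite (bigD1 j) //= eqxx mul1r big1 ?addr0 // => a /negbTE ->.
  by rewrite mul0r.
have := Mop G (fun a => (a == j)%:R).
under eq_bigr => k _ do rewrite s1.
under [X in _ * X]eq_bigr => k _ do rewrite expr2.
by rewrite s1 eqxx mulr1.
Qed.

Lemma op_entry G j k : M G j k ^+ 2 <= L ^+ 2.
Proof.
apply: le_trans (op_row G j); rewrite (bigD1 k) //= lerDl sumr_ge0 // => a _.
exact: sqr_ge0.
Qed.

Lemma op_quad G (v : 'I_n -> R) :
  (\sum_k \sum_j v j * v k * M G j k) ^+ 2 <= (L * \sum_j v j ^+ 2) ^+ 2.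
Proof.
have v0 : 0 <= \sum_j v j ^+ 2 by apply: sumr_ge0 => j _; exact: sqr_ge0.
rewrite -[leLHS]real_normK ?num_real // ler_pXn2r ?nnegrE ?mulr_ge0 //.
pose w k := \sum_j v j * M G j k.
have -> : \sum_k \sum_j v j * v k * M G j k = \sum_k w k * v k.
  by apply: eq_bigr => k _; rewrite mulr_suml; apply: eq_bigr => j _; rewrite mulrAC.
apply: le_trans (_ : \sum_k (w k ^+ 2 / (2 * L) + L / 2 * v k ^+ 2) <= _).
  apply: le_trans (ler_norm_sum _ _ _) _; apply: ler_sum => k _.
  rewrite normrM -(real_normK (num_real (w k))) -(real_normK (num_real (v k))).
  set a := `|w k|; set b := `|v k|; rewrite -subr_ge0.
  have -> : a ^+ 2 / (2 * L) + L / 2 * b ^+ 2 - a * b = (a - L * b) ^+ 2 / (2 * L).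
    by field; rewrite gt_eqF.
  by rewrite divr_ge0 ?sqr_ge0 // mulr_ge0 //.
rewrite big_split /= -mulr_suml -mulr_sumr.
apply: le_trans (_ : L ^+ 2 * (\sum_j v j ^+ 2) / (2 * L) + L / 2 * \sum_j v j ^+ 2 <= _).
  by rewrite lerD2r ler_wpM2r ?Mop // invr_ge0 mulr_ge0 //.
rewrite le_eqVlt; apply/orP; left; apply/eqP; field; by rewrite gt_eqF.
Qed.

Definition drift j := Num.sqrt c * q i j.

(** Four pieces of the centred quadratic form: squared noise, noise times noise, noise times drift,
    drift times drift. The first three are sums of uncorrelated terms; the last is small because the
    drift is. *)
Definition diag_part G := \sum_(j | j != i) (noise j G ^+ 2 - nvar j) * M G j j.
Definition off_part G := \sum_(jk : edge | [&& jk.1 != i, jk.2 != i & (jk.1 < jk.2)%N])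
   noise jk.1 G * noise jk.2 G * M G jk.1 jk.2.
Definition lin_part G := \sum_(k | k != i) noise k G * (\sum_(j | j != i) drift j * M G j k).
Definition cst_part G := \sum_(k | k != i) \sum_(j | j != i) drift j * drift k * M G j k.

Lemma Mfree_on j G : j != i -> M (star j |: G) = M (G :\ star j).
Proof. by move=> ji; apply: Mfree. Qed.

Lemma Ex_diag_part : E (fun G => diag_part G ^+ 2) <= c * C * L ^+ 2.
Proof.
rewrite /diag_part Ex_orthogonal => [|a b ai bi ab].
  apply: le_trans (_ : \sum_(j < n) c * (C / n%:R) * L ^+ 2 <= _); last first.
    rewrite sumr_const card_ord -[_ *+ n]mulr_natr le_eqVlt; apply/orP; left.
    by apply/eqP; field; rewrite gt_eqF.
  rewrite [leLHS]big_mkcond; apply: ler_sum => j _; case: ifP => ji; last first.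
    by rewrite !mulr_ge0 ?invr_ge0 ?sqr_ge0 //.
  under eq_Ex => G _ do rewrite exprMn.
  apply: le_trans (Ex_noise_four _ _ _) _ => //.
  - by move=> G; rewrite Mfree_on.
  - by move=> G; exact: sqr_ge0.
  - rewrite ler_wpM2l ?mulr_ge0 ?invr_ge0 // -[leRHS](Ex_cst pq).
    by apply: ler_Ex => // G _; apply: op_entry.
under eq_Ex => G _ do rewrite -mulrA.
apply: Ex_noise_sqr_centred => // G.
by rewrite !Mfree_on // /noise centred_off.
Qed.

Lemma Ex_off_part : E (fun G => off_part G ^+ 2) <= C ^+ 2 * L ^+ 2 / n%:R.
Proof.
rewrite /off_part Ex_orthogonal => [|[j k] [l m] /= /and3P[ji ki jk] /and3P[li mi lm] ne].
  apply: le_trans (_ : \sum_(jk : edge) (C / n%:R) ^+ 2 * E (fun G => M G jk.1 jk.2 ^+ 2) <= _).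
    rewrite [leLHS]big_mkcond; apply: ler_sum => -[j k] _ /=.
    have EM0 : 0 <= E (fun G => M G j k ^+ 2) by apply: Ex_ge0 => // G _; exact: sqr_ge0.
    case: ifP => [/and3P[ji ki jk]|_]; last by rewrite mulr_ge0 // sqr_ge0.
    have jk' : j != k by apply: contraTneq jk => ->; rewrite ltnn.
    have -> : E (fun G => (noise j G * noise k G * M G j k) ^+ 2) =
       nvar j * (nvar k * E (fun G => M G j k ^+ 2)).
      under eq_Ex => G _ do rewrite exprMn exprMn -mulrA.
      rewrite (@Ex_noise_sqr j (fun G => noise k G ^+ 2 * M G j k ^+ 2)) //; last first.
        by move=> G; rewrite Mfree_on // /noise centred_off.
      by rewrite (@Ex_noise_sqr k (fun G => M G j k ^+ 2)) // => G; rewrite Mfree_on.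
    rewrite mulrA ler_wpM2r // expr2 ler_pM ?nvar_ge0 ?nvar_le //.
  rewrite -mulr_sumr -Ex_sum.
  apply: le_trans (_ : (C / n%:R) ^+ 2 * (n%:R * L ^+ 2) <= _); last first.
    by rewrite le_eqVlt; apply/orP; left; apply/eqP; field; rewrite gt_eqF.
  rewrite ler_wpM2l ?sqr_ge0 // -[leRHS](Ex_cst pq); apply: ler_Ex => // G _ /=.
  rewrite -(pair_bigA _ (fun j k => M G j k ^+ 2)) /=.
  apply: le_trans (_ : \sum_(j < n) L ^+ 2 <= _).
    by apply: ler_sum => j _; exact: op_row.
  by rewrite sumr_const card_ord mulr_natl.
(* Two distinct increasing pairs always leave an index that occurs only once; its noise factor is
   centred and independent of the others. *)
have lone a b : a != i -> a != b -> a != l -> a != m -> b != i ->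
    E (fun G => noise a G * (noise b G * M G j k * (noise l G * noise m G * M G l m))) = 0.
  move=> ai ab al am bi; apply: Ex_noise => // G.
  by rewrite !Mfree_on // /noise !centred_off.
have jk' : j != k by apply: contraTneq jk => ->; rewrite ltnn.
have [jl|jl] := eqVneq j l.
  have km : k != m by apply: contra_neq ne => ->; rewrite jl.
  have kl : k != l by rewrite -jl eq_sym.
  rewrite -[RHS](lone k j) // 1?eq_sym //.
  by apply: eq_Ex => G _; ring.
have [jm|jm] := eqVneq j m.
  have kl : k != l.
    apply/eqP => kl; move: jk; rewrite kl jm => ml.
    by have := ltn_trans lm ml; rewrite ltnn.
  have km : k != m by rewrite -jm eq_sym.
  rewrite -[RHS](lone k j) // 1?eq_sym //.
  by apply: eq_Ex => G _; ring.
rewrite -[RHS](lone j k) //.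
by apply: eq_Ex => G _; ring.
Qed.

(** Here the smallness of the edge probabilities enters: [kappa] bounds [q] and tends to 0 in the
    model, while the sum of the [c * q i j] stays below [C]. *)
Lemma drift2_le : \sum_(j | j != i) drift j ^+ 2 <= kappa * C.
Proof.
apply: le_trans (_ : \sum_(j < n) kappa * (C / n%:R) <= _); last first.
  rewrite sumr_const card_ord -[_ *+ n]mulr_natr le_eqVlt; apply/orP; left.
  by apply/eqP; field; rewrite gt_eqF.
rewrite [leLHS]big_mkcond; apply: ler_sum => j _; case: ifP => ji; last first.
  by rewrite !mulr_ge0 ?invr_ge0 //.
rewrite /drift exprMn sqc expr2 mulrCA; case/andP: (q01 i j) => h1 h2.
by rewrite ler_pM // mulr_ge0 //.
Qed.

(** Extending the drift by 0 at [i] turns sums over [j != i] into full sums, to which [Mop] and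
    [op_quad] apply. *)
Let v0 j := if j != i then drift j else 0.
Let v0_sum (F : 'I_n -> R) : \sum_(j | j != i) drift j * F j = \sum_j v0 j * F j.
Proof.
by rewrite big_mkcond; apply: eq_bigr => j _; rewrite /v0; case: ifP => //; rewrite mul0r.
Qed.
Let v0_norm : \sum_j v0 j ^+ 2 <= kappa * C.
Proof.
apply: le_trans drift2_le; rewrite [leRHS]big_mkcond; apply: ler_sum => j _.
by rewrite /v0; case: ifP => // _; rewrite expr0n.
Qed.

Lemma Ex_lin_part : E (fun G => lin_part G ^+ 2) <= C / n%:R * (L ^+ 2 * (kappa * C)).
Proof.
rewrite /lin_part Ex_orthogonal => [|a b ai bi ab].
  apply: le_trans (_ : \sum_(k < n) C / n%:R * E (fun G => (\sum_j v0 j * M G j k) ^+ 2) <= _).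
    rewrite [leLHS]big_mkcond; apply: ler_sum => k _.
    have EM0 : 0 <= E (fun G => (\sum_j v0 j * M G j k) ^+ 2).
      by apply: Ex_ge0 => // G _; exact: sqr_ge0.
    case: ifP => ki; last by rewrite mulr_ge0 // divr_ge0 //.
    under eq_Ex => G _ do rewrite exprMn v0_sum.
    rewrite (@Ex_noise_sqr k (fun G => (\sum_j v0 j * M G j k) ^+ 2)) //; last first.
      by move=> G; rewrite Mfree_on.
    by rewrite ler_wpM2r ?nvar_le.
  rewrite -mulr_sumr ler_wpM2l ?divr_ge0 // -Ex_sum -[leRHS](Ex_cst pq).
  apply: ler_Ex => // G _; apply: le_trans (Mop _ _) _.
  by rewrite ler_wpM2l ?sqr_ge0.
under eq_Ex => G _ do rewrite -mulrA.
apply: Ex_noise => // G.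
by rewrite !Mfree_on // /noise centred_off.
Qed.

Lemma cst_part_le G : cst_part G ^+ 2 <= (L * (kappa * C)) ^+ 2.
Proof.
have -> : cst_part G = \sum_k \sum_j v0 j * v0 k * M G j k.
  rewrite /cst_part big_mkcond; apply: eq_bigr => k _; case: ifP => ki.
    rewrite big_mkcond; apply: eq_bigr => j _; rewrite /v0 ki.
    by case: ifP => // _; rewrite !mul0r.
  by rewrite big1 // => j _; rewrite /v0 ki mulr0 mul0r.
apply: le_trans (op_quad _ _) _.
have s0 : 0 <= \sum_j v0 j ^+ 2 by apply: sumr_ge0 => j _; exact: sqr_ge0.
by rewrite ler_pXn2r ?nnegrE ?mulr_ge0 // ?ler_pM  //.
Qed.

Lemma quad_decomp G :
  \sum_(k | k != i) \sum_(j | j != i)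
     (noise j G + drift j) * (noise k G + drift k) * M G j k
  - \sum_(j | j != i) nvar j * M G j j =
  diag_part G + 2 * off_part G + 2 * lin_part G + cst_part G.
Proof.
have split3 (F : 'I_n -> 'I_n -> R) : (forall j k, F j k = F k j) ->
    \sum_(k | k != i) \sum_(j | j != i) F j k =
    \sum_(j | j != i) F j j +
    2 * \sum_(jk : edge | [&& jk.1 != i, jk.2 != i & (jk.1 < jk.2)%N]) F jk.1 jk.2.
  move=> Fs; rewrite pair_big /=.
  rewrite (bigID (fun jk : edge => jk.1 == jk.2)) /=; congr (_ + _).
    rewrite (reindex_onto (fun j : 'I_n => (j, j)) fst) /=; last first.
      by move=> [a b] /andP[_ /= /eqP <-].
    by apply: eq_bigl => j; rewrite !eqxx !andbT andbb.
  rewrite (bigID (fun jk : edge => (jk.1 < jk.2)%N)) /= mulrDl mul1r; congr (_ + _).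
    apply: eq_big => [[a b]|[a b] _] /=; last exact: Fs.
    rewrite -!andbA; congr andb; congr andb; apply/andP/idP => [[]//|h]; split=> //.
    by apply: contraTneq h => ->; rewrite ltnn.
  rewrite (reindex_onto (fun jk : edge => (jk.2, jk.1)) (fun jk : edge => (jk.2, jk.1))) /=.
    apply: eq_bigl => -[a b] /=; rewrite eqxx andbT -!andbA [RHS]andbCA; congr andb; congr andb.
    by rewrite -leqNgt eq_sym [RHS]ltn_neqAle.
  by move=> [].
have -> : \sum_(k | k != i) \sum_(j | j != i)
     (noise j G + drift j) * (noise k G + drift k) * M G j k =
   \sum_(k | k != i) \sum_(j | j != i) noise j G * noise k G * M G j k +
   2 * lin_part G + cst_part G.
  transitivity (\sum_(k | k != i) \sum_(j | j != i) noise j G * noise k G * M G j k +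
    (lin_part G + lin_part G) + cst_part G); last by rewrite mulr_natl mulr2n.
  rewrite {1}/lin_part [X in _ + (_ + X)](_ : _ =
    \sum_(k | k != i) \sum_(j | j != i) noise j G * (drift k * M G j k)); last first.
    rewrite exchange_big /=; apply: eq_bigr => k _; rewrite mulr_sumr.
    by apply: eq_bigr => j _; rewrite Msym.
  rewrite /cst_part -!big_split; apply: eq_bigr => k _.
  rewrite mulr_sumr -!big_split; apply: eq_bigr => j _ /=; ring.
rewrite split3; last by move=> j k; rewrite Msym [noise j G * _]mulrC.
rewrite /diag_part -/(off_part G).
set A := \sum_(j | j != i) noise j G * noise j G * _.
have -> : \sum_(j | j != i) (noise j G ^+ 2 - nvar j) * M G j j =
   A - \sum_(j | j != i) nvar j * M G j j.
  by rewrite -sumrB; apply: eq_bigr => j _; rewrite mulrBl expr2.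
ring.
Qed.

Lemma Ex_quad_form :
  E (fun G => (\sum_(k | k != i) \sum_(j | j != i)
     (noise j G + drift j) * (noise k G + drift k) * M G j k
  - \sum_(j | j != i) nvar j * M G j j) ^+ 2) <=
  4 * (c * C * L ^+ 2 + 4 * (C ^+ 2 * L ^+ 2 / n%:R)
       + 4 * (C / n%:R * (L ^+ 2 * (kappa * C))) + (L * (kappa * C)) ^+ 2).
Proof.
apply: le_trans (_ : E (fun G => 4 * (diag_part G ^+ 2 + (4 * off_part G ^+ 2
   + (4 * lin_part G ^+ 2 + cst_part G ^+ 2)))) <= _).
  apply: ler_Ex => // G _; rewrite quad_decomp.
  set a := diag_part G; set b := off_part G; set d := lin_part G; set e := cst_part G.
  (* Four times the sum of four squares exceeds the square of the sum by the six squared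
     differences. *)
  rewrite -subr_ge0.
  have -> : 4 * (a ^+ 2 + (4 * b ^+ 2 + (4 * d ^+ 2 + e ^+ 2))) -
    (a + 2 * b + 2 * d + e) ^+ 2 = (a - 2 * b) ^+ 2 + (a - 2 * d) ^+ 2 + (a - e) ^+ 2
     + (2 * b - 2 * d) ^+ 2 + (2 * b - e) ^+ 2 + (2 * d - e) ^+ 2 by ring.
  by rewrite !addr_ge0 ?sqr_ge0.
rewrite ExZ !ExD !ExZ ler_wpM2l // -!addrA lerD ?Ex_diag_part // lerD //.
  by rewrite ler_wpM2l ?Ex_off_part.
rewrite lerD // ?ler_wpM2l ?Ex_lin_part // -[leRHS](Ex_cst pq).
by apply: ler_Ex => // G _; apply: cst_part_le.
Qed.

End QuadraticForm.
(** * The self-consistent equation *)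

Section SelfConsistent.
Variables (R : realType) (n : nat) (q : 'I_n -> 'I_n -> R).
Local Notation K := R[i].
Local Notation toC := (real_complex R).
Local Notation edge := ('I_n * 'I_n)%type.
Implicit Types (G : {set edge}) (i j k : 'I_n).
Variables (c C kappa : R) (z : K).

Definition scaled_adj G : 'M[R]_n := Num.sqrt c *: adjacency R G.

Definition resg G i : K := resolvent (scaled_adj G) z i i.

(* The defect of the diagonal of the resolvent in the self-consistent equation
   -1/g_i = z + sum_j s_ij g_j, with s_ij = c q_ij = f_ij / n. *)
Definition qve_err G i : K :=
  - (resg G i)^-1 - z - \sum_j toC (c * q i j) * resg G j.

Hypothesis q01 : forall j k, 0 <= q j k <= 1.
Hypothesis qC : forall j k, q j k = q k j.
Hypothesis c_gt0 : 0 < c.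
Hypothesis z_gt0 : 0 < complex.Im z.
Hypothesis q_kappa : forall j k, q j k <= kappa.
Hypothesis cq_le : forall j k, c * q j k <= C / n%:R.
Local Notation pq := (fun e : edge => q e.1 e.2).
Local Notation eta := (complex.Im z).
Local Notation L := (eta^-1).
Local Notation E := (Ex pq).
Let pq01 (e : edge) : (e.1 < e.2)%N -> 0 <= pq e <= 1.
Proof. by move=> _; exact: q01. Qed.

Lemma scaled_adj_sym G : (scaled_adj G)^T = scaled_adj G.
Proof. by apply/matrixP => a b; rewrite !mxE orbC. Qed.

Lemma scaled_adj_diag G i : is_graph G -> scaled_adj G i i = 0.
Proof.
move=> /forallP /(_ (i, i)); rewrite ltnn implybF => /negbTE h.
by rewrite !mxE h mulr0.
Qed.

Lemma scaled_adj_star G i j : is_graph G -> j != i ->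
  scaled_adj G i j = noise q i c j G + drift q i c j.
Proof.
move=> /forallP gG ji; rewrite /noise /drift /centred -mulrDr subrK !mxE.
congr (_ * (nat_of_bool _)%:R); rewrite /star.
have gG1 := gG (i, j); have gG2 := gG (j, i).
case: ltnP => h.
  by move: gG2; rewrite /= ltnNge (ltnW h) /= implybF => /negbTE ->; rewrite orbF.
by move: gG1; rewrite /= ltnNge h /= implybF => /negbTE ->.
Qed.

Section Row.
Variable i : 'I_n.
Local Notation Gam G := (resolvent (minormx i (scaled_adj G)) z).

Lemma minor_star_free : star_free i (fun G => minormx i (scaled_adj G)).
Proof.
move=> j G ji; apply/matrixP => a b; rewrite !mxE.
have [//|ai] := eqVneq a i; have [//|bi] := eqVneq b i; rewrite /=.
have ne x y : x != i -> y != i -> ((x, y) == star i j) = false.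
  move=> xi yi; rewrite /star; case: ifP => _; apply/eqP => -[h1 h2];
  by rewrite ?h1 ?h2 eqxx in xi yi.
by rewrite !inE !ne.
Qed.

Lemma op_resolvent_minor G (v : 'I_n -> R) :
  \sum_k normc (\sum_j toC (v j) * Gam G j k) ^+ 2 <= L ^+ 2 * \sum_j v j ^+ 2.
Proof.
have := rnorm2_resolvent (minormx_sym i (scaled_adj_sym G)) z_gt0 (\row_j toC (v j)).
rewrite exprVn mulrC.
have -> : rnorm2 (\row_j toC (v j)) = \sum_j v j ^+ 2.
  by apply: eq_bigr => j _; rewrite mxE normc_toC real_normK ?num_real.
apply: le_trans; rewrite le_eqVlt; apply/orP; left; apply/eqP; apply: eq_bigr => k _.
by congr (normc _ ^+ 2); rewrite !mxE; apply: eq_bigr => j _; rewrite mxE.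
Qed.

Definition quad_err G : K :=
  \sum_(k | k != i) \sum_(j | j != i)
     toC ((noise q i c j G + drift q i c j) * (noise q i c k G + drift q i c k)) * Gam G j k
  - \sum_(j | j != i) toC (nvar q i c j) * Gam G j j.

Definition quad_bound : R := 4 * (c * C * L ^+ 2 + 4 * (C ^+ 2 * L ^+ 2 / n%:R)
       + 4 * (C / n%:R * (L ^+ 2 * (kappa * C))) + (L * (kappa * C)) ^+ 2).

(** [Ex_quad_form] concerns real matrices, so it is applied to the real and to the imaginary part of
    the minor's resolvent; each inherits the operator bound on real vectors. Hence the factor 2. *)
Lemma Ex_quad_err : E (fun G => normc (quad_err G) ^+ 2) <= 2 * quad_bound.
Proof.
have Lgt0 : 0 < L by rewrite invr_gt0.
under eq_Ex => G _ do rewrite normc2E.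
rewrite ExD mulr_natl mulr2n lerD //.
- apply: le_trans _ (Ex_quad_form (i := i) q01 qC c_gt0 Lgt0 q_kappa cq_le
    (M := fun G => map_mx (@complex.Re R) (Gam G)) _ _ _).
  + apply: ler_Ex => // G _; rewrite /quad_err ReD ReN !Re_sum le_eqVlt; apply/orP; left.
    apply/eqP; congr ((_ - _) ^+ 2).
      by apply: eq_bigr => k _; rewrite Re_sum; apply: eq_bigr => j _; rewrite ReZ !mxE.
    by apply: eq_bigr => j _; rewrite ReZ !mxE.
  + by move=> j G ji; rewrite minor_star_free.
  + by move=> G j k; rewrite !mxE resolvent_sym // minormx_sym // scaled_adj_sym.
  + move=> G v; apply: le_trans (op_resolvent_minor G v); apply: ler_sum => k _.
    rewrite normc2E -[leLHS]addr0 lerD ?sqr_ge0 // Re_sum le_eqVlt; apply/orP; left.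
    by apply/eqP; congr (_ ^+ 2); apply: eq_bigr => j _; rewrite ReZ !mxE.
apply: le_trans _ (Ex_quad_form (i := i) q01 qC c_gt0 Lgt0 q_kappa cq_le
    (M := fun G => map_mx (@complex.Im R) (Gam G)) _ _ _).
- apply: ler_Ex => // G _; rewrite /quad_err ImD ImN !Im_sum le_eqVlt; apply/orP; left.
  apply/eqP; congr ((_ - _) ^+ 2).
    by apply: eq_bigr => k _; rewrite Im_sum; apply: eq_bigr => j _; rewrite ImZ !mxE.
  by apply: eq_bigr => j _; rewrite ImZ !mxE.
- by move=> j G ji; rewrite minor_star_free.
- by move=> G j k; rewrite !mxE resolvent_sym // minormx_sym // scaled_adj_sym.
- move=> G v; apply: le_trans (op_resolvent_minor G v); apply: ler_sum => k _.
  rewrite normc2E -[leLHS]add0r lerD ?sqr_ge0 // Im_sum le_eqVlt; apply/orP; left.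
  by apply/eqP; congr (_ ^+ 2); apply: eq_bigr => j _; rewrite ImZ !mxE.
Qed.

Let n_gt0 : (0 < n)%N. Proof. exact: leq_ltn_trans (ltn_ord i). Qed.
Let nR_gt0 : 0 < n%:R :> R. Proof. by rewrite ltr0n. Qed.
Let cq_ge0 j k : 0 <= c * q j k.
Proof. by case/andP: (q01 j k) => h _; rewrite mulr_ge0 // ltW. Qed.
Let Cn_ge0 : 0 <= C / n%:R. Proof. exact: le_trans (cq_le i i). Qed.

(** Three corrections separate Schur's formula from the self-consistent equation: the variance is
    [c q (1 - q)] and not [c q], the minor's resolvent stands in place of the full one, and the sum
    omits [j = i]. *)
Lemma qve_errE G : is_graph G ->
  qve_err G i = quad_err G
    - \sum_(j | j != i) toC (c * q i j ^+ 2) * Gam G j j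
    - \sum_(j | j != i) toC (c * q i j) * (resg G j - Gam G j j)
    - toC (c * q i i) * resg G i.
Proof.
move=> gG; have hs := scaled_adj_sym G.
rewrite /qve_err /resg (schur_complement hs z_gt0 (scaled_adj_diag i gG)).
rewrite [z + _]addrC addrK /quad_err.
have -> : \sum_k \sum_b toC (scaled_adj G i b) * Gam G b k * toC (scaled_adj G i k) =
  \sum_(k | k != i) \sum_(j | j != i)
     toC ((noise q i c j G + drift q i c j) * (noise q i c k G + drift q i c k)) * Gam G j k.
  rewrite (bigD1 i) //= big1 ?add0r; last first.
    by move=> b _; rewrite scaled_adj_diag // rmorph0 mulr0.
  apply: eq_bigr => k ki; rewrite (bigD1 i) //= scaled_adj_diag // rmorph0 !mul0r add0r.
  apply: eq_bigr => j ji; rewrite !scaled_adj_star // rmorphM; ring.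
rewrite [X in _ - X = _](bigD1 i) //=.
set A := \sum_(k | _) _; set T := toC _ * _.
have -> : \sum_(j | j != i) toC (nvar q i c j) * Gam G j j =
   \sum_(j | j != i) toC (c * q i j) * Gam G j j - \sum_(j | j != i) toC (c * q i j ^+ 2) * Gam G j j.
  rewrite -sumrB; apply: eq_bigr => j _; rewrite -mulrBl -rmorphB /nvar; congr (toC _ * _); ring.
have -> : \sum_(j | j != i) toC (c * q i j) * (resolvent (scaled_adj G) z j j - Gam G j j) =
   \sum_(j | j != i) toC (c * q i j) * resolvent (scaled_adj G) z j j
   - \sum_(j | j != i) toC (c * q i j) * Gam G j j.
  by rewrite -sumrB; apply: eq_bigr => j _; rewrite mulrBr.
ring.
Qed.

Lemma sum_cq_le (F : 'I_n -> R) (B : R) (P : pred 'I_n) :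
  (forall j, 0 <= F j) -> \sum_j F j <= B -> \sum_(j | P j) c * q i j * F j <= C / n%:R * B.
Proof.
move=> F0 FB; apply: le_trans (_ : C / n%:R * \sum_j F j <= _); last by rewrite ler_wpM2l.
rewrite mulr_sumr [leLHS]big_mkcond; apply: ler_sum => j _.
by case: ifP => _; [exact: ler_wpM2r|exact: mulr_ge0].
Qed.

Lemma qve_err_le G : is_graph G ->
  normc (qve_err G i) <= normc (quad_err G) + (kappa * C * L + 2 * (C / n%:R) * L).
Proof.
move=> gG; have hs := scaled_adj_sym G; rewrite qve_errE //.
have Lge0 : 0 <= L by rewrite invr_ge0 ltW.
have hG j : normc (Gam G j j) <= L.
  by apply: normc_resolvent_le z_gt0 _; rewrite minormx_sym // scaled_adj_sym.
have tri (a b : K) : normc (a - b) <= normc a + normc b.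
  by apply: le_trans (le_normcD _ _) _; rewrite normcN'.
apply: le_trans (tri _ _) _; have -> : normc (quad_err G) + (kappa * C * L + 2 * (C / n%:R) * L) =
    normc (quad_err G) + kappa * C * L + C / n%:R * L + C / n%:R * L by ring.
rewrite lerD //; last first.
  rewrite normcM normc_toC ger0_norm // ler_pM ?normc_ge0 // ?normc_resolvent_le //.
apply: le_trans (tri _ _) _; rewrite lerD //; last first.
  apply: le_trans (ler_normc_sum _ _ _) _.
  under eq_bigr => j ji do rewrite normcM normc_toC ger0_norm // (resolvent_minor_diag hs z_gt0 ji).
  set g := resolvent (scaled_adj G) z i i.
  have g0 : g != 0 by apply: resolvent_neq0.
  have ng : 0 < normc g.
    rewrite lt_def normc_ge0 andbT; apply/eqP => /eq0_normc /eqP; by rewrite (negbTE g0).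
  apply: (@sum_cq_le (fun j => normc (resolvent (scaled_adj G) z i j ^+ 2 / g))).
    by move=> j; exact: normc_ge0.
  under eq_bigr => j _ do rewrite normcM normcV expr2 normcM -expr2.
  (* By the Ward identity the squared row sum is [Im g / eta], at most [normc g / eta]. *)
  rewrite -mulr_suml ler_pdivrMr // -(ler_pM2l z_gt0) ward // mulrA divff ?gt_eqF // mul1r.
  exact: le_trans (ler_norm _) (ler_Im_normc _).
apply: le_trans (tri _ _) _; rewrite lerD //.
apply: le_trans (ler_normc_sum _ _ _) _.
apply: le_trans (_ : \sum_(j | j != i) c * q i j * (kappa * L) <= _).
  apply: ler_sum => j _; rewrite normcM normc_toC.
  case/andP: (q01 i j) => h1 h2.
  rewrite ger0_norm ?mulr_ge0 ?exprn_ge0 //; last exact: ltW.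
  set x := normc _; have -> : c * q i j ^+ 2 * x = c * q i j * (q i j * x) by ring.
  by apply: ler_wpM2l => //; apply: ler_pM => //; [exact: normc_ge0|exact: hG].
have kL0 : 0 <= kappa * L.
  by rewrite mulr_ge0 //; case/andP: (q01 i i) => h1 _; apply: le_trans h1 (q_kappa i i).
apply: le_trans (sum_cq_le (B := n%:R * (kappa * L)) _ _ _) _ => //.
  by rewrite sumr_const card_ord mulr_natl.
rewrite le_eqVlt; apply/orP; left; apply/eqP; field; by rewrite !gt_eqF.
Qed.

(** From [(a + D)^2 <= 2 a^2 + 2 D^2], with the mean of [a^2] at most [2 * quad_bound]. *)
Definition err_bound : R :=
  4 * quad_bound + 2 * (kappa * C * L + 2 * (C / n%:R) * L) ^+ 2.

Lemma Ex_qve_err : E (fun G => normc (qve_err G i) ^+ 2) <= err_bound.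
Proof.
set D := kappa * C * L + 2 * (C / n%:R) * L.
apply: le_trans (_ : E (fun G => 2 * normc (quad_err G) ^+ 2 + 2 * D ^+ 2) <= _).
  apply: ler_Ex => // G gG; have h := qve_err_le gG.
  apply: le_trans (_ : (normc (quad_err G) + D) ^+ 2 <= _).
    by rewrite ler_pXn2r // ?nnegrE ?normc_ge0 //; apply: le_trans (normc_ge0 _) h.
  rewrite -subr_ge0; set a := normc _.
  have -> : 2 * a ^+ 2 + 2 * D ^+ 2 - (a + D) ^+ 2 = (a - D) ^+ 2 by ring.
  exact: sqr_ge0.
rewrite ExD [X in X + _]ExZ Ex_cst /err_bound -/D lerD2r.
have -> : 4 * quad_bound = 2 * (2 * quad_bound) by ring.
by rewrite ler_wpM2l // Ex_quad_err.
Qed.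

End Row.
End SelfConsistent.

(** * Spectral sums as traces *)

Section Spectrum.
Variables (R : realType) (n : nat) (H : 'M[R]_n).
Local Notation K := R[i].
Local Notation toC := (real_complex R).
Hypothesis Hsym : H^T = H.

Lemma char_poly_conj (F : fieldType) (P D : 'M[F]_n) : P \in unitmx ->
  char_poly (invmx P *m D *m P) = char_poly D.
Proof.
move=> Pu; rewrite /char_poly /char_poly_mx.
have -> : 'X%:M - map_mx polyC (invmx P *m D *m P) =
    map_mx polyC (invmx P) *m ('X%:M - map_mx polyC D) *m map_mx polyC P.
  rewrite mulmxBr mulmxBl !map_mxM; congr (_ - _).
  by rewrite scalar_mxC -mulmxA -map_mxM mulVmx // map_mx1 mulmx1.
rewrite !det_mulmx mulrAC -det_mulmx -map_mxM mulVmx // map_mx1 det1 mul1r.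
by [].
Qed.

(** Spectral theorem for the Hermitian complexification of [H]. Its real diagonal splits
    [char_poly H], so the choice in [spectrum] is a genuine factorisation, and uniqueness of roots
    makes it agree with the diagonal up to order. *)
Lemma spectrum_diag : exists (P : 'M[K]_n) (d : 'rV[R]_n),
  [/\ P \in unitmx, map_mx toC H = invmx P *m diag_mx (map_mx toC d) *m P &
   perm_eq (spectrum H) [seq d 0 j | j <- enum 'I_n]].
Proof.
set HC := map_mx toC H.
have Hherm : HC \is hermsymmx.
  apply: realsym_hermsym.
    apply/is_hermitianmxP; rewrite expr0 scale1r map_mx_id //.
    by rewrite /HC map_trmx Hsym.
  by apply/mxOverP => i j; rewrite mxE; apply/complex_realP; exists (H i j).
have /orthomx_spectralP E := hermitian_normalmx Hherm.
have /mxOverP Dr := hermitian_spectral_diag_real Hherm.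
set P := spectralmx HC in E; set D := spectral_diag HC in E Dr.
pose d : 'rV[R]_n := map_mx (@complex.Re R) D.
have DE : D = map_mx toC d.
  by apply/matrixP => a b; rewrite !mxE RRe_real.
exists P, d; rewrite -DE; split => //; first exact: spectral_unit.
have cp : char_poly H = \prod_(x <- [seq d 0 j | j <- enum 'I_n]) ('X - x%:P).
  apply: (map_poly_inj (real_complex R)).
  rewrite map_char_poly -/HC E char_poly_conj ?spectral_unit // char_poly_trig.
    rewrite big_map big_enum rmorph_prod; apply: eq_bigr => j _ /=.
    by rewrite rmorphB /= map_polyX map_polyC /= mxE eqxx mulr1n DE mxE.
  exact: diag_mx_is_trig.
have [_ sp] : size (spectrum H) = n /\
    char_poly H = \prod_(x <- spectrum H) ('X - x%:P).
  rewrite /spectrum; case: xgetP => [s -> //|/(_ [seq d 0 j | j <- enum 'I_n]) []].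
  by split=> //; rewrite size_map size_enum_ord.
by apply: prod_XsubC_eq; rewrite -sp cp.
Qed.

Lemma sum_spectrum (V : zmodType) (F : R -> V) (d : 'rV[R]_n) :
  perm_eq (spectrum H) [seq d 0 j | j <- enum 'I_n] ->
  \sum_(x <- spectrum H) F x = \sum_j F (d 0 j).
Proof. by move=> /(perm_big _) ->; rewrite big_map big_enum. Qed.

Lemma size_spectrum : size (spectrum H) = n.
Proof.
by have [P [d [_ _ /perm_size ->]]] := spectrum_diag; rewrite size_map size_enum_ord.
Qed.

Lemma sum_spectrum_sqr : \sum_(x <- spectrum H) x ^+ 2 = \sum_i \sum_j H i j ^+ 2.
Proof.
have [P [d [Pu E /sum_spectrum ->]]] := spectrum_diag.
apply: (@complexI R); rewrite !rmorph_sum.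
transitivity (\tr (diag_mx (map_mx toC d) *m diag_mx (map_mx toC d))).
  by rewrite mulmx_diag mxtrace_diag; apply: eq_bigr => j _; rewrite !mxE rmorphXn expr2.
transitivity (\tr (map_mx toC H *m map_mx toC H)).
  rewrite E -!mulmxA mulKVmx // [RHS]mxtrace_mulC -!mulmxA mulmxV // mulmx1.
  by [].
apply: eq_bigr => i _; rewrite mxE rmorph_sum; apply: eq_bigr => j _.
by rewrite !mxE (Hsym_entry Hsym j) rmorphXn expr2.
Qed.

Lemma sum_spectrum_resolvent (z : K) : 0 < complex.Im z ->
  \sum_(x <- spectrum H) (toC x - z)^-1 = \sum_i resolvent H z i i.
Proof.
move=> z0; have [P [d [Pu E /sum_spectrum ->]]] := spectrum_diag.
have dz j : toC (d 0 j) - z != 0.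
  apply/eqP => h; have := congr1 (@complex.Im R) h.
  by rewrite ImD ImN /= sub0r => /eqP; rewrite oppr_eq0 gt_eqF.
pose Dz : 'rV[K]_n := \row_j (toC (d 0 j) - z).
pose Dv : 'rV[K]_n := \row_j (toC (d 0 j) - z)^-1.
have S : shiftmx H z = invmx P *m diag_mx Dz *m P.
  rewrite /shiftmx E; have -> : z%:M = invmx P *m z%:M *m P.
    by rewrite scalar_mxC -mulmxA mulVmx // mulmx1.
  rewrite -mulmxBl -mulmxBr; congr (_ *m _ *m _).
  by apply/matrixP => a b; rewrite !mxE -mulrnBl.
have DD : diag_mx Dv *m diag_mx Dz = 1%:M.
  rewrite mulmx_diag; apply/matrixP => a b; rewrite !mxE.
  by rewrite mulVf.
have -> : resolvent H z = invmx P *m diag_mx Dv *m P.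
  apply: (can_inj (mulmxK (shiftmx_unit Hsym z0))).
  rewrite resolventV // S -!mulmxA mulKVmx // [diag_mx Dv *m _]mulmxA DD mul1mx.
  by rewrite mulVmx.
transitivity (\tr (diag_mx Dv)).
  by rewrite mxtrace_diag; apply: eq_bigr => j _; rewrite mxE.
by rewrite -[RHS]/(\tr _) mxtrace_mulC mulmxA mulmxV // mul1mx.
Qed.

End Spectrum.

(** * Stability of the self-consistent equation across grids *)

Section Coupling.
Variable R : realType.
Local Notation K := R[i].
Local Notation toC := (real_complex R).

Definition qve_defect n (f : 'I_n -> 'I_n -> R) (z : K) (u : 'I_n -> K) i : K :=
  - (u i)^-1 - z - \sum_j toC (f i j / n%:R) * u j.

(** All fibres of [a] have the same size, said through sums so that averages of real and of complex
    functions transfer without counting. *)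
Definition uniform_map n M (a : 'I_M -> 'I_n) :=
  forall (V : zmodType) (F : 'I_n -> V), (\sum_k F (a k)) *+ n = (\sum_j F j) *+ M.

Lemma uniform_map_avg n M (a : 'I_M -> 'I_n) (F : 'I_n -> R) :
  (0 < n)%N -> (0 < M)%N ->
  uniform_map a -> M%:R^-1 * (\sum_k F (a k)) = n%:R^-1 * \sum_j F j.
Proof.
move=> n0 M0 ha; have nR : n%:R != 0 :> R by rewrite pnatr_eq0 -lt0n.
have MR : M%:R != 0 :> R by rewrite pnatr_eq0 -lt0n.
have h : (\sum_k F (a k)) * n%:R = (\sum_j F j) * M%:R by rewrite !mulr_natr; exact: ha.
apply: (mulIf nR); rewrite -mulrA h; field; exact/andP.
Qed.

Lemma uniform_map_avgC n M (a : 'I_M -> 'I_n) (F : 'I_n -> K) :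
  (0 < n)%N -> (0 < M)%N ->
  uniform_map a -> toC M%:R^-1 * (\sum_k F (a k)) = toC n%:R^-1 * \sum_j F j.
Proof.
move=> n0 M0 ha; have nR : n%:R != 0 :> K by rewrite pnatr_eq0 -lt0n.
have MR : M%:R != 0 :> K by rewrite pnatr_eq0 -lt0n.
rewrite !fmorphV !rmorph_nat.
have h : (\sum_k F (a k)) * n%:R = (\sum_j F j) * M%:R by rewrite !mulr_natr; exact: ha.
apply: (mulIf nR); rewrite -mulrA h; field; exact/andP.
Qed.

(* The equation is contracting when L^2 C <= 1/2; the two grids are compared
   through the common refinement of size M. *)
Lemma qve_contraction n n' M (a : 'I_M -> 'I_n) (a' : 'I_M -> 'I_n')
   (f : 'I_n -> 'I_n -> R) (f' : 'I_n' -> 'I_n' -> R) z u u' (C L w : R) :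
  (0 < n)%N -> (0 < n')%N -> (0 < M)%N -> uniform_map a -> uniform_map a' ->
  (forall i j, 0 <= f i j <= C) -> 0 <= L -> L ^+ 2 * C <= 2^-1 ->
  (forall k l, `|f (a k) (a l) - f' (a' k) (a' l)| <= w) ->
  (forall i, u i != 0) -> (forall i, u' i != 0) ->
  (forall i, normc (u i) <= L) -> (forall i, normc (u' i) <= L) ->
  normc (toC n%:R^-1 * (\sum_i u i) - toC n'%:R^-1 * (\sum_i u' i)) <=
  2 * L ^+ 2 * (w * L + n%:R^-1 * (\sum_i normc (qve_defect f z u i))
      + n'%:R^-1 * (\sum_i normc (qve_defect f' z u' i))).
Proof.
move=> n0 n'0 M0 ha ha' f0 L0 LC hw u0 u'0 uL u'L.
set e := \sum_i normc (qve_defect f z u i).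
set e' := \sum_i normc (qve_defect f' z u' i).
have C0 : 0 <= C by case/andP: (f0 (Ordinal n0) (Ordinal n0)); exact: le_trans.
have MR : 0 < M%:R :> R by rewrite ltr0n.
have M1 : 0 <= M%:R^-1 :> R by rewrite invr_ge0 ltW.
pose D : R := M%:R^-1 * \sum_k normc (u (a k) - u' (a' k)).
have SE m (b : 'I_M -> 'I_m) (g : 'I_m -> 'I_m -> R) v i : (0 < m)%N -> uniform_map b ->
    \sum_j toC (g i j / m%:R) * v j = toC M%:R^-1 * \sum_l toC (g i (b l)) * v (b l).
  move=> m0 hb; rewrite (uniform_map_avgC (fun j => toC (g i j) * v j) m0 M0 hb) mulr_sumr.
  by apply: eq_bigr => j _; rewrite rmorphM; ring.
have point k : normc (u (a k) - u' (a' k)) <=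
    L ^+ 2 * ((C * D + w * L) + (normc (qve_defect f z u (a k)) + normc (qve_defect f' z u' (a' k)))).
  (* The identity [x - y = x y (1/y - 1/x)]; the equation rewrites both reciprocals and [z]
     cancels. *)
  have -> : u (a k) - u' (a' k) = u (a k) * u' (a' k) *
      (toC M%:R^-1 * (\sum_l (toC (f (a k) (a l)) * u (a l) - toC (f' (a' k) (a' l)) * u' (a' l)))
       + (qve_defect f z u (a k) - qve_defect f' z u' (a' k))).
    rewrite sumrB mulrBr -(SE _ a) // -(SE _ a') // /qve_defect.
    set S := \sum_j _; set S' := \sum_j _.
    have := u0 (a k); have := u'0 (a' k); set x := u _; set y := u' _ => y0 x0.
    by field; rewrite y0 x0.
  rewrite !normcM expr2 -2!mulrA; apply: ler_pM; rewrite ?normc_ge0 //.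
    by rewrite mulr_ge0 ?normc_ge0.
  apply: ler_pM; rewrite ?normc_ge0 //.
  apply: le_trans (le_normcD _ _) _; apply: lerD; last first.
    by apply: le_trans (le_normcD _ _) _; rewrite normcN'.
  rewrite normcM normc_toC ger0_norm // /D mulrCA.
  have -> : w * L = M%:R^-1 * \sum_(k < M) w * L.
    by rewrite sumr_const card_ord -mulr_natr; field; rewrite gt_eqF.
  rewrite mulr_sumr -mulrDr ler_wpM2l // -big_split /=.
  apply: le_trans (ler_normc_sum _ _ _) _; apply: ler_sum => l _.
  have -> : toC (f (a k) (a l)) * u (a l) - toC (f' (a' k) (a' l)) * u' (a' l) =
    toC (f (a k) (a l)) * (u (a l) - u' (a' l))
    + toC (f (a k) (a l) - f' (a' k) (a' l)) * u' (a' l) by rewrite rmorphB; ring.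
  apply: le_trans (le_normcD _ _) _; rewrite !normcM !normc_toC.
  have /andP[fl fC] := f0 (a k) (a l).
  apply: lerD; first by rewrite ger0_norm // ler_wpM2r // normc_ge0.
  by apply: ler_pM; rewrite ?normc_ge0.
have De : D <= L ^+ 2 * ((C * D + w * L) + (n%:R^-1 * e + n'%:R^-1 * e')).
  rewrite {1}/D -(uniform_map_avg _ n0 M0 ha) -(uniform_map_avg _ n'0 M0 ha').
  have -> : C * D + w * L = M%:R^-1 * \sum_(k < M) (C * D + w * L).
    by rewrite sumr_const card_ord -mulr_natr; field; rewrite gt_eqF.
  rewrite -2!mulrDr -2!big_split /= mulrCA ler_wpM2l // mulr_sumr.
  by apply: ler_sum => k _.
have D0 : 0 <= D.
  by rewrite mulr_ge0 // sumr_ge0 // => k _; exact: normc_ge0.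
apply: le_trans (_ : D <= _).
  rewrite -(uniform_map_avgC u n0 M0 ha) -(uniform_map_avgC u' n'0 M0 ha').
  rewrite -mulrBr -sumrB normcM normc_toC ger0_norm // ler_wpM2l //.
  exact: ler_normc_sum.
(* Absorption: [L^2 C <= 1/2] moves half of [D] to the left, whence the factor 2 in the bound. *)
have h : L ^+ 2 * (C * D) <= 2^-1 * D by rewrite mulrA ler_wpM2r.
move: De; set T := w * L + _ + _.
have -> : C * D + w * L + (n%:R^-1 * e + n'%:R^-1 * e') = C * D + T by rewrite /T !addrA.
rewrite mulrDr -mulrA => De; lra.
Qed.

Lemma uniform_map_id n : uniform_map (@id 'I_n).
Proof. by []. Qed.

Lemma sum_divn (V : zmodType) (F : nat -> V) n m : (0 < m)%N ->
  \sum_(k < n * m) F (k %/ m)%N = (\sum_(i < n) F i) *+ m.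
Proof.
move=> m0; rewrite -(big_mkord xpredT (fun k => F (k %/ m)%N)) -(big_mkord xpredT F).
elim: n => [|n IH]; first by rewrite mul0n !big_nil mul0rn.
rewrite mulSn addnC (big_cat_nat (n := (n * m)%N)) //=; last by rewrite leq_addr.
rewrite IH big_nat_recr //= mulrnDl; congr (_ + _).
rewrite -{1}[(n * m)%N]add0n big_addn addKn.
rewrite (eq_big_nat _ _ (F2 := fun=> F n)) ?sumr_const_nat ?subn0 // => k /andP[_ km].
by rewrite divnDMl // divn_small // add0n.
Qed.

Lemma uniform_map_div n m M (a : 'I_M -> 'I_n) : (0 < m)%N -> M = (n * m)%N ->
  (forall k, a k = (k %/ m)%N :> nat) -> uniform_map a.
Proof.
move=> m0 ME aE V F; subst M.
have n0 : (0 < n)%N \/ n = 0%N by case: (n); [right|left].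
case: n0 => [n0|n0]; last by subst n; rewrite mulr0n mul0n mulr0n.
(* Extends [F] to all naturals, with an arbitrary value beyond [n], to reach the form of
   [sum_divn]. *)
pose F' k := F (insubd (Ordinal n0) k).
have FE (i : 'I_n) : F i = F' i.
  by rewrite /F'; congr F; apply: val_inj; rewrite val_insubd ltn_ord.
have -> : \sum_k F (a k) = \sum_(k < n * m) F' (k %/ m)%N.
  by apply: eq_bigr => k _; rewrite FE aE.
rewrite sum_divn // (eq_bigr _ (fun i _ => FE i)).
by rewrite -mulrnA mulnC.
Qed.

End Coupling.

(** * Continuous functions on the unit square *)

Section UnitSquare.
Variables (R : realType) (f : R -> R -> R).
Local Notation sq := [set p : R * R | p.1 \in `[0, 1] /\ p.2 \in `[0, 1]].
Hypothesis f_cont : {within sq, continuous (fun p : R * R => f p.1 p.2)}.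

Lemma compact_square : compact sq.
Proof.
have -> : sq = [set` `[(0 : R), 1]] `*` [set` `[(0 : R), 1]] by [].
by apply: compact_setX; exact: segment_compact.
Qed.

Lemma square_near (p : R * R) e : sq p -> 0 < e ->
  exists2 r, 0 < r & forall p', sq p' -> ball p r p' -> `|f p.1 p.2 - f p'.1 p'.2| < e.
Proof.
move=> sp e0; have /subspace_continuousP /(_ p sp) /cvgrPdist_lt /(_ e e0) := f_cont.
rewrite near_withinE => /nbhs_ballP [r /= r0 rP]; exists r => // p' sp' bp'.
exact: rP.
Qed.

(** Near coverings of the compact square: half the radius of continuity at [p], both for the
    neighbourhood and for [d], keeps the two points in the full ball. Functions of one variable are
    treated later as functions that ignore their second argument. *)
Lemma square_unif_cont e : 0 < e -> exists2 d, 0 < d &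
  forall x y x' y', x \in `[0, 1] -> y \in `[0, 1] -> x' \in `[0, 1] -> y' \in `[0, 1] ->
  `|x - x'| < d -> `|y - y'| < d -> `|f x y - f x' y'| < e.
Proof.
move=> e0; have := compact_square => /compact_near_coveringP.
move=> /(_ R (0^'+) (fun d p => sq p -> forall p', sq p' -> ball p d p' ->
   `|f p.1 p.2 - f p'.1 p'.2| < e)) H.
have {}H : \forall d \near 0^'+, sq `<=` fun p => sq p -> forall p', sq p' -> ball p d p' ->
   `|f p.1 p.2 - f p'.1 p'.2| < e.
  apply: H => p sp; have [r r0 rP] := square_near sp (divr_gt0 e0 (ltr0n R 2)).
  have r2 : 0 < r / 2 by rewrite divr_gt0.
  exists (ball p (r / 2), [set d | d < r / 2]) => [|[p1 d] /= [b1 dr] s1 p2 s2 b2].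
    by split => /=; [exact: nbhsx_ballx|exact: nbhs_right_lt].
  have b1' : ball p r p1 by apply: le_ball b1; rewrite ler_pdivrMr // ler_peMr ?ler1n // ltW.
  have b2' : ball p r p2.
    by rewrite (splitr r); apply: ball_triangle b1 _; apply: le_ball b2; exact: ltW.
  have h1 := rP _ s1 b1'; have h2 := rP _ s2 b2'; rewrite distrC in h1.
  have -> : f p1.1 p1.2 - f p2.1 p2.2 =
    (f p1.1 p1.2 - f p.1 p.2) + (f p.1 p.2 - f p2.1 p2.2) by ring.
  apply: le_lt_trans (ler_normD _ _) _; rewrite (splitr e); exact: ltrD.
have [d d0 Hd] : exists2 d, 0 < d & sq `<=` fun p => sq p -> forall p', sq p' -> ball p d p' ->
   `|f p.1 p.2 - f p'.1 p'.2| < e.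
  have [d [h d0]] := @filter_ex _ (0^'+) _ _ (filterI H (nbhs_right_gt (0 : R))).
  by exists d.
exists d => // x y x' y' xI yI x'I y'I h1 h2.
by apply: (Hd (x, y) _ _ (x', y')).
Qed.

Lemma square_bounded : exists2 C, 0 < C &
  forall x y, x \in `[0, 1] -> y \in `[0, 1] -> f x y <= C.
Proof.
have := compact_square => /compact_near_coveringP.
move=> /(_ R (+oo) (fun C p => sq p -> f p.1 p.2 <= C)) H.
have {}H : \forall C \near +oo, sq `<=` fun p => sq p -> f p.1 p.2 <= C.
  apply: H => p sp; have [r r0 rP] := square_near sp (@ltr01 R).
  exists (ball p r, [set d | f p.1 p.2 + 1 < d]) => [|[p1 d] /= [b1 dr] s1].
    by split => /=; [exact: nbhsx_ballx|exact: (nbhs_pinfty_gt (num_real _))].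
  have := rP _ s1 b1; rewrite distrC => /ltr_distlDr h.
  by apply: ltW; apply: lt_trans dr; rewrite addrC -ltrBlDr ltrBlDl.
have [C [h C0]] := @filter_ex _ (+oo) _ _ (filterI H (nbhs_pinfty_gt (num_real (0 : R)))).
by exists C => // x y xI yI; apply: (h (x, y)).
Qed.

Lemma square_pos : (forall x y, x \in `[0, 1] -> y \in `[0, 1] -> 0 < f x y) ->
  exists2 d, 0 < d & forall x y, x \in `[0, 1] -> y \in `[0, 1] -> d <= f x y.
Proof.
move=> f0; have := compact_square => /compact_near_coveringP.
move=> /(_ R (0^'+) (fun d p => sq p -> d <= f p.1 p.2)) H.
have {}H : \forall d \near 0^'+, sq `<=` fun p => sq p -> d <= f p.1 p.2.
  apply: H => p sp; have fp : 0 < f p.1 p.2 by case: sp => *; apply: f0.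
  have fp2 : 0 < f p.1 p.2 / 2 by rewrite divr_gt0.
  have [r r0 rP] := square_near sp fp2.
  exists (ball p r, [set d | d < f p.1 p.2 / 2]) => [|[p1 d] /= [b1 dr] s1].
    by split => /=; [exact: nbhsx_ballx|exact: nbhs_right_lt].
  have := rP _ s1 b1; rewrite ltr_norml => /andP[_ h].
  by apply: ltW; apply: lt_trans dr _; lra.
have [d [h d0]] := @filter_ex _ (0^'+) _ _ (filterI H (nbhs_right_gt (0 : R))).
by exists d => // x y xI yI; apply: (h (x, y)).
Qed.

End UnitSquare.

(** * A priori bounds for approximate solutions *)

Section ApproximateSolutions.
Variable R : realType.
Local Notation K := R[i].
Local Notation toC := (real_complex R).
Variables (n : nat) (f : 'I_n -> 'I_n -> R) (z : K) (u : 'I_n -> K).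
Hypothesis n_gt0 : (0 < n)%N.
Local Notation eta := (complex.Im z).
Local Notation L := (eta^-1).
Local Notation e := (qve_defect f z u).
Hypothesis z_gt0 : 0 < eta.
Hypothesis u_Im : forall i, eta * normc (u i) ^+ 2 <= complex.Im (u i).
Hypothesis u_neq0 : forall i, u i != 0.

Let a i := normc (u i).
Let b i := complex.Im (u i).
Let nR : 0 < n%:R :> R. Proof. by rewrite ltr0n. Qed.
Let ni : 0 <= n%:R^-1 :> R. Proof. by rewrite invr_ge0 ltW. Qed.
Let a_gt0 i : 0 < a i.
Proof.
rewrite /a lt_def normc_ge0 andbT; apply/eqP => /eq0_normc /eqP.
by rewrite (negbTE (u_neq0 i)).
Qed.
Let a_ge0 i : 0 <= a i. Proof. exact: ltW. Qed.
Let b_gt0 i : 0 < b i.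
Proof. by apply: lt_le_trans (u_Im i); apply: mulr_gt0 => //; apply/exprn_gt0/a_gt0. Qed.
Let b_ge0 i : 0 <= b i. Proof. exact: ltW. Qed.
Let L_ge0 : 0 <= L. Proof. by rewrite invr_ge0 ltW. Qed.
Let en i := normc (e i).
Let en_ge0 i : 0 <= en i. Proof. exact: normc_ge0. Qed.

Lemma approx_le i : a i <= L.
Proof.
rewrite -[leRHS]mul1r ler_pdivlMr // -(ler_pM2r (a_gt0 i)) mul1r.
have -> : a i * eta * a i = eta * a i ^+ 2 by ring.
apply: le_trans (u_Im i) _; exact: le_trans (ler_norm _) (ler_Im_normc _).
Qed.

(** [Im (-1/u)] is [Im u / |u|^2]. The imaginary part of the equation becomes a relation for [b]
    with the kernel [f / n], the source of the main bounds below. *)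
Lemma approx_Im i :
  b i = a i ^+ 2 * (eta + (\sum_j f i j / n%:R * b j) + complex.Im (e i)).
Proof.
have -> : eta + (\sum_j f i j / n%:R * b j) + complex.Im (e i) = complex.Im (- (u i)^-1).
  rewrite /qve_defect !ImD !ImN Im_sum.
  under [X in _ - X]eq_bigr => j _ do rewrite ImZ.
  rewrite -[\sum_j _ * b j]/(\sum_j f i j / n%:R * complex.Im (u j)).
  set S := \sum_j _; ring.
have a0 : a i ^+ 2 != 0 by rewrite gt_eqF // exprn_gt0.
move: a0; rewrite /a normc2E /b; case: (u i) => x y /= a0; field.
exact: a0.
Qed.

Lemma approx_Im_err i : `|complex.Im (e i)| <= en i.
Proof. exact: ler_Im_normc. Qed.

Local Notation s := (toC n%:R^-1 * \sum_i u i).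

Lemma avg_Im : complex.Im s = n%:R^-1 * \sum_i b i.
Proof. by rewrite ImZ Im_sum. Qed.

Lemma avg_sqr_le (x : 'I_n -> R) : (n%:R^-1 * \sum_i x i) ^+ 2 <= n%:R^-1 * \sum_i x i ^+ 2.
Proof.
set m := n%:R^-1 * \sum_i x i.
have : 0 <= n%:R^-1 * \sum_i (x i - m) ^+ 2.
  by rewrite mulr_ge0 // sumr_ge0 // => i _; exact: sqr_ge0.
have -> : \sum_i (x i - m) ^+ 2 = \sum_i x i ^+ 2 - 2 * m * \sum_i x i + m ^+ 2 * n%:R.
  transitivity (\sum_i (x i ^+ 2 - 2 * m * x i + m ^+ 2)).
    by apply: eq_bigr => i _; ring.
  by rewrite big_split /= sumrB -mulr_sumr sumr_const card_ord mulr_natr.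
have -> : n%:R^-1 * (\sum_i x i ^+ 2 - 2 * m * \sum_i x i + m ^+ 2 * n%:R) =
   n%:R^-1 * (\sum_i x i ^+ 2) - 2 * m * m + m ^+ 2 * (n%:R * n%:R^-1) by rewrite /m; ring.
rewrite divff ?gt_eqF // => h; rewrite -subr_ge0; apply: le_trans h _.
by rewrite le_eqVlt; apply/orP; left; apply/eqP; ring.
Qed.

Lemma normc_avg2_le : normc s ^+ 2 <= n%:R^-1 * \sum_i a i ^+ 2.
Proof.
apply: le_trans (avg_sqr_le a); rewrite ler_pXn2r ?nnegrE ?normc_ge0 //.
  rewrite normcM normc_toC ger0_norm // ler_wpM2l //; exact: ler_normc_sum.
by rewrite mulr_ge0 // sumr_ge0.
Qed.

(** The lower bound on [f] gives [b i >= a i ^+ 2 * (delta * m)] up to errors; on averaging, the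
    mean of [a i ^+ 2] is at least [|s|^2] by Jensen. As [|s| >= m], this limits [m] to about
    [delta^(-1/2)]. *)
Lemma approx_Im_lower (delta : R) : 0 <= delta -> (forall i j, delta <= f i j) ->
  complex.Im s * (delta * normc s ^+ 2 - 1) <= L ^+ 2 * (n%:R^-1 * \sum_i en i).
Proof.
move=> d0 df; set m := complex.Im s.
have m0 : 0 <= m by rewrite /m avg_Im mulr_ge0 // sumr_ge0.
have h1 i : a i ^+ 2 * (delta * m) <= b i + L ^+ 2 * en i.
  have S : delta * m <= \sum_j f i j / n%:R * b j.
    rewrite /m avg_Im mulrA mulr_sumr; apply: ler_sum => j _.
    by rewrite !ler_wpM2r.
  have h3 : a i ^+ 2 * `|complex.Im (e i)| <= L ^+ 2 * en i.
    apply: ler_pM; rewrite ?sqr_ge0 ?approx_Im_err //.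
    by rewrite ler_pXn2r ?nnegrE ?approx_le.
  apply: le_trans (_ : a i ^+ 2 * (eta + (\sum_j f i j / n%:R * b j) + complex.Im (e i)
     + `|complex.Im (e i)|) <= _); last by rewrite mulrDr -approx_Im lerD2l.
  rewrite ler_wpM2l ?sqr_ge0 //.
  have := ler_norm (- complex.Im (e i)); rewrite normrN; move: S (ltW z_gt0).
  set x := complex.Im (e i); set y := \sum_j _; lra.
have h2 : normc s ^+ 2 * (delta * m) <= m + L ^+ 2 * (n%:R^-1 * \sum_i en i).
  apply: le_trans (_ : n%:R^-1 * \sum_i a i ^+ 2 * (delta * m) <= _).
    by rewrite -mulr_suml [leRHS]mulrA ler_wpM2r ?normc_avg2_le // mulr_ge0.
  rewrite {2}/m avg_Im mulrCA -mulrDr ler_wpM2l // mulr_sumr -big_split /=.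
  by apply: ler_sum => i _.
rewrite mulrBr mulr1 lerBlDl; apply: le_trans h2.
by rewrite le_eqVlt; apply/orP; left; apply/eqP; ring.
Qed.

Variable C : R.
Hypothesis C_gt0 : 0 < C.
Hypothesis f_sym : forall i j, f i j = f j i.
Hypothesis f0C : forall i j, 0 <= f i j <= C.

Let f_ge0 i j : 0 <= f i j. Proof. by case/andP: (f0C i j). Qed.
Let f_le i j : f i j <= C. Proof. by case/andP: (f0C i j). Qed.
Let C_ge0 : 0 <= C. Proof. exact: ltW. Qed.

(* A Schur test: the symmetric kernel F_ij = |u_i| f_ij |u_j| / n almost has the
   positive subsolution v = Im u / |u|, so that its l^2 norm is almost at most 1. *)
Lemma schur_test :
  \sum_i normc (u i * \sum_j toC (f i j / n%:R) * u j) ^+ 2 <=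
  n%:R + (L + L ^+ 3 * C) * \sum_i en i.
Proof.
pose F i j := a i * (f i j / n%:R) * a j.
have F0 i j : 0 <= F i j by rewrite !mulr_ge0.
have Fs i j : F i j = F j i by rewrite /F f_sym; ring.
pose v i := b i / a i.
have v0 i : 0 < v i by rewrite divr_gt0.
pose rho i := a i * en i.
have rho0 i : 0 <= rho i by rewrite mulr_ge0.
(* [approx_Im] divided by [a i]; the term with [eta] has the favourable sign and is dropped, and
   [rho] carries the defect. *)
have Fv i : \sum_j F i j * v j <= v i + rho i.
  have -> : \sum_j F i j * v j = a i * \sum_j f i j / n%:R * b j.
    rewrite mulr_sumr; apply: eq_bigr => j _; rewrite /F /v; field.
    by rewrite !gt_eqF.
  have -> : a i * \sum_j f i j / n%:R * b j = v i - a i * (eta + complex.Im (e i)).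
    have h := approx_Im i; rewrite /v h; field; by rewrite gt_eqF.
  rewrite lerD2l /rho -mulrN ler_wpM2l // opprD.
  have := ler_norm (- complex.Im (e i)); rewrite normrN.
  have := approx_Im_err i; move: (z_gt0); set x := complex.Im (e i); lra.
(* [u_Im] bounds [v] from below, which prices each division of an error by [v]. *)
have vinv j : (v j)^-1 <= L / a j.
  rewrite /v invf_div ler_pdivrMr // mulrAC ler_pdivlMr //.
  by rewrite [L * _]mulrC ler_pdivlMr // mulrC -expr2; exact: u_Im.
have row i : normc (u i * \sum_j toC (f i j / n%:R) * u j) ^+ 2 <=
    (v i + rho i) * \sum_j F i j / v j.
  have h : normc (u i * \sum_j toC (f i j / n%:R) * u j) <= \sum_j F i j.
    rewrite normcM; apply: le_trans (_ : a i * \sum_j normc (toC (f i j / n%:R) * u j) <= _).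
      by apply: ler_wpM2l; [exact: normc_ge0|exact: ler_normc_sum].
    rewrite mulr_sumr; apply: ler_sum => j _.
    rewrite normcM normc_toC ger0_norm; last exact: mulr_ge0.
    by rewrite mulrA; exact: lexx.
  have SF0 : 0 <= \sum_j F i j by rewrite sumr_ge0.
  apply: le_trans (_ : (\sum_j F i j) ^+ 2 <= _).
    by rewrite ler_pXn2r ?nnegrE ?normc_ge0.
  set A := \sum_j F i j in SF0 h *; set B := \sum_j F i j / v j.
  have B0 : 0 <= B by apply: sumr_ge0 => j _; rewrite divr_ge0 // ltW.
  apply: le_trans (_ : (\sum_j F i j * v j) * B <= _); last by rewrite ler_wpM2r.
  set D := \sum_j F i j * v j.
  (* Cauchy-Schwarz with weights [v], from a quadratic in [t] that is a sum of nonnegative terms;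
     its minimum is at [A / B], so [B = 0] is treated apart. *)
  have AM t : 0 <= D - 2 * t * A + t ^+ 2 * B.
    have -> : D - 2 * t * A + t ^+ 2 * B = \sum_j F i j / v j * (v j - t) ^+ 2.
      rewrite /D /A /B !mulr_sumr -sumrB -big_split /=; apply: eq_bigr => j _.
      by field; rewrite gt_eqF.
    by apply: sumr_ge0 => j _; rewrite mulr_ge0 ?sqr_ge0 // divr_ge0 // ltW.
  have [B_eq|Bn] := eqVneq B 0.
    have A_eq : A = 0.
      apply: big1 => j _; apply/eqP.
      have Fv0 k : true -> 0 <= F i k / v k by move=> _; rewrite divr_ge0 // ltW.
      have /eqP := psumr_eq0P Fv0 B_eq (i := j) isT.
      by rewrite mulf_eq0 invr_eq0 (gt_eqF (v0 j)) orbF.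
    by rewrite A_eq B_eq mulr0 expr0n.
  have Bp : 0 < B by rewrite lt_def Bn.
  have := AM (A / B).
  have -> : D - 2 * (A / B) * A + (A / B) ^+ 2 * B = (D * B - A ^+ 2) / B by field.
  by rewrite pmulr_lge0 ?invr_gt0 // subr_ge0.
apply: le_trans (ler_sum _ (fun i _ => row i)) _.
(* The symmetry of [F] lets the subsolution inequality be used a second time, now after summation
   over [i]. *)
have -> : \sum_i (v i + rho i) * \sum_j F i j / v j =
    \sum_j (\sum_i F j i * (v i + rho i)) / v j.
  under eq_bigr => i _ do rewrite mulr_sumr.
  rewrite exchange_big; apply: eq_bigr => j _; rewrite mulr_suml.
  by apply: eq_bigr => i _; rewrite (Fs i j); ring.
apply: le_trans (_ : \sum_j (1 + (L * en j + L ^+ 3 * (C / n%:R) * \sum_i en i)) <= _).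
  apply: ler_sum => j _.
  under eq_bigr => i _ do rewrite mulrDr.
  rewrite big_split /= mulrDl.
  apply: le_trans (_ : (v j + rho j) / v j + (\sum_i F j i * rho i) / v j <= _).
    by rewrite lerD2r ler_wpM2r // invr_ge0 ltW.
  rewrite mulrDl divff ?gt_eqF // -addrA lerD2l; apply: lerD.
    apply: le_trans (_ : rho j * (L / a j) <= _); first by rewrite ler_wpM2l.
    rewrite /rho le_eqVlt; apply/orP; left; apply/eqP; field; by rewrite !gt_eqF.
  rewrite mulr_suml mulr_sumr; apply: ler_sum => i _.
  apply: le_trans (_ : F j i * rho i * (L / a j) <= _).
    by rewrite ler_wpM2l // mulr_ge0.
  have -> : F j i * rho i * (L / a j) = L * (f j i / n%:R) * (a i ^+ 2) * en i.
    by rewrite /F /rho; field; rewrite !gt_eqF.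
  rewrite ler_wpM2r //.
  have -> : L ^+ 3 * (C / n%:R) = L * (C / n%:R) * L ^+ 2 by ring.
  apply: ler_pM; rewrite ?sqr_ge0 //; first by rewrite !mulr_ge0.
    by rewrite ler_wpM2l // ler_wpM2r.
  by rewrite ler_pXn2r ?nnegrE ?approx_le.
rewrite !big_split /= !sumr_const card_ord -mulr_sumr mulrDl lerD2l lerD2l.
rewrite le_eqVlt; apply/orP; left; apply/eqP; rewrite -[LHS]mulr_natr; field.
by rewrite !gt_eqF.
Qed.

Definition err_sum : R :=
  (L + L ^+ 3 * C) * (n%:R^-1 * \sum_i en i) + L ^+ 2 * (n%:R^-1 * \sum_i en i ^+ 2).

(** The equation gives [z u = -1 - u S - u e]. By [(1 + x + y)^2 <= 3 (1 + x^2 + y^2)] and the Schur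
    test, which puts the mean of [|u S|^2] at no more than 1 plus errors, the main term is
    [3 * (1 + 1)]. *)
Lemma avg_normc2_le : normc z ^+ 2 * (n%:R^-1 * \sum_i a i ^+ 2) <= 6 + 3 * err_sum.
Proof.
apply: le_trans (_ : n%:R^-1 * \sum_i 3 * (1 +
   normc (u i * \sum_j toC (f i j / n%:R) * u j) ^+ 2 + L ^+ 2 * en i ^+ 2) <= _).
  rewrite mulrCA ler_wpM2l // mulr_sumr; apply: ler_sum => i _.
  set S := \sum_j _.
  have zE : z * u i = - 1 - u i * S - u i * e i.
    by rewrite /qve_defect -/S; have := u_neq0 i; set x := u i => x0; field.
  rewrite -exprMn -normcM zE.
  have tri (x y : K) : normc (x - y) <= normc x + normc y.
    by apply: le_trans (le_normcD _ _) _; rewrite normcN'.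
  have h : normc (- 1 - u i * S - u i * e i) <= 1 + normc (u i * S) + L * en i.
    apply: le_trans (tri _ _) _; apply: lerD.
      by apply: le_trans (tri _ _) _; rewrite lerD2r normcN' normc1.
    by rewrite normcM; apply: ler_wpM2r; [exact: normc_ge0|exact: approx_le].
  apply: le_trans (_ : (1 + normc (u i * S) + L * en i) ^+ 2 <= _).
    rewrite ler_pXn2r ?nnegrE ?normc_ge0 // !addr_ge0 ?normc_ge0 ?mulr_ge0 //.
  rewrite -exprMn; set x := normc _; set y := L * _; rewrite -subr_ge0.
  have -> : 3 * (1 + x ^+ 2 + y ^+ 2) - (1 + x + y) ^+ 2 =
    (1 - x) ^+ 2 + (1 - y) ^+ 2 + (x - y) ^+ 2 by ring.
  by rewrite !addr_ge0 ?sqr_ge0.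
rewrite -mulr_sumr !big_split /= sumr_const card_ord -mulr_sumr.
apply: le_trans (_ : n%:R^-1 * (3 * (1 *+ n + (n%:R + (L + L ^+ 3 * C) * \sum_i en i)
  + L ^+ 2 * \sum_i en i ^+ 2)) <= _).
  by rewrite ler_wpM2l // ler_wpM2l // lerD2r lerD2l schur_test.
rewrite le_eqVlt; apply/orP; left; apply/eqP; rewrite /err_sum; field.
by rewrite !gt_eqF.
Qed.

(** The threshold 24 makes [A * C] at most [6 / 24 = 1/4] up to errors. Replacing [f] by [C] in
    [approx_Im] gives [m <= A eta + A C m] up to errors, and absorbing the last term leaves [3/4] of
    [m]. *)
Lemma approx_Im_upper : 24 * C <= normc z ^+ 2 ->
  complex.Im s * (3 / 4) <= eta / (4 * C) +
    err_sum * (eta / (8 * C) + L / 8) + L ^+ 2 * (n%:R^-1 * \sum_i en i).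
Proof.
move=> zC; set m := complex.Im s; set A := n%:R^-1 * \sum_i a i ^+ 2.
have A0 : 0 <= A by rewrite mulr_ge0 // sumr_ge0 // => i _; exact: sqr_ge0.
have m0 : 0 <= m by rewrite /m avg_Im mulr_ge0 // sumr_ge0.
(* A crude bound, spent only on the product of [m] with the error term. *)
have mL : m <= L.
  rewrite /m avg_Im; apply: le_trans (_ : n%:R^-1 * \sum_(i < n) L <= _).
    rewrite ler_wpM2l // ler_sum // => i _; apply: le_trans (approx_le i).
    exact: le_trans (ler_norm _) (ler_Im_normc _).
  rewrite sumr_const card_ord -mulr_natr le_eqVlt; apply/orP; left; apply/eqP; field.
  by rewrite !gt_eqF.
have AC : A * (4 * C) <= 1 + err_sum / 2.
  have := le_trans (ler_wpM2r A0 zC) avg_normc2_le; rewrite -/A; lra.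
have h1 : m <= A * eta + A * C * m + L ^+ 2 * (n%:R^-1 * \sum_i en i).
  rewrite {1}/m avg_Im /A.
  have -> : n%:R^-1 * (\sum_i a i ^+ 2) * eta + n%:R^-1 * (\sum_i a i ^+ 2) * C * m
     + L ^+ 2 * (n%:R^-1 * \sum_i en i) =
    n%:R^-1 * \sum_i (a i ^+ 2 * (eta + C * m) + L ^+ 2 * en i).
    by rewrite big_split /= -mulr_suml -mulr_sumr; ring.
  rewrite ler_wpM2l //; apply: ler_sum => i _; rewrite {1}approx_Im mulrDr; apply: lerD.
    rewrite ler_wpM2l ?sqr_ge0 // lerD2l /m avg_Im mulrA mulr_sumr; apply: ler_sum => j _.
    by rewrite !ler_wpM2r.
  apply: le_trans (ler_norm _) _; rewrite normrM ger0_norm ?sqr_ge0 //.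
  apply: ler_pM; rewrite ?sqr_ge0 ?approx_Im_err //.
  by rewrite ler_pXn2r ?nnegrE ?approx_le.
have err0 : 0 <= err_sum.
  rewrite /err_sum addr_ge0 // !mulr_ge0 ?addr_ge0 ?mulr_ge0 ?exprn_ge0 ?sumr_ge0 //.
  by move=> i _; exact: sqr_ge0.
have h2 : A * eta <= (1 + err_sum / 2) * (eta / (4 * C)).
  rewrite [leRHS]mulrA ler_pdivlMr ?mulr_gt0 // mulrAC.
  by apply: ler_wpM2r => //; exact: ltW.
have h3 : A * C * m <= m / 4 + err_sum / 8 * L.
  apply: le_trans (_ : (1 / 4 + err_sum / 8) * m <= _).
    by rewrite ler_wpM2r //; lra.
  by rewrite mulrDl lerD // ?ler_wpM2l ?divr_ge0 //; lra.
have -> : err_sum * (eta / (8 * C) + L / 8) =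
   err_sum / 2 * (eta / (4 * C)) + err_sum / 8 * L by field; rewrite !gt_eqF.
move: h1 h2 h3; set T := L ^+ 2 * _; set Y := eta / (4 * C); set W := err_sum / 8 * L.
rewrite mulrDl mul1r; set Q := err_sum / 2 * Y.
set X1 := A * eta; set X2 := A * C * m; lra.
Qed.

End ApproximateSolutions.
(** * Approximation by Cauchy kernels *)

Section Bernstein.
Variable R : realType.
Implicit Types (F : nat -> R) (t : R).

(* The n-th Bernstein polynomial of F, as the mean of F under a binomial law. *)
Fixpoint bernstein n F : {poly R} :=
  if n is m.+1 then 'X * bernstein m (F \o S) + (1 - 'X) * bernstein m F else (F 0%N)%:P.

Lemma bernsteinS n F t : (bernstein n.+1 F).[t] =
  t * (bernstein n (F \o S)).[t] + (1 - t) * (bernstein n F).[t].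
Proof. by rewrite /= !hornerE. Qed.

Lemma bernstein0 n F : (bernstein n F).[0] = F 0%N.
Proof.
elim: n F => [|n IH] F; first by rewrite hornerC.
by rewrite bernsteinS mul0r add0r subr0 mul1r IH.
Qed.

Lemma bernstein_le n F F' t : 0 <= t <= 1 -> (forall k, (k <= n)%N -> F k <= F' k) ->
  (bernstein n F).[t] <= (bernstein n F').[t].
Proof.
move=> /andP[t0 t1]; elim: n F F' => [|n IH] F F' h; first by rewrite !hornerC h.
rewrite !bernsteinS; apply: lerD; apply: ler_wpM2l; rewrite ?subr_ge0 //; apply: IH => k kn.
  exact: h.
by apply: h; apply: leqW.
Qed.

Lemma bernstein_lin n F F' a b t :
  (bernstein n (fun k => a * F k + b * F' k)).[t] =
  a * (bernstein n F).[t] + b * (bernstein n F').[t].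
Proof.
elim: n F F' => [|n IH] F F'; first by rewrite !hornerC.
by rewrite !bernsteinS !IH; ring.
Qed.

Lemma bernstein_cst n a t : (bernstein n (fun=> a)).[t] = a.
Proof.
elim: n => [|n IH]; first by rewrite hornerC.
by rewrite bernsteinS IH; ring.
Qed.

(** Variance plus squared bias of the binomial law, for every centre [c] because the induction
    shifts it by one. *)
Lemma bernstein_variance n c t :
  (bernstein n (fun k => (k%:R - c) ^+ 2)).[t] = n%:R * t * (1 - t) + (n%:R * t - c) ^+ 2.
Proof.
elim: n c => [|n IH] c; first by rewrite hornerC; ring.
rewrite bernsteinS IH.
have -> : (bernstein n ((fun k => (k%:R - c) ^+ 2) \o S)).[t] =
    (bernstein n (fun k => (k%:R - (c - 1)) ^+ 2)).[t].
  by congr (_.[_]); congr bernstein; apply/funext => k /=; rewrite -natr1; ring.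
rewrite IH -natr1; ring.
Qed.

(** Chebyshev's argument: where [k / n] is at distance at least [d] from [t], the bound [2 B] is
    paid by [K * (k - n t)^2], whose mean is [O(1/n)]. The exact value at 0 is kept because only
    polynomials without constant term are available in [W_poly]. *)
Lemma weierstrass (h : R -> R) e :
  (forall e, 0 < e -> exists2 d, 0 < d & forall x y, x \in `[0, 1] -> y \in `[0, 1] ->
     `|x - y| < d -> `|h x - h y| < e) ->
  (exists B, forall x, x \in `[0, 1] -> `|h x| <= B) -> 0 < e ->
  exists2 p : {poly R}, p.[0] = h 0 & forall t, t \in `[0, 1] -> `|h t - p.[t]| <= e.
Proof.
move=> hu [B hB] e0; have [d d0 hd] := hu _ (divr_gt0 e0 (ltr0n R 2)).
have B0 : 0 <= B by apply: le_trans (hB 0 _); rewrite ?in_itv /= ?lexx ?ler01.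
(* Makes [2 B / (d^2 n)] at most [e / 2]. *)
pose m := Num.bound (4 * B / (d ^+ 2 * e)).
have m0 : (0 < m.+1)%N by [].
have mR : 0 < m.+1%:R :> R by rewrite ltr0n.
pose n := m.+1.
exists (bernstein n (fun k => h (k%:R / n%:R))); first by rewrite bernstein0 mul0r.
move=> t tI; have t01 : 0 <= t <= 1 by move: tI; rewrite in_itv.
have /andP[t0 t1] := t01.
pose K := 2 * B / (d ^+ 2 * n%:R ^+ 2).
have K0 : 0 <= K by rewrite divr_ge0 ?mulr_ge0 ?exprn_ge0 // ltW.
have bnd k : (k <= n)%N -> `|h t - h (k%:R / n%:R)| <= e / 2 + K * (k%:R - n%:R * t) ^+ 2.
  move=> kn; have kI : k%:R / n%:R \in `[(0 : R), 1].
    by rewrite in_itv /= divr_ge0 //= ler_pdivrMr // mul1r ler_nat.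
  have [lt|ge] := ltP `|t - k%:R / n%:R| d.
    apply: le_trans (ltW (hd _ _ tI kI lt)) _.
    by rewrite lerDl mulr_ge0 // sqr_ge0.
  apply: le_trans (ler_normB _ _) _; apply: le_trans (lerD (hB _ tI) (hB _ kI)) _.
  apply: le_trans (_ : K * (k%:R - n%:R * t) ^+ 2 <= _); last by rewrite lerDr divr_ge0 // ltW.
  have -> : (k%:R - n%:R * t) ^+ 2 = n%:R ^+ 2 * `|t - k%:R / n%:R| ^+ 2 :> R.
    by rewrite real_normK ?num_real //; field; rewrite gt_eqF.
  have -> : K * (n%:R ^+ 2 * `|t - k%:R / n%:R| ^+ 2) = (B + B) * (`|t - k%:R / n%:R| ^+ 2 / d ^+ 2).
    by rewrite /K; field; rewrite !gt_eqF.
  rewrite -[leLHS]mulr1; apply: ler_wpM2l; first by rewrite addr_ge0.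
  rewrite ler_pdivlMr ?exprn_gt0 // mul1r ler_pXn2r ?nnegrE // ltW //.
set p := bernstein _ _.
have var : e / 2 + K * (n%:R * t * (1 - t)) <= e.
  have tt : t * (1 - t) <= 1 by nra.
  have -> : K * (n%:R * t * (1 - t)) = (2 * B / (d ^+ 2 * n%:R)) * (t * (1 - t)).
    by rewrite /K; field; rewrite !gt_eqF.
  have C0 : 0 <= 2 * B / (d ^+ 2 * n%:R) by rewrite divr_ge0 ?mulr_ge0 ?exprn_ge0 // ltW.
  suff : 2 * B / (d ^+ 2 * n%:R) <= e / 2 by nra.
  rewrite ler_pdivrMr ?mulr_gt0 ?exprn_gt0 //.
  have := archi_boundP (divr_ge0 (mulr_ge0 (ler0n R 4) B0) (mulr_ge0 (ltW (exprn_gt0 2 d0)) (ltW e0))).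
  rewrite -/m ltr_pdivrMr ?mulr_gt0 ?exprn_gt0 // => h1.
  have de0 : 0 < d ^+ 2 * e by rewrite mulr_gt0 ?exprn_gt0.
  have h2 : m%:R * (d ^+ 2 * e) <= n%:R * (d ^+ 2 * e) by rewrite ler_wpM2r ?(ltW de0) // ler_nat.
  have -> : e / 2 * (d ^+ 2 * n%:R) = n%:R * (d ^+ 2 * e) / 2 by ring.
  lra.
have vE : (bernstein n (fun k => e / 2 * 1 + K * (k%:R - n%:R * t) ^+ 2)).[t] =
    e / 2 + K * (n%:R * t * (1 - t)).
  rewrite (bernstein_lin n (fun=> 1)) bernstein_cst bernstein_variance; ring.
rewrite ler_norml; apply/andP; split.
  rewrite lerBrDl -lerBrDr opprK.
  apply: le_trans (_ : (bernstein n (fun k => 1 * h t + 1 * (e / 2 * 1 + K * (k%:R - n%:R * t) ^+ 2))).[t] <= _).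
    rewrite /p; apply: bernstein_le => // k kn; rewrite !mul1r mulr1.
    have := bnd k kn; have := ler_norm (- (h t - h (k%:R / n%:R))).
    rewrite normrN; lra.
  by rewrite (bernstein_lin n (fun=> h t)) bernstein_cst vE !mul1r lerD2l.
rewrite lerBlDr.
apply: le_trans (_ : (bernstein n (fun k => 1 * h (k%:R / n%:R) + 1 * (e / 2 * 1 + K * (k%:R - n%:R * t) ^+ 2))).[t] <= _).
  rewrite -{1}(bernstein_cst n (h t) t); apply: bernstein_le => // k kn; rewrite !mul1r mulr1.
  have := bnd k kn; have := ler_norm (h t - h (k%:R / n%:R)); lra.
rewrite (bernstein_lin n (fun k => h (k%:R / n%:R))) vE -/p !mul1r [leRHS]addrC.
by rewrite lerD2l.
Qed.

End Bernstein.

(** * Test functions generated by Cauchy kernels *)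

Section Density.
Variable R : realType.
Variable W : (R -> R) -> Prop.
Hypothesis W_lin : forall a b phi psi, W phi -> W psi -> W (fun x => a * phi x + b * psi x).
Hypothesis W_app : forall phi,
  (forall e, 0 < e -> exists psi, W psi /\ forall x, `|phi x - psi x| <= e * (1 + x ^+ 2)) -> W phi.
Variables (w : R -> R) (s0 : R).
Hypothesis w_le : forall x, `|w x| <= 1 + x ^+ 2.
Hypothesis s0_ge1 : 1 <= s0.

(** At [z = i sqrt s] these are [Im (x - z)^-1] up to the factor [sqrt s], and times [x] they are
    [Re (x - z)^-1]. [W] stands for the functions with a known limit, and [w] for 1 or the identity,
    to serve even and odd functions. Only [s >= s0] is given, as limits are first known for large
    spectral parameters. *)
Definition cauchy_fun (s x : R) : R := (x ^+ 2 + s)^-1.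
Local Notation u := cauchy_fun.
Hypothesis W_u : forall s, s0 <= s -> W (fun x => w x * u s x).

Lemma eq_W phi psi : (forall x, phi x = psi x) -> W phi -> W psi.
Proof. by move=> h; have -> : phi = psi by apply/funext. Qed.

Lemma cauchy_fun_gt0 s x : s0 <= s -> 0 < u s x.
Proof.
move=> h; rewrite invr_gt0 ltr_wpDl ?sqr_ge0 //; apply: lt_le_trans (le_trans s0_ge1 h).
exact: ltr01.
Qed.

Lemma cauchy_fun_le1 s x : s0 <= s -> u s x <= 1.
Proof.
move=> h; have p := cauchy_fun_gt0 x h; move: p; rewrite /u invr_gt0 => p.
rewrite invf_le1 //; apply: le_trans (le_trans s0_ge1 h) _; rewrite lerDr sqr_ge0 //.
Qed.

Lemma cauchy_fun_diff s t x : s0 <= s -> s0 <= t -> u s x - u t x = (t - s) * (u s x * u t x).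
Proof.
move=> hs ht; have := cauchy_fun_gt0 x hs; have := cauchy_fun_gt0 x ht.
rewrite /u !invr_gt0 => p q; field; by rewrite !gt_eqF.
Qed.

(** Partial fractions: by [cauchy_fun_diff], a product over two distinct nodes is a multiple of a
    difference, which shortens the list by one factor. *)
Lemma W_prod n (l : seq R) : size l = n.+1 -> uniq l -> all (fun s => s0 <= s) l ->
  W (fun x => w x * \prod_(s <- l) u s x).
Proof.
elim: n l => [|n IH] [|s1 l] //=.
  case: l => // _ _ /andP[h _]; apply: eq_W (W_u h) => x.
  by rewrite big_cons big_nil mulr1.
case: l => // s2 l [sl] /=; rewrite inE negb_or => /andP[/andP[s12 s1l] /andP[s2l ul]].
move=> /and3P[h1 h2 hl].
have W1 : W (fun x => w x * \prod_(s <- s1 :: l) u s x).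
  by apply: IH; rewrite /= ?sl // ?s1l ?h1.
have W2 : W (fun x => w x * \prod_(s <- s2 :: l) u s x).
  by apply: IH; rewrite /= ?sl // ?s2l ?h2.
apply: eq_W (W_lin (s2 - s1)^-1 (- (s2 - s1)^-1) W1 W2) => x.
rewrite !big_cons; set P := \prod_(_ <- _) _.
transitivity (w x * ((s2 - s1)^-1 * (u s1 x - u s2 x)) * P); first by ring.
by rewrite cauchy_fun_diff //; field; rewrite subr_eq0 eq_sym.
Qed.

Lemma prod_close n (a : nat -> R) b d : 0 <= b <= 1 ->
  (forall i, (i < n)%N -> 0 <= a i <= 1 /\ `|a i - b| <= d) ->
  `|\prod_(i < n) a i - b ^+ n| <= n%:R * d.
Proof.
move=> /andP[b0 b1]; elim: n => [|n IH] h; first by rewrite big_ord0 expr0 subrr normr0 mul0r.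
have [/andP[an0 an1] hn] := h n (ltnSn n).
rewrite big_ord_recr /= exprSr.
have {}IH := IH (fun i hi => h i (ltnW hi : (i < n.+1)%N)).
set P := \prod_(_ < _) _ in IH *.
have -> : P * a n - b ^+ n * b = (P - b ^+ n) * a n + b ^+ n * (a n - b) by ring.
apply: le_trans (ler_normD _ _) _; rewrite !normrM -natr1 mulrDl mul1r; apply: lerD.
  by apply: le_trans IH; rewrite ler_piMr // ger0_norm.
apply: le_trans hn; rewrite ler_piMl // ger0_norm ?exprn_ge0 //; exact: exprn_ile1.
Qed.

(** Powers are limits of products with the distinct nodes [s + i d], so no derivative in [s] is
    taken; with [d = e / (k+1)^2] the product is [e]-close to the power. *)
Lemma W_pow s k : s0 <= s -> W (fun x => w x * u s x ^+ k.+1).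
Proof.
move=> hs; apply: W_app => e e0.
pose d := e / (k.+1%:R * k.+1%:R).
have kR : 0 < k.+1%:R :> R by rewrite ltr0n.
have d0 : 0 < d by rewrite divr_gt0 // mulr_gt0.
pose l := [seq s + i%:R * d | i <- iota 0 k.+1].
have ls i : s0 <= s + i%:R * d.
  by apply: le_trans hs _; rewrite lerDl mulr_ge0 // ltW.
exists (fun x => w x * \prod_(s <- l) u s x); split.
  apply: (@W_prod k).
  - by rewrite size_map size_iota.
  - rewrite map_inj_uniq ?iota_uniq // => i j /addrI /(mulIf (lt0r_neq0 d0)) /eqP.
    by rewrite eqr_nat => /eqP.
  - by apply/allP => _ /mapP[i _ ->].
move=> x; rewrite -mulrBr normrM mulrC; apply: ler_pM => //; rewrite distrC.
rewrite big_map -[X in iota 0 X]subn0 -/(index_iota 0 k.+1) big_mkord.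
apply: le_trans (@prod_close k.+1 (fun i => u (s + i%:R * d) x) (u s x) (k.+1%:R * d) _ _) _.
- by rewrite (ltW (cauchy_fun_gt0 x hs)) cauchy_fun_le1.
- move=> i ik; split.
    by rewrite (ltW (cauchy_fun_gt0 x (ls i))) cauchy_fun_le1.
  rewrite distrC cauchy_fun_diff // addrAC subrr add0r.
  have p1 := cauchy_fun_gt0 x hs; have p2 := cauchy_fun_gt0 x (ls i).
  rewrite ger0_norm; last by rewrite !mulr_ge0 // ltW.
  have q1 := cauchy_fun_le1 x hs; have q2 := cauchy_fun_le1 x (ls i).
  have id0 : 0 <= i%:R * d by rewrite mulr_ge0 // ltW.
  apply: le_trans (_ : i%:R * d <= _).
    rewrite ler_piMr //; apply: mulr_ile1 => //; exact: ltW.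
  by rewrite ler_wpM2r ?(ltW d0) // ler_nat ltnW.
- by rewrite /d le_eqVlt; apply/orP; left; apply/eqP; field; rewrite gt_eqF.
Qed.

(** The constant term must vanish: every function obtained so far carries at least one factor
    [u]. *)
Lemma W_poly s (p : {poly R}) : s0 <= s -> p.[0] = 0 -> W (fun x => w x * p.[u s x]).
Proof.
move=> hs p0.
have Wn n : W (fun x => w x * \sum_(i < n) p`_i.+1 * u s x ^+ i.+1).
  elim: n => [|n IH].
    apply: eq_W (W_lin 0 0 (W_u hs) (W_u hs)) => x.
    by rewrite big_ord0 !mul0r addr0 mulr0.
  apply: eq_W (W_lin 1 p`_n.+1 IH (W_pow n hs)) => x.
  by rewrite big_ord_recr /=; ring.
apply: eq_W (Wn (size p).-1) => x; congr (_ * _).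
rewrite horner_coef; case sp: (size p) => [|n]; first by rewrite !big_ord0.
rewrite big_ord_recl expr0 mulr1; move: p0; rewrite horner_coef0 => ->.
by rewrite add0r.
Qed.

Lemma W_continuous s (h : R -> R) : s0 <= s -> continuous h -> h 0 = 0 ->
  W (fun x => w x * h (u s x)).
Proof.
move=> hs hc h00; apply: W_app => e e0.
have fc : {within [set p : R * R | p.1 \in `[0, 1] /\ p.2 \in `[0, 1]],
    continuous (fun p : R * R => (fun x (_ : R) => h x) p.1 p.2)}.
  apply: continuous_subspaceT => p /=.
  by apply: (@continuous_comp _ _ _ fst h); [exact: cvg_fst|exact: hc].
have fc' : {within [set p : R * R | p.1 \in `[0, 1] /\ p.2 \in `[0, 1]],
    continuous (fun p : R * R => (fun x (_ : R) => `|h x|) p.1 p.2)}.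
  apply: continuous_subspaceT => p /=.
  apply: (@continuous_comp _ _ _ fst (fun x => `|h x|)); first exact: cvg_fst.
  by apply: (@continuous_comp _ _ _ h); [exact: hc|exact: norm_continuous].
have z0 : (0 : R) \in `[0, 1] by rewrite in_itv /= lexx ler01.
have hu e' : 0 < e' -> exists2 d, 0 < d & forall x y, x \in `[0, 1] -> y \in `[0, 1] ->
     `|x - y| < d -> `|h x - h y| < e'.
  move=> e'0; have [d d0 hd] := @square_unif_cont R (fun x _ => h x) fc _ e'0; exists d => // x y xI yI xy.
  by apply: (hd x 0 y 0) => //; rewrite subrr normr0.
have hb : exists B, forall x, x \in `[0, 1] -> `|h x| <= B.
  by have [B _ hB] := @square_bounded R (fun x _ => `|h x|) fc'; exists B => x xI; exact: (hB x 0 xI z0).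
have [p p0 hp] := weierstrass hu hb e0.
exists (fun x => w x * p.[u s x]); split; first by apply: W_poly => //; rewrite p0.
move=> x; rewrite -mulrBr normrM mulrC; apply: ler_pM => //; apply: hp.
by rewrite in_itv /= (ltW (cauchy_fun_gt0 x hs)) cauchy_fun_le1.
Qed.

(** An even [g] is a function of [u s x], as [x^2 = 1/u - s], but it need not have a limit at
    infinity, which is [u = 0]. The factor [u / (u + delta)] vanishes there, makes [h] continuous,
    and tends to 1 as [delta] shrinks. *)
Lemma W_damped s delta (g : R -> R) : s0 <= s -> 0 < delta -> continuous g ->
  (forall x, g (- x) = g x) -> (exists B, forall x, `|g x| <= B) ->
  W (fun x => w x * (g x * (u s x / (u s x + delta)))).
Proof.
move=> hs d0 gc ge [B gB].
(* The absolute value extends the formula to negative [t]; for [|t| > 1/s] the square root takes its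
   default value 0, which keeps [h] continuous. *)
pose h (t : R) : R := g (Num.sqrt (`|t|^-1 - s)) * (`|t| / (`|t| + delta)).
have h00 : h 0 = 0 by rewrite /h normr0 mul0r mulr0.
suff hc : continuous h.
  apply: eq_W (W_continuous hs hc h00) => x.
  rewrite /h gtr0_norm ?cauchy_fun_gt0 // {1}/u invrK addrK sqrtr_sqr.
  by congr (_ * (_ * _)); case: (ger0P x) => _; rewrite ?ge.
move=> t; have [->|t0] := eqVneq t 0.
  apply/cvgrPdist_lt => e e0.
  have B0 : 0 <= B by apply: le_trans (gB 0).
  have B1 : 0 < B + 1 by rewrite ltr_pwDr.
  have r0 : 0 < e * delta / (B + 1) by rewrite divr_gt0 // mulr_gt0.
  near=> y; rewrite /h normr0 mul0r mulr0 sub0r normrN normrM.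
  have td : 0 < `|y| + delta by rewrite ltr_wpDl.
  rewrite [`|_ / _|]ger0_norm ?divr_ge0 ?(ltW td) //.
  apply: le_lt_trans (_ : B * (`|y| / delta) < e).
    apply: ler_pM; rewrite ?divr_ge0 ?(ltW td) //.
    by rewrite ler_wpM2l // lef_pV2 ?posrE // lerDr.
  have : `|y| < e * delta / (B + 1).
    by near: y; apply/nbhs_ballP; exists (e * delta / (B + 1)) => // v; rewrite /ball /= sub0r normrN.
  rewrite ltr_pdivlMr // => h1.
  rewrite mulrA ltr_pdivrMr //; apply: le_lt_trans h1.
  by rewrite mulrC ler_wpM2l // lerDl.
have nt : `|t| != 0 by rewrite normr_eq0.
have td : `|t| + delta != 0 by rewrite gt_eqF // ltr_wpDl.
apply: cvgM.
  apply: continuous_cvg; first exact: gc.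
  apply: continuous_cvg; first exact: sqrt_continuous.
  by apply: cvgB; [apply: cvgV => //; exact: norm_continuous|exact: cvg_cst].
apply: cvgM; first exact: norm_continuous.
by apply: cvgV => //; apply: cvgD; [exact: norm_continuous|exact: cvg_cst].
Unshelve. all: by end_near. Qed.

End Density.
(** * Positive functionals and probability measures on the line *)

Section MeanFunctionals.
Variable R : realType.
Implicit Types (g phi psi : R -> R) (J : (R -> R) -> R) (F : R -> R).

Definition Cb g := continuous g /\ exists B, forall x, `|g x| <= B.

Definition mean_functional J := [/\
  forall a b phi psi, Cb phi -> Cb psi ->
    J (fun x => a * phi x + b * psi x) = a * J phi + b * J psi,
  forall phi psi, Cb phi -> Cb psi -> (forall x, phi x <= psi x) -> J phi <= J psi &
  J (fun=> 1) = 1].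

Lemma Cb_cst (a : R) : Cb (fun=> a).
Proof. by split; [move=> x; exact: cvg_cst | exists `|a|]. Qed.

Lemma Cb_lin a b phi psi : Cb phi -> Cb psi -> Cb (fun x => a * phi x + b * psi x).
Proof.
move=> [c1 [B1 b1]] [c2 [B2 b2]]; split.
  move=> x; apply: cvgD; apply: cvgM; try exact: cvg_cst; [exact: c1|exact: c2].
exists (`|a| * B1 + `|b| * B2) => x; apply: le_trans (ler_normD _ _) _.
by rewrite !normrM; apply: lerD; apply: ler_wpM2l.
Qed.

Lemma Cb_sum n (c : nat -> R) (r : nat -> R -> R) b : (forall k, Cb (r k)) ->
  Cb (fun x => b + \sum_(k < n) c k * r k x).
Proof.
move=> hr; elim: n => [|n IH].
  by under eq_fun => x do rewrite big_ord0 addr0; exact: Cb_cst.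
under eq_fun => x do rewrite big_ord_recr /= addrA -[_ + \sum_(_ < n) _]mul1r.
exact: Cb_lin.
Qed.

Section OneFunctional.
Variable J : (R -> R) -> R.
Hypothesis hJ : mean_functional J.

Lemma mean_cst a : J (fun=> a) = a.
Proof.
have [lin _ one] := hJ.
have -> : (fun _ : R => a) = (fun x => a * (fun=> 1) x + 0 * (fun=> 1) x).
  by apply/funext => x; rewrite mulr1 mul0r addr0.
by rewrite lin ?one; [ring|exact: Cb_cst|exact: Cb_cst].
Qed.

Lemma mean_sum n (c : nat -> R) (r : nat -> R -> R) b : (forall k, Cb (r k)) ->
  J (fun x => b + \sum_(k < n) c k * r k x) = b + \sum_(k < n) c k * J (r k).
Proof.
have [lin _ one] := hJ; move=> hr; elim: n => [|n IH].
  by under eq_fun => x do rewrite big_ord0 addr0; rewrite mean_cst big_ord0 addr0.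
under eq_fun => x do rewrite big_ord_recr /= addrA -[_ + \sum_(_ < n) _]mul1r.
by rewrite lin ?IH ?mul1r ?big_ord_recr /= ?addrA //; exact: Cb_sum.
Qed.

Lemma mean_close phi psi E : Cb phi -> Cb psi -> Cb E ->
  (forall x, `|phi x - psi x| <= E x) -> `|J phi - J psi| <= J E.
Proof.
have [lin mono one] := hJ; move=> c1 c2 cE h.
have E1 : J phi - J psi = J (fun x => 1 * phi x + -1 * psi x) by rewrite lin // mul1r mulN1r.
have E2 : J psi - J phi = J (fun x => 1 * psi x + -1 * phi x) by rewrite lin // mul1r mulN1r.
rewrite ler_norml lerNl opprB E1 E2; apply/andP; split; apply: mono => //; try exact: Cb_lin.
  by move=> x; rewrite mul1r mulN1r; apply: le_trans (h x); rewrite distrC ler_norm.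
by move=> x; rewrite mul1r mulN1r; apply: le_trans (h x); rewrite ler_norm.
Qed.

End OneFunctional.

(** Continuous stand-in for the indicator of the half-line up to [a], linear between [a] and
    [a + d]. *)
Definition ramp (a d x : R) : R := Num.max 0 (Num.min 1 ((a + d - x) / d)).

Lemma ramp_ge0 a d x : 0 <= ramp a d x.
Proof. by rewrite /ramp le_max lexx. Qed.

Lemma ramp_le1 a d x : ramp a d x <= 1.
Proof. by rewrite /ramp ge_max ler01 ge_min lexx. Qed.

Lemma ramp_left a d x : 0 < d -> x <= a -> ramp a d x = 1.
Proof.
move=> d0 xa; rewrite /ramp min_l ?max_r //.
by rewrite ler_pdivlMr // mul1r; lra.
Qed.

Lemma ramp_right a d x : 0 < d -> a + d <= x -> ramp a d x = 0.
Proof.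
move=> d0 xa; rewrite /ramp max_l // ge_min; apply/orP; right.
by rewrite ler_pdivrMr // mul0r; lra.
Qed.

Lemma ramp_mono a b d x : 0 < d -> a <= b -> ramp a d x <= ramp b d x.
Proof.
move=> d0 ab; rewrite /ramp; have h : (a + d - x) / d <= (b + d - x) / d.
  by rewrite ler_wpM2r ?invr_ge0 ?(ltW d0) //; lra.
rewrite ge_max le_max lexx /= le_max; apply/orP; right.
by rewrite le_min !ge_min lexx /= h orbT.
Qed.

Lemma ramp_shift a t d x : 0 < d -> 0 <= t -> ramp (a + t) d x <= ramp a d x + t / d.
Proof.
move=> d0 t0; have td : 0 <= t / d by rewrite divr_ge0 // ltW.
rewrite /ramp; have -> : (a + t + d - x) / d = (a + d - x) / d + t / d.
  by field; rewrite gt_eqF.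
move: td; set y := (_ / d); set s := t / d => td.
by rewrite /Num.max /Num.min; case: ifP; case: ifP; case: ifP; case: ifP; lra.
Qed.

Lemma Cb_ramp a d : Cb (ramp a d).
Proof.
split; last by exists 1 => x; rewrite ger0_norm ?ramp_le1 ?ramp_ge0.
move=> x; apply: (@continuous_max _ _ (fun=> 0 : R) (Num.min 1 \o (fun y => (a + d - y) / d))).
  exact: cvg_cst.
apply: (@continuous_min _ _ (fun=> 1 : R) (fun y => (a + d - y) / d)); first exact: cvg_cst.
by apply: cvgM; [apply: cvgB; [exact: cvg_cst|exact: cvg_id]|exact: cvg_cst].
Qed.

Section Interpolation.
Variables (g : R -> R) (x0 d w : R).
Hypothesis d_gt0 : 0 < d.
Definition node (k : nat) : R := x0 + k%:R * d.
Local Notation pt := node.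

(** The piecewise linear interpolant of [g] at the nodes, constant outside them. Abel summation
    writes it through ramps, since ramps are what a distribution function controls. *)
Definition interp n x := g (pt n) + \sum_(k < n) (g (pt k) - g (pt k.+1)) * ramp (pt k) d x.

Lemma ptS k : pt k.+1 = pt k + d.
Proof. by rewrite /node -natr1 mulrDl mul1r addrA. Qed.

Lemma interpS n x : interp n.+1 x =
  interp n x + (g (pt n) - g (pt n.+1)) * (ramp (pt n) d x - 1).
Proof. by rewrite /interp big_ord_recr /=; ring. Qed.

Lemma interp_left n x : x <= x0 -> interp n x = g x0.
Proof.
move=> h; elim: n => [|n IH]; first by rewrite /interp big_ord0 /node mul0r !addr0.
rewrite interpS IH ramp_left ?subrr ?mulr0 ?addr0 //; apply: le_trans h _.
by rewrite /node lerDl mulr_ge0 // ltW.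
Qed.

Lemma interp_right n x : pt n <= x -> interp n x = g (pt n).
Proof.
elim: n => [|n IH] h; first by rewrite /interp big_ord0 addr0.
have h' : pt n <= x by apply: le_trans h; rewrite ptS lerDl ltW.
by rewrite interpS IH // ramp_right -?ptS //; ring.
Qed.

Lemma interp_close n x : (forall y z, pt 0 <= y <= pt n -> pt 0 <= z <= pt n ->
    `|y - z| <= d -> `|g y - g z| <= w) ->
  pt 0 <= x <= pt n -> `|g x - interp n x| <= w.
Proof.
elim: n => [|n IH] hg /andP[h1 h2].
  have -> : x = pt 0 by apply/eqP; rewrite eq_le h1 h2.
  by rewrite interp_right //; apply: hg; rewrite ?lexx // subrr normr0 ltW.
have nS : pt n <= pt n.+1 by rewrite ptS lerDl ltW.
have [xn|nx] := leP x (pt n).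
  rewrite interpS ramp_left // subrr mulr0 addr0; apply: IH; last by rewrite h1.
  move=> y z /andP[y1 y2] /andP[z1 z2]; apply: hg; first by rewrite y1 (le_trans y2).
  by rewrite z1 (le_trans z2).
rewrite interpS (interp_right (ltW nx)); set r := ramp _ _ _.
have r0 : 0 <= r := ramp_ge0 _ _ _; have r1 : r <= 1 := ramp_le1 _ _ _.
have n0 : pt 0 <= pt n by rewrite /node mul0r addr0 lerDl mulr_ge0 // ltW.
have dx : x - pt n <= d by move: h2; rewrite ptS; lra.
have a1 : `|g x - g (pt n)| <= w.
  apply: hg; rewrite ?h1 ?n0 //=; rewrite ger0_norm //; first by rewrite subr_ge0 ltW.
have a2 : `|g x - g (pt n.+1)| <= w.
  apply: hg; rewrite ?h1 ?(le_trans n0) ?lexx //=.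
  rewrite distrC ger0_norm ?subr_ge0 //; move: (ltW nx); rewrite ptS; lra.
have -> : g x - (g (pt n) + (g (pt n) - g (pt n.+1)) * (r - 1)) =
   r * (g x - g (pt n)) + (1 - r) * (g x - g (pt n.+1)) by ring.
apply: le_trans (ler_normD _ _) _; have r1' : 0 <= 1 - r by rewrite subr_ge0.
rewrite !normrM (ger0_norm r0) (ger0_norm r1').
have := ler_wpM2l r0 a1; have := ler_wpM2l r1' a2; lra.
Qed.

Lemma Cb_interp n : Cb (interp n).
Proof.
exact: (@Cb_sum n (fun k => g (pt k) - g (pt k.+1)) (fun k => ramp (pt k) d) (g (pt n))
  (fun k => Cb_ramp _ _)).
Qed.

End Interpolation.

Lemma unif_cont_itv g (T w : R) : continuous g -> 0 < T -> 0 < w ->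
  exists2 d, 0 < d & forall x y, -T <= x <= T -> -T <= y <= T -> `|x - y| < d ->
    `|g x - g y| < w.
Proof.
move=> gc T0 w0; pose h t := g (- T + 2 * T * t).
have hc : continuous h.
  move=> t; apply: (@continuous_comp _ _ _ (fun t => - T + 2 * T * t) g); last exact: gc.
  by apply: cvgD; [exact: cvg_cst|apply: cvgM; [exact: cvg_cst|exact: cvg_id]].
have fc : {within [set p : R * R | p.1 \in `[0, 1] /\ p.2 \in `[0, 1]],
    continuous (fun p : R * R => (fun x (_ : R) => h x) p.1 p.2)}.
  apply: continuous_subspaceT => p /=.
  by apply: (@continuous_comp _ _ _ fst h); [exact: cvg_fst|exact: hc].
have [d d0 hd] := @square_unif_cont R (fun x _ => h x) fc _ w0.
have T2 : 0 < 2 * T by rewrite mulr_gt0.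
exists (2 * T * d); first by rewrite mulr_gt0.
move=> x y /andP[x1 x2] /andP[y1 y2] xy.
have z0 : (0 : R) \in `[0, 1] by rewrite in_itv /= lexx ler01.
pose c v := (v + T) / (2 * T).
have cI v : - T <= v -> v <= T -> c v \in `[(0 : R), 1].
  move=> v1 v2; rewrite in_itv /= /c divr_ge0 ?(ltW T2) //=; last by lra.
  by rewrite ler_pdivrMr // mul1r; lra.
have hE v : h (c v) = g v by rewrite /h /c; congr g; field; rewrite gt_eqF.
rewrite -(hE x) -(hE y); apply: (hd _ 0 _ 0) => //; rewrite ?cI ?subrr ?normr0 //.
have -> : c x - c y = (x - y) / (2 * T) by rewrite /c; field; rewrite gt_eqF.
by rewrite normrM [X in _ * X]gtr0_norm ?invr_gt0 // ltr_pdivrMr // mulrC.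
Qed.

(** On each ramp the functionals differ by at most an increment of [F], and the coefficients of the
    interpolant are at most [w], so the differences telescope to [w]. The tails, where [g] may be
    [2 B] away from its interpolant, have mass at most [w] on each side. *)
Lemma mean_functional_eq J J' F : mean_functional J -> mean_functional J' ->
  {homo F : x y / x <= y} ->
  (forall e, 0 < e -> exists2 T, 0 < T & F (- T) <= e /\ 1 - e <= F T) ->
  (forall x, 0 <= F x <= 1) ->
  (forall a d, 0 < d -> F a <= J (ramp a d) <= F (a + d)) ->
  (forall a d, 0 < d -> F a <= J' (ramp a d) <= F (a + d)) ->
  forall g, Cb g -> J g = J' g.
Proof.
move=> hJ hJ' Fm Flim F01 JF J'F g cg; have [gc [B gB]] := cg.
have B0 : 0 <= B by apply: le_trans (gB 0).
suff H e : 0 < e -> `|J g - J' g| <= e.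
  by apply/eqP; rewrite -subr_eq0 -normr_le0; apply/ler_addgt0Pr => e e0; rewrite add0r H.
(* The total error is [2 (w + 4 B w) + w]. *)
move=> e0; pose w := e / (3 + 8 * B).
have p0 : 0 < 3 + 8 * B by rewrite ltr_pwDl // mulr_ge0.
have w0 : 0 < w by rewrite divr_gt0.
(* The extra 1 leaves room for a ramp of width [d <= 1] outside [[-T0, T0]]. *)
have [T0 T00 [Fl Fr]] := Flim w w0; pose T := T0 + 1.
have Tp : 0 < T by rewrite addr_gt0.
have [d0 d00 hd] := unif_cont_itv gc Tp w0.
pose n := (Num.bound (2 * T * (1 + d0^-1))).+1.
have nR : 0 < n%:R :> R by rewrite ltr0n.
pose d := 2 * T / n%:R.
have dp : 0 < d by rewrite divr_gt0 // mulr_gt0.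
have nb : 2 * T * (1 + d0^-1) < n%:R.
  apply: lt_trans (archi_boundP _) _; last by rewrite ltr_nat.
  by rewrite mulr_ge0 ?addr_ge0 ?invr_ge0 ?mulr_ge0 // ltW.
have di0 : 0 < d0^-1 by rewrite invr_gt0.
have T2 : 0 < 2 * T by rewrite mulr_gt0.
have d1 : d <= 1 by rewrite ler_pdivrMr // mul1r; apply: ltW; nra.
have dd : d < d0.
  rewrite ltr_pdivrMr // -ltr_pdivrMl //; apply: le_lt_trans nb.
  by rewrite mulrC ler_pM2l //; lra.
pose x := node (- T) d.
have xn : x n = T by rewrite /x /node /d; field; rewrite gt_eqF.
have xn1 : x n.-1 = T - d.
  have xS : x n = x n.-1 + d := ptS (- T) d n.-1.
  by rewrite -xn xS addrK.
(* [r 0] dominates the left tail and [r 1] the right one. *)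
pose r (k : nat) y : R := if k == 0%N then ramp (x 0%N) d y else 1 * 1 + -1 * ramp (x n.-1) d y.
have cr k : Cb (r k).
  rewrite /r; case: eqP => _; first exact: Cb_ramp.
  by apply: (@Cb_lin 1 (-1) (fun=> 1)); [exact: Cb_cst|exact: Cb_ramp].
have cE : Cb (fun y => w + \sum_(k < 2) (2 * B) * r k y) by exact: (@Cb_sum 2 (fun=> 2 * B)).
have cI := @Cb_interp g (- T) d n.
have close y : `|g y - interp g (- T) d n y| <= w + \sum_(k < 2) (2 * B) * r k y.
  rewrite !big_ord_recl big_ord0 addr0 /r /= mul1r mulN1r.
  have r0 := ramp_ge0 (x 0%N) d y; have r1 := ramp_le1 (x n.-1) d y.
  have B2 : 0 <= 2 * B by rewrite mulr_ge0.
  have gB2 z : `|g y - g z| <= 2 * B.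
    by apply: le_trans (ler_normB _ _) _; have := gB y; have := gB z; lra.
  have x00 : x 0%N = - T by rewrite /x /node mul0r addr0.
  have [yT|yT] := leP y (- T).
    rewrite interp_left // [ramp (x 0%N) d y]ramp_left ?x00 // mulr1.
    by apply: le_trans (gB2 _) _; nra.
  have [Ty|Ty] := leP T y.
    rewrite interp_right // -/(x n) ?xn // [ramp (x n.-1) d y]ramp_right ?xn1 ?subrK //.
    by apply: le_trans (gB2 _) _; nra.
  apply: (@le_trans _ _ w); last by nra.
  apply: interp_close => //; rewrite -/(x 0%N) -/(x n) ?x00 ?xn ?(ltW yT) ?(ltW Ty) //.
  by move=> z z' hz hz' zz'; apply/ltW/hd => //; apply: le_lt_trans zz' dd.
have env K : mean_functional K -> (forall a d, 0 < d -> F a <= K (ramp a d) <= F (a + d)) ->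
    `|K g - K (interp g (- T) d n)| <= w + 4 * B * w.
  move=> hK KF; apply: le_trans (mean_close hK cg cI cE close) _.
  rewrite (mean_sum hK _ (fun=> 2 * B) _ cr) !big_ord_recl big_ord0 addr0 /r /= lerD2l.
  have [lin _ one] := hK.
  rewrite (lin 1 (-1) (fun=> 1)) ?one; try exact: Cb_ramp; last exact: Cb_cst.
  have /andP[_ k1] := KF (x 0%N) d dp; have /andP[k2 _] := KF (x n.-1) d dp.
  have f1 : F (x 0%N + d) <= w.
    by apply: le_trans Fl; apply: Fm; rewrite /x /node mul0r addr0 /T; lra.
  have f2 : 1 - w <= F (x n.-1) by apply: le_trans Fr _; apply: Fm; rewrite xn1 /T; lra.
  have B2 : 0 <= 2 * B by rewrite mulr_ge0.
  rewrite -mulrDr; have -> : 4 * B * w = 2 * B * (w + w) by ring.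
  apply: ler_wpM2l => //; lra.
have mid : `|J (interp g (- T) d n) - J' (interp g (- T) d n)| <= w.
  have cR k : Cb (ramp (x k) d) by exact: Cb_ramp.
  rewrite (mean_sum hJ n (fun k => g (x k) - g (x k.+1)) (g (x n)) cR).
  rewrite (mean_sum hJ' n (fun k => g (x k) - g (x k.+1)) (g (x n)) cR).
  rewrite opprD addrACA subrr add0r -sumrB; apply: le_trans (ler_norm_sum _ _ _) _.
  apply: le_trans (_ : \sum_(k < n) w * (F (x k.+1) - F (x k)) <= _).
    apply: ler_sum => k _; rewrite -mulrBr normrM.
    have xS : x k.+1 = x k + d by rewrite /x ptS.
    have xT (j : nat) : (j <= n)%N -> - T <= x j <= T.
      move=> jn; rewrite -{2}xn /x /node lerDl mulr_ge0 ?(ltW dp) //= lerD2l ler_wpM2r ?(ltW dp) //.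
      by rewrite ler_nat.
    apply: ler_pM => //.
      apply/ltW/hd; [exact/xT/ltnW|exact: xT|].
      by rewrite xS opprD addrA subrr add0r normrN gtr0_norm.
    have /andP[k1 k2] := JF (x k) d dp; have /andP[k3 k4] := J'F (x k) d dp.
    by rewrite xS ler_norml; apply/andP; split; lra.
  rewrite -mulr_sumr -(big_mkord xpredT (fun k => F (x k.+1) - F (x k))) telescope_sumr //.
  have /andP[f1 f2] := F01 (x n); have /andP[f3 f4] := F01 (x 0%N).
  by rewrite ler_piMr ?(ltW w0) //; lra.
have e1 := env J hJ JF; have e2 := env J' hJ' J'F.
have -> : J g - J' g = (J g - J (interp g (- T) d n)) +
  ((J (interp g (- T) d n) - J' (interp g (- T) d n)) - (J' g - J' (interp g (- T) d n))) by ring.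
have eE : e = (w + 4 * B * w) + (w + (w + 4 * B * w)).
  have -> : (w + 4 * B * w) + (w + (w + 4 * B * w)) = (3 + 8 * B) * w by ring.
  by rewrite /w mulrC divfK // gt_eqF.
rewrite eE; apply: le_trans (ler_normD _ _) _; apply: lerD => //.
by apply: le_trans (ler_normB _ _) _; apply: lerD.
Qed.

End MeanFunctionals.

(** * Means and distribution functions of probability measures *)

Section ProbabilityMean.
Variables (R : realType) (P : probability (measurableTypeR R) R).

Definition prob_mean (g : R -> R) : R := fine (\int[P]_x (g x)%:E).
Definition prob_cdf (a : R) : R := fine (P `]-oo, a]%classic).

Lemma Cb_integrable g : Cb g -> P.-integrable setT (EFin \o g).
Proof.
move=> [gc [B gB]]; apply: measurable_bounded_integrable => //.
- by apply: (le_lt_trans (probability_le1 P measurableT)); rewrite ltry.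
- exact: continuous_measurable_fun.
- exists B; split; first exact: num_real.
  by move=> x Bx y _; apply: le_trans (gB y) (ltW Bx).
Qed.

Lemma prob_mean_functional : mean_functional prob_mean.
Proof.
have E g : prob_mean g = Rintegral P setT g by [].
split.
- move=> a b phi psi c1 c2; rewrite !E.
  have i1 := Cb_integrable c1; have i2 := Cb_integrable c2.
  rewrite RintegralD //; first by rewrite !RintegralZl.
  + by have := Cb_integrable (Cb_lin a 0 c1 c1); under eq_fun => x do rewrite mul0r addr0.
  + by have := Cb_integrable (Cb_lin b 0 c2 c2); under eq_fun => x do rewrite mul0r addr0.
- by move=> phi psi c1 c2 h; rewrite !E le_Rintegral //; exact: Cb_integrable.
- rewrite /prob_mean integral_cst // mul1e; apply: (congr1 fine (probability_setT P)).
Qed.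

Lemma prob_cdfE a : P `]-oo, a]%classic = (prob_cdf a)%:E.
Proof. by rewrite /prob_cdf fineK // fin_num_measure. Qed.

Lemma prob_mean_indic (A : set R) : measurable A ->
  Rintegral P setT (\1_A : R -> R) = fine (P A).
Proof. by move=> mA; rewrite /Rintegral integral_indic // setIT. Qed.

Lemma le_fine_prob (A B : set R) : measurable A -> measurable B -> A `<=` B ->
  fine (P A) <= fine (P B).
Proof.
move=> mA mB AB; apply: fine_le; rewrite ?fin_num_measure //.
by apply: le_measure; rewrite ?inE.
Qed.

Lemma le_prob_mean (A : set R) g : measurable A -> Cb g ->
  (forall x, (\1_A x : R) <= g x) -> fine (P A) <= prob_mean g.
Proof.
move=> mA cg h; rewrite -prob_mean_indic //.
apply: le_Rintegral => //.
- exact: integrable_indic.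
- exact: Cb_integrable.
- by move=> x _; exact: h.
Qed.

Lemma prob_mean_le (A : set R) g : measurable A -> Cb g ->
  (forall x, g x <= (\1_A x : R)) -> prob_mean g <= fine (P A).
Proof.
move=> mA cg h; rewrite -prob_mean_indic //.
apply: le_Rintegral => //.
- exact: Cb_integrable.
- exact: integrable_indic.
Qed.

Lemma prob_cdf_ramp a d : 0 < d ->
  prob_cdf a <= prob_mean (ramp a d) <= prob_cdf (a + d).
Proof.
move=> d0; apply/andP; split.
  apply: le_prob_mean => //; first exact: Cb_ramp.
  move=> x; rewrite indicE mem_setE in_itv /=; have [xa|xa] := leP x a; last by rewrite mulr0n ramp_ge0.
  by rewrite ramp_left.
apply: prob_mean_le => //; first exact: Cb_ramp.
move=> x; rewrite indicE mem_setE in_itv /=; have [xa|xa] := leP x (a + d); first by rewrite mulr1n ramp_le1.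
by rewrite mulr0n ramp_right // ltW.
Qed.

Lemma prob_cdf01 a : 0 <= prob_cdf a <= 1.
Proof.
rewrite /prob_cdf fine_ge0 //= -[leRHS]/(fine 1%:E); apply: fine_le => //.
  by rewrite fin_num_measure.
exact: probability_le1.
Qed.

Lemma prob_cdf_homo : {homo prob_cdf : x y / x <= y}.
Proof. by move=> x y xy; apply: le_fine_prob => //; exact: subset_itvl. Qed.

End ProbabilityMean.

(** * Riesz representation on the line *)

Section Riesz.
Variable R : realType.
Variables (J : (R -> R) -> R) (K : R).
Hypothesis hJ : mean_functional J.
Hypothesis K_gt0 : 0 < K.
Hypothesis J_tight : forall phi e, Cb phi -> 0 <= e ->
  (forall x, `|phi x| <= e * (1 + x ^+ 2)) -> `|J phi| <= e * K.

(** Shrinking widths approach the closed half-line from outside, which makes the infimum right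
    continuous. *)
Definition mean_cdf (a : R) : R := inf [set J (ramp a d) | d in [set d : R | 0 < d]].
Local Notation F := mean_cdf.

Let mono phi psi : Cb phi -> Cb psi -> (forall x, phi x <= psi x) -> J phi <= J psi.
Proof. by case: hJ => _ + _; apply. Qed.

Let ramp_J0 a d : 0 <= J (ramp a d).
Proof.
rewrite -(mean_cst hJ 0); apply: mono; [exact: Cb_cst|exact: Cb_ramp|].
by move=> x; exact: ramp_ge0.
Qed.

Let ramp_J1 a d : J (ramp a d) <= 1.
Proof.
rewrite -(mean_cst hJ 1); apply: mono; [exact: Cb_ramp|exact: Cb_cst|].
by move=> x; exact: ramp_le1.
Qed.

Let has_infJ a : has_inf [set J (ramp a d) | d in [set d : R | 0 < d]].
Proof.
split; first by exists (J (ramp a 1)), 1 => //=.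
by exists 0 => _ [d _ <-].
Qed.

Lemma mean_cdf_le a d : 0 < d -> F a <= J (ramp a d).
Proof. by move=> d0; apply: ge_inf; [case: (has_infJ a)|exists d]. Qed.

Lemma mean_cdf_ge a b : (forall d, 0 < d -> b <= J (ramp a d)) -> b <= F a.
Proof.
by move=> h; apply: lb_le_inf; [case: (has_infJ a)|move=> _ [d d0 <-]; exact: h].
Qed.

Lemma mean_cdf_ramp a d : 0 < d -> F a <= J (ramp a d) <= F (a + d).
Proof.
move=> d0; rewrite mean_cdf_le //=; apply: mean_cdf_ge => d' d'0.
apply: mono; [exact: Cb_ramp|exact: Cb_ramp|move=> x].
have [xa|ax] := leP x (a + d); first by rewrite [leRHS]ramp_left // ramp_le1.
by rewrite ramp_right ?ramp_ge0 // ltW.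
Qed.

Lemma mean_cdf_homo : {homo F : x y / x <= y}.
Proof.
move=> x y xy; apply: mean_cdf_ge => d d0; apply: le_trans (mean_cdf_le x d0) _.
by apply: mono; [exact: Cb_ramp|exact: Cb_ramp|move=> z; exact: ramp_mono].
Qed.

Lemma mean_cdf01 a : 0 <= F a <= 1.
Proof.
apply/andP; split; first by apply: mean_cdf_ge => d _; exact: ramp_J0.
exact: le_trans (mean_cdf_le a ltr01) (ramp_J1 a 1).
Qed.

(** For a fixed near-optimal width [d], moving the ramp by [b - a] costs at most [(b - a) / d]. *)
Lemma mean_cdf_right : right_continuous F.
Proof.
move=> a; apply/cvgrPdist_le => e e0.
have e2 : 0 < e / 2 by rewrite divr_gt0.
have [_ [d d0 <-] hd] := inf_adherent e2 (has_infJ a); rewrite -/(F a) in hd.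
near=> b.
have ab : a <= b by near: b; exact: nbhs_right_ge.
have bd : b - a <= e / 2 * d.
  have : b < a + e / 2 * d by near: b; apply: nbhs_right_lt; rewrite ltrDl mulr_gt0.
  by move=> h; lra.
rewrite distrC ger0_norm; last by rewrite subr_ge0 mean_cdf_homo.
have [lin _ one] := hJ.
have h : J (ramp b d) <= J (ramp a d) + (b - a) / d.
  have -> : J (ramp a d) + (b - a) / d = J (fun x => 1 * ramp a d x + (b - a) / d * (fun=> 1) x).
    by rewrite lin ?one ?mul1r ?mulr1 //; [exact: Cb_ramp|exact: Cb_cst].
  apply: mono; [exact: Cb_ramp|apply: Cb_lin; [exact: Cb_ramp|exact: Cb_cst]|].
  move=> x; rewrite mul1r mulr1.
  by have := @ramp_shift _ a (b - a) d x d0; rewrite subr_ge0 addrC subrK; apply.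
have h2 : (b - a) / d <= e / 2 by rewrite ler_pdivrMr.
have := mean_cdf_le b d0; lra.
Unshelve. all: by end_near. Qed.

Let tail e : 0 < e -> exists2 T, 0 < T & F (- T) <= e /\ 1 - e <= F T.
Proof.
(* Chebyshev's inequality: [S^-2 * (1 + x^2)] is at least 1 beyond [S], and [S^-2 * K = e]. *)
move=> e0; pose S := Num.sqrt (K / e).
have S2 : S ^+ 2 = K / e by rewrite sqr_sqrtr // divr_ge0 // ltW.
have S0 : 0 < S by rewrite sqrtr_gt0 divr_gt0.
have eK : S ^- 2 * K = e by rewrite S2; field; rewrite !gt_eqF.
have i0 : 0 <= S ^- 2 by rewrite invr_ge0 exprn_ge0 // ltW.
have far x : S <= `|x| -> 1 <= S ^- 2 * (1 + x ^+ 2).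
  move=> h; rewrite mulrC ler_pdivlMr ?exprn_gt0 // mul1r.
  apply: le_trans (_ : x ^+ 2 <= _); last by rewrite lerDr.
  by rewrite -[leRHS]real_normK ?num_real // ler_pXn2r ?nnegrE // ltW.
have near x : 0 <= S ^- 2 * (1 + x ^+ 2).
  by rewrite mulr_ge0 // addr_ge0 // sqr_ge0.
exists (S + 1); first by rewrite addr_gt0.
split.
  apply: le_trans (mean_cdf_le _ ltr01) _; apply: le_trans (ler_norm _) _.
  rewrite -[leRHS]eK; apply: J_tight => //; first exact: Cb_ramp.
  move=> x; rewrite ger0_norm ?ramp_ge0 //.
  have [xS|xS] := leP x (- S).
    apply: le_trans (ramp_le1 _ _ _) (far _ _).
    by rewrite -normrN; apply: le_trans (ler_norm _); rewrite lerNr.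
  by rewrite ramp_right // opprD subrK ltW.
apply: mean_cdf_ge => d d0.
have [lin _ one] := hJ.
have h : `|J (fun x => 1 * (fun=> 1) x + -1 * ramp (S + 1) d x)| <= e.
  rewrite -[leRHS]eK; apply: J_tight => //.
    by apply: Cb_lin; [exact: Cb_cst|exact: Cb_ramp].
  move=> x; rewrite mulr1 mulN1r.
  have r0 := ramp_ge0 (S + 1) d x; have r1 := ramp_le1 (S + 1) d x.
  rewrite ger0_norm ?subr_ge0 //.
  have [xS|xS] := leP x (S + 1); first by rewrite ramp_left // subrr.
  have Sx : S <= `|x| by apply: le_trans (ler_norm _); apply: ltW; apply: lt_trans xS; rewrite ltrDl.
  by have := far x Sx; lra.
have := le_trans (ler_norm _) h; rewrite lin ?one; [|exact: Cb_cst|exact: Cb_ramp].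
lra.
Qed.

Let F_cvgNy : F @ -oo --> (0 : R).
Proof.
apply/cvgrPdist_le => e e0; have [T T0 [h _]] := tail e0.
near=> x; rewrite sub0r normrN ger0_norm; last by case/andP: (mean_cdf01 x).
apply: le_trans h; apply: mean_cdf_homo.
by near: x; apply: nbhs_ninfty_le; exact: num_real.
Unshelve. all: by end_near. Qed.

Let F_cvgy : F @ +oo --> (1 : R).
Proof.
apply/cvgrPdist_le => e e0; have [T T0 [_ h]] := tail e0.
near=> x; rewrite ger0_norm; last by rewrite subr_ge0; case/andP: (mean_cdf01 x).
have : F T <= F x.
  by apply: mean_cdf_homo; near: x; apply: nbhs_pinfty_ge; exact: num_real.
lra.
Unshelve. all: by end_near. Qed.

#[local] HB.instance Definition _ :=
  isCumulative.Build R _ R F mean_cdf_homo mean_cdf_right.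
#[local] HB.instance Definition _ :=
  isCumulativeBounded.Build R 0 1 F F_cvgNy F_cvgy.

(** The Lebesgue-Stieltjes measure of [mean_cdf] obeys the same bounds on ramps as [J], so
    [mean_functional_eq] applies. *)
Lemma riesz_mean : exists mu : probability (measurableTypeR R) R,
  forall g, Cb g -> prob_mean mu g = J g.
Proof.
pose mu : probability (measurableTypeR R) R := lebesgue_stieltjes_measure F.
exists mu; apply: (@mean_functional_eq _ _ _ F) => //.
- exact: prob_mean_functional.
- exact: mean_cdf_homo.
- exact: mean_cdf01.
- move=> a d d0; have cdfE b : prob_cdf mu b = F b.
    rewrite /prob_cdf; have := cdf_lebesgue_stieltjes_id F b.
    by rewrite /cdf /distribution /pushforward preimage_id => ->.
  by rewrite -!cdfE; exact: prob_cdf_ramp.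
- exact: mean_cdf_ramp.
Qed.

End Riesz.

(** * Null sets, tails and reflection of probability measures *)

Section RealProbability.
Variable R : realType.

Let idR : measurableTypeR R -> R := idfun.

#[local] HB.instance Definition _ :=
  @isMeasurableFun.Build _ _ _ _ idR (@measurable_id _ _ setT).

Section OneProbability.
Variable P : probability (measurableTypeR R) R.
Local Notation G := (prob_cdf P).

Lemma prob_cdf_right : right_continuous G.
Proof.
move=> a; apply: fine_cvg; rewrite fineK ?fin_num_measure //.
have := @cdf_right_continuous _ _ _ P (idR : {RV P >-> R}) a; rewrite /cdf /distribution /pushforward; exact.
Qed.

Lemma prob_cdf_cvgy : G @ +oo --> (1 : R).
Proof. exact/fine_cvg/(cvg_cdfy1 (idR : {RV P >-> R})). Qed.

Lemma prob_itvoc a b : a <= b -> P `]a, b]%classic = (G b - G a)%:E.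
Proof.
move=> ab; rewrite EFinB -!prob_cdfE.
have -> : `]a, b]%classic = `]-oo, b]%classic `\` `]-oo, a]%classic.
  by rewrite -[RHS]setCK setCD setCitvl setUC -[LHS]setCK setCitv.
rewrite measureD ?setIidr //; first exact: subset_itvl.
by rewrite -ge0_fin_numE // fin_num_measure.
Qed.

(** A null set has covers by half-open intervals of arbitrarily small total length, and the
    Lipschitz bound carries each cover over to [P]. The [+ 1] in the denominator allows
    [kappa = 0]. *)
Lemma prob_abs_continuous kappa : 0 <= kappa ->
  (forall a b, a <= b -> G b - G a <= kappa * (b - a)) -> P `<< @lebesgue_measure R.
Proof.
move=> k0 lip N nN A mA AN; have lA : lebesgue_measure A = 0%E by exact: nN.
apply/eqP; rewrite eq_le measure_ge0 andbT; apply/lee_addgt0Pr => e e0; rewrite add0e.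
have : (lebesgue_measure A < (e / (kappa + 1))%:E)%E.
  by rewrite lA lte_fin divr_gt0 // ltr_wpDl.
rewrite /lebesgue_measure /lebesgue_stieltjes_measure /measure_extension.
move=> /ereal_inf_lt [_ [F [mF AF] <-]] sF.
have PF k : (P (F k) <= kappa%:E * wlength idfun (F k))%E.
  have /ocitvP [->|[[a b] /= ab ->]] := mF k; first by rewrite measure0 wlength0 mule0.
  rewrite prob_itvoc ?(ltW ab) // wlength_itv_bnd ?(ltW ab) // -EFinM lee_fin.
  by apply: lip; exact: ltW.
have mF' k : measurable (F k : set (measurableTypeR R)).
  by have /ocitvP [->|[[a b] /= ab ->]] := mF k; [exact: measurable0|exact: measurable_itv].
apply: le_trans (measure_sigma_subadditive P mF' mA AF) _.
apply: le_trans (_ : \sum_(k <oo) (kappa%:E * wlength idfun (F k)) <= _)%E.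
  by apply: lee_nneseries => [k _ _|k _]; [exact: measure_ge0|exact: PF].
rewrite nneseriesZl; [|by move=> k _; exact: wlength_ge0].
apply: le_trans (_ : kappa%:E * (e / (kappa + 1))%:E <= _)%E.
  by apply: lee_wpmul2l; [rewrite lee_fin|exact: ltW].
rewrite -EFinM lee_fin mulrA ler_pdivrMr ?ltr_wpDl // mulrC ler_wpM2l ?(ltW e0) //.
by rewrite lerDl.
Qed.

(* By subdivision, increments that are quadratic in the length vanish. *)
Lemma prob_right_tail_eq0 M c :
  (forall a h, M <= a -> 0 < h -> G (a + h) - G a <= c * h ^+ 2) -> P `]M, +oo[%classic = 0%E.
Proof.
move=> H; have c0 : 0 <= c.
  apply: le_trans (_ : G (M + 1) - G M <= _); last first.
    by have := H M 1 (lexx _) ltr01; rewrite expr1n mulr1.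
  by rewrite subr_ge0; apply: prob_cdf_homo; rewrite lerDl.
have flat l : 0 < l -> G (M + l) <= G M.
  move=> l0; apply/ler_addgt0Pr => e e0.
  pose n := (Num.bound (c * l ^+ 2 / e)).+1; have nR : 0 < n%:R :> R by rewrite ltr0n.
  have hn : 0 < l / n%:R by rewrite divr_gt0.
  have step k : G (M + k%:R * (l / n%:R)) - G M <= k%:R * (c * (l / n%:R) ^+ 2).
    elim: k => [|k IH]; first by rewrite !mul0r addr0 subrr.
    have Mk : M <= M + k%:R * (l / n%:R) by rewrite lerDl mulr_ge0 // ltW.
    have := H _ _ Mk hn; rewrite -natr1 !mulrDl !mul1r addrA; move: IH.
    set x := G _; set y := G _; set z := G _; lra.
  have := step n; have -> : n%:R * (l / n%:R) = l by field; rewrite gt_eqF.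
  have -> : n%:R * (c * (l / n%:R) ^+ 2) = c * l ^+ 2 / n%:R by field; rewrite gt_eqF.
  have : c * l ^+ 2 / n%:R <= e.
    rewrite ler_pdivrMr // [e * _]mulrC -ler_pdivrMr //; apply: ltW.
    apply: lt_trans (archi_boundP _) _; last by rewrite ltr_nat.
    by rewrite divr_ge0 ?mulr_ge0 ?exprn_ge0 // ltW.
  lra.
have G1 : 1 <= G M.
  apply: (cvgr_to_le prob_cdf_cvgy); near=> x.
  have Mx : M < x by near: x; apply: nbhs_pinfty_gt; exact: num_real.
  by have := flat (x - M); rewrite subr_gt0 addrC subrK; apply.
have -> : `]M, +oo[%classic = ~` `]-oo, M]%classic by rewrite setCitvl.
rewrite probability_setC // prob_cdfE -EFinB; congr (_%:E).
by apply/eqP; rewrite subr_eq0 eq_le G1; case/andP: (prob_cdf01 P M).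
Unshelve. all: by end_near. Qed.

End OneProbability.

Lemma prob_cdf_inj (P Q : probability (measurableTypeR R) R) :
  (forall a, prob_cdf P a = prob_cdf Q a) -> forall A, measurable A -> P A = Q A.
Proof.
move=> h A mA; rewrite -(lebesgue_stieltjes_cdf_id P mA).
apply: lebesgue_stieltjes_measure_unique => // X oX.
have mX : measurable (X : set (measurableTypeR R)).
  by have /ocitvP [->|[[a b] /= ab ->]] := oX; [exact: measurable0|exact: measurable_itv].
rewrite (lebesgue_stieltjes_cdf_id P mX).
have /ocitvP [->|[[a b] /= ab ->]] := oX; first by rewrite !measure0.
by rewrite !prob_itvoc ?(ltW ab) // !h.
Qed.

(** A ramp puts each distribution function at [a] below the other at any [b > a]; right continuity
    removes the gap. *)
Lemma prob_mean_inj (P Q : probability (measurableTypeR R) R) :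
  (forall g, Cb g -> prob_mean P g = prob_mean Q g) -> forall A, measurable A -> P A = Q A.
Proof.
have half (P' Q' : probability (measurableTypeR R) R) a :
    (forall g, Cb g -> prob_mean P' g = prob_mean Q' g) -> prob_cdf P' a <= prob_cdf Q' a.
  move=> h; apply: (cvgr_to_ge (@prob_cdf_right Q' a)); near=> b.
  have ab : a < b by near: b; exact: nbhs_right_gt.
  have d0 : 0 < b - a by rewrite subr_gt0.
  have /andP[h1 _] := prob_cdf_ramp P' a d0; have /andP[_ h2] := prob_cdf_ramp Q' a d0.
  apply: le_trans h1 _; rewrite h; last exact: Cb_ramp.
  by apply: le_trans h2 _; rewrite addrC subrK.
move=> h; apply: prob_cdf_inj => a; apply/eqP; rewrite eq_le !half //.
by move=> g cg; rewrite h.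
Unshelve. all: by end_near. Qed.

Let oppR : measurableTypeR R -> measurableTypeR R := fun x => - x.

Let oppR_measurable : measurable_fun setT oppR.
Proof. by apply: continuous_measurable_fun; exact: opp_continuous. Qed.

#[local] HB.instance Definition _ :=
  @isMeasurableFun.Build _ _ _ _ oppR oppR_measurable.

Lemma Cb_reflect (g : R -> R) : Cb g -> Cb (fun x => g (- x)).
Proof.
move=> [gc [B gB]]; split; last by exists B => x.
by move=> x; apply: (@continuous_comp _ _ _ -%R g); [exact: opp_continuous|exact: gc].
Qed.

Lemma prob_reflect (P : probability (measurableTypeR R) R) :
  (forall g, Cb g -> prob_mean P (fun x => g (- x)) = prob_mean P g) ->
  forall A : set R, measurable A -> P [set - x | x in A] = P A.
Proof.
move=> h A mA.
pose Q : probability (measurableTypeR R) R := distribution P (oppR : {mfun _ >-> _}).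
have QE B : Q B = P (oppR @^-1` B) by [].
have -> : [set - x | x in A] = oppR @^-1` A.
  apply/seteqP; split => [_ [x Ax <-]|x Ax]; first by rewrite /= /oppR opprK.
  by exists (- x) => //; rewrite opprK.
rewrite -QE; apply: prob_mean_inj => // g cg; rewrite -h //.
rewrite /prob_mean /Q /distribution integral_pushforward //.
- by apply/measurable_EFinP; apply: continuous_measurable_fun; exact: cg.1.
- exact: (Cb_integrable P (Cb_reflect cg)).
Qed.

End RealProbability.
(** * The random graph *)

Section Model.
Variable R : realType.
Local Notation K := R[i].
Local Notation toC := (real_complex R).
Variables (f : R -> R -> R) (eps : nat -> R) (C : R).
Hypothesis C_gt0 : 0 < C.
Hypothesis f_le : forall x y, x \in `[0, 1] -> y \in `[0, 1] -> f x y <= C.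
Hypothesis f_ge0 : forall x y, x \in `[0, 1] -> y \in `[0, 1] -> 0 <= f x y.
Hypothesis f_sym : forall x y, x \in `[0, 1] -> y \in `[0, 1] -> f x y = f y x.
Hypothesis f_unif : forall e, 0 < e -> exists2 d, 0 < d &
  forall x y x' y', x \in `[0, 1] -> y \in `[0, 1] -> x' \in `[0, 1] -> y' \in `[0, 1] ->
  `|x - x'| < d -> `|y - y'| < d -> `|f x y - f x' y'| < e.
Hypothesis eps_gt0 : forall N, 0 < eps N.
Hypothesis eps_to0 : eps @ \oo --> (0 : R).
Hypothesis Neps_toy : (fun N : nat => N%:R * eps N) @ \oo --> +oo.

Definition cN N : R := (N%:R * eps N)^-1.
Definition grid N (i : 'I_N) : R := i.+1%:R / N%:R.
Definition fN N (i j : 'I_N) : R := f (grid i) (grid j).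
Definition EN N (X : {set 'I_N * 'I_N} -> R) : R :=
  Ex (fun e => edge_prob f eps e.1 e.2) X.
Definition HN N (G : {set 'I_N * 'I_N}) : 'M[R]_N := scaled_adj (cN N) G.
Definition greenN N (z : K) (G : {set 'I_N * 'I_N}) (i : 'I_N) : K := resg (cN N) z G i.
Definition avgerr N z (G : {set 'I_N * 'I_N}) : R :=
  N%:R^-1 * \sum_i normc (qve_defect (@fN N) z (greenN z G) i).
Definition avgerr2 N z (G : {set 'I_N * 'I_N}) : R :=
  N%:R^-1 * \sum_i normc (qve_defect (@fN N) z (greenN z G) i) ^+ 2.
Definition sN N z (G : {set 'I_N * 'I_N}) : K := toC N%:R^-1 * \sum_i greenN z G i.

Lemma gridP N (i : 'I_N) : grid i \in `[0, 1].
Proof.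
have N0 : 0 < N%:R :> R by rewrite ltr0n (leq_ltn_trans _ (ltn_ord i)).
by rewrite in_itv /= /grid divr_ge0 //= ler_pdivrMr // mul1r ler_nat ltn_ord.
Qed.

Lemma fN_bound N (i j : 'I_N) : 0 <= fN i j <= C.
Proof. by rewrite f_ge0 ?f_le ?gridP. Qed.

Lemma fN_sym N (i j : 'I_N) : fN i j = fN j i.
Proof. by rewrite /fN f_sym ?gridP. Qed.

(** For such [N] the weights are probabilities and [EN] is monotone, so statements about large [N]
    carry this condition along. *)
Definition good N := (0 < N)%N /\ eps N * C <= 1.

Lemma near_good : \forall N \near \oo, good N.
Proof.
have /cvgrPdist_lt /(_ C^-1) h := eps_to0.
near=> N; split; first by near: N; exists 1%N.
rewrite -ler_pdivlMr // div1r; apply: ltW.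
have : `|0 - eps N| < C^-1 by near: N; apply: h; rewrite invr_gt0.
by rewrite sub0r normrN gtr0_norm.
Unshelve. all: by end_near. Qed.

Section Good.
Variable N : nat.
Hypothesis hN : good N.
Let N0 : (0 < N)%N. Proof. by case: hN. Qed.
Let NR : 0 < N%:R :> R. Proof. by rewrite ltr0n. Qed.
Let Ni : 0 <= N%:R^-1 :> R. Proof. by rewrite invr_ge0 ltW. Qed.
Local Notation q := (@edge_prob R f eps N).

Lemma cN_gt0 : 0 < cN N.
Proof. by rewrite invr_gt0 mulr_gt0. Qed.

Lemma q01 (i j : 'I_N) : 0 <= q i j <= 1.
Proof.
have /andP[f0 fC] := fN_bound i j; have [_ h] := hN.
rewrite /edge_prob mulr_ge0 ?(ltW (eps_gt0 N)) //=.
apply: le_trans h; apply: ler_wpM2l => //; exact: ltW.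
Qed.

Lemma q_sym (i j : 'I_N) : q i j = q j i.
Proof. by rewrite /edge_prob; congr (_ * _); exact: fN_sym. Qed.

Lemma q_le (i j : 'I_N) : q i j <= eps N * C.
Proof.
by have /andP[f0 fC] := fN_bound i j; apply: ler_wpM2l => //; exact: ltW.
Qed.

Lemma cqE (i j : 'I_N) : cN N * q i j = fN i j / N%:R.
Proof.
rewrite /cN /edge_prob -/(fN i j); field; by rewrite !gt_eqF.
Qed.

Lemma cq_le (i j : 'I_N) : cN N * q i j <= C / N%:R.
Proof. by rewrite cqE; have /andP[f0 fC] := fN_bound i j; apply: ler_wpM2r. Qed.

Let pq01 (e : 'I_N * 'I_N) : (e.1 < e.2)%N -> 0 <= q e.1 e.2 <= 1.
Proof. by move=> _; exact: q01. Qed.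

Lemma qve_defect_err z (G : {set 'I_N * 'I_N}) i :
  qve_defect (@fN N) z (greenN z G) i = qve_err q (cN N) z G i.
Proof.
rewrite /qve_defect /qve_err; congr (_ - _).
by apply: eq_bigr => j _; rewrite cqE.
Qed.

Lemma EN_avgerr2_le z : 0 < complex.Im z ->
  EN (@avgerr2 N z) <= err_bound N (cN N) C (eps N * C) z.
Proof.
move=> z0; rewrite /EN /avgerr2 ExZ Ex_sum.
rewrite mulrC ler_pdivrMr //; set B := err_bound _ _ _ _ _.
have -> : B * N%:R = \sum_(i < N) B by rewrite sumr_const card_ord mulr_natr.
apply: ler_sum => i _. apply: le_trans _ (Ex_qve_err q01 q_sym cN_gt0 z0 q_le cq_le i).
by apply: ler_Ex => // G _; rewrite qve_defect_err.
Qed.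

Lemma EN_mono X Y : (forall G : {set 'I_N * 'I_N}, is_graph G -> X G <= Y G) -> EN X <= EN Y.
Proof. exact: ler_Ex. Qed.

Lemma EN_norm (X : {set 'I_N * 'I_N} -> R) : `|EN X| <= EN (fun G : {set 'I_N * 'I_N} => `|X G|).
Proof.
rewrite ler_norml; apply/andP; split; last by apply: EN_mono => G _; exact: ler_norm.
rewrite -[- EN _]mulN1r /EN -ExZ; apply: EN_mono => G _.
by rewrite mulN1r lerNl -normrN ler_norm.
Qed.

Lemma greenN_neq0 z (G : {set 'I_N * 'I_N}) i : 0 < complex.Im z -> greenN z G i != 0.
Proof. by move=> z0; apply: resolvent_neq0 z0 _; exact: scaled_adj_sym. Qed.

Lemma greenN_Im z (G : {set 'I_N * 'I_N}) i : 0 < complex.Im z ->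
  complex.Im z * normc (greenN z G i) ^+ 2 <= complex.Im (greenN z G i).
Proof. by move=> z0; apply: Im_resolvent_ge z0 _; exact: scaled_adj_sym. Qed.

Lemma greenN_le z (G : {set 'I_N * 'I_N}) i : 0 < complex.Im z ->
  normc (greenN z G i) <= (complex.Im z)^-1.
Proof. by move=> z0; apply: normc_resolvent_le z0 _; exact: scaled_adj_sym. Qed.

(** The second moment is [1/N] times the sum of the squared entries, and an entry off the diagonal
    has expected square [cN N * q i j]. This bound controls every approximation with weight
    [1 + x^2]. *)
Lemma EN_esd_sqr_le : EN (fun G : {set 'I_N * 'I_N} => esd_int (HN G) (fun x => x ^+ 2)) <= C.
Proof.
rewrite /EN /esd_int ExZ mulrC ler_pdivrMr //.
have -> : Ex (fun e : 'I_N * 'I_N => q e.1 e.2) (fun G => \sum_(x <- spectrum (HN G)) x ^+ 2)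
   = \sum_i \sum_j Ex (fun e : 'I_N * 'I_N => q e.1 e.2) (fun G => HN G i j ^+ 2).
  under eq_bigr => i _ do rewrite -Ex_sum.
  rewrite -Ex_sum; apply: eq_Ex => G _; apply: sum_spectrum_sqr; exact: scaled_adj_sym.
rewrite mulr_natr -[N in leRHS]card_ord -sumr_const; apply: ler_sum => i _.
apply: le_trans (_ : \sum_(j < N) C / N%:R <= _); last first.
  rewrite sumr_const card_ord -[leLHS]mulr_natr le_eqVlt; apply/orP; left; apply/eqP.
  by field; rewrite gt_eqF.
apply: ler_sum => j _.
have CN0 : 0 <= C / N%:R by rewrite divr_ge0 // ltW.
have [ji|ji] := eqVneq j i.
  rewrite -[leRHS](Ex_cst (fun e : 'I_N * 'I_N => q e.1 e.2)); apply: ler_Ex => // G gG.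
  by rewrite ji scaled_adj_diag // expr0n.
apply: le_trans (cq_le i j); have c0 := ltW cN_gt0.
have h G : is_graph G -> HN G i j ^+ 2 =
    (fun b : bool => cN N * b%:R) (star i j \in G) * 1.
  move=> gG; rewrite /HN (scaled_adj_star q (cN N) gG ji) /noise /drift /centred.
  rewrite -mulrDr subrK exprMn sqr_sqrtr // mulr1; congr (_ * _).
  by case: (star i j \in G); rewrite ?expr1n ?expr0n.
rewrite (eq_Ex _ h) (@Ex_edge _ _ (fun e : 'I_N * 'I_N => q e.1 e.2) (star i j)
   (fun b : bool => cN N * b%:R) (fun=> 1)) ?star_lt //.
rewrite Ex_cst mulr1 /= mulr1n mulr0n !mulr0 addr0 mulr1.
rewrite (_ : edge_prob f eps (star i j).1 (star i j).2 = edge_prob f eps i j) 1?mulrC //.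
exact: (@q_star _ _ (@edge_prob R f eps N) i q_sym j).
Qed.

Lemma esd_resolvent z (G : {set 'I_N * 'I_N}) : 0 < complex.Im z ->
  toC N%:R^-1 * (\sum_(x <- spectrum (HN G)) (toC x - z)^-1) = sN z G.
Proof.
move=> z0; congr (_ * _); apply: sum_spectrum_resolvent => //; exact: scaled_adj_sym.
Qed.

Lemma esd_Im z (G : {set 'I_N * 'I_N}) : 0 < complex.Im z ->
  esd_int (HN G) (fun x => complex.Im (toC x - z)^-1) = complex.Im (sN z G).
Proof. by move=> z0; rewrite -esd_resolvent // ImZ Im_sum. Qed.

Lemma esd_Re z (G : {set 'I_N * 'I_N}) : 0 < complex.Im z ->
  esd_int (HN G) (fun x => complex.Re (toC x - z)^-1) = complex.Re (sN z G).
Proof. by move=> z0; rewrite -esd_resolvent // ReZ Re_sum. Qed.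

Lemma avgerr_ge0 z (G : {set 'I_N * 'I_N}) : 0 <= avgerr z G.
Proof. by rewrite mulr_ge0 // sumr_ge0 // => i _; exact: normc_ge0. Qed.

Lemma avgerr_le_avgerr2 z (G : {set 'I_N * 'I_N}) e : 0 < e ->
  avgerr z G <= e / 2 + (2 * e)^-1 * avgerr2 z G.
Proof.
move=> e0; rewrite /avgerr /avgerr2.
have -> : e / 2 = N%:R^-1 * \sum_(i < N) e / 2.
  by rewrite sumr_const card_ord -mulr_natr; field; rewrite gt_eqF.
rewrite mulrCA -mulrDr ler_wpM2l // mulr_sumr -big_split /=; apply: ler_sum => i _.
set x := normc _; rewrite -subr_ge0.
have -> : e / 2 + (2 * e)^-1 * x ^+ 2 - x = (x - e) ^+ 2 / (2 * e) by field; rewrite gt_eqF.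
by rewrite divr_ge0 ?sqr_ge0 // mulr_ge0 // ltW.
Qed.

End Good.

(** * Vanishing of the expected defects *)

Lemma near_ltn0 : \forall N \near \oo, (0 < N)%N.
Proof. by exists 1%N. Qed.

Lemma cN_cvg : cN @ \oo --> (0 : R).
Proof.
have pos : \forall N \near \oo, 0 < N%:R * eps N.
  by apply: filterS near_ltn0 => N N0; rewrite mulr_gt0 // ltr0n.
exact: (gtr0_cvgV0 pos).2 Neps_toy.
Qed.

Lemma invN_cvg : (fun N : nat => N%:R^-1 : R) @ \oo --> (0 : R).
Proof.
have pos : \forall N \near \oo, 0 < N%:R :> R.
  by apply: filterS near_ltn0 => N N0; rewrite ltr0n.
exact: (gtr0_cvgV0 pos).2 cvgr_idn.
Qed.

Lemma err_bound_cvg z : (fun N => err_bound N (cN N) C (eps N * C) z) @ \oo --> (0 : R).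
Proof.
set L := (complex.Im z)^-1.
(* A polynomial in [cN N], [eps N * C] and [1 / N] without constant term; squares of the variables
   are written as products for the limit rules. *)
pose F (c k t : R) : R := 4 * (4 * (c * C * L ^+ 2 + 4 * (C ^+ 2 * L ^+ 2 * t)
   + 4 * (C * t * (L ^+ 2 * (k * C))) + (L * (k * C)) * (L * (k * C))))
   + 2 * ((k * C * L + 2 * (C * t) * L) * (k * C * L + 2 * (C * t) * L)).
have -> : (0 : R) = F 0 (0 * C) 0 by rewrite /F; ring.
rewrite (_ : (fun N => _) = (fun N => F (cN N) (eps N * C) N%:R^-1)); last first.
  by apply/funext => N; rewrite /err_bound /quad_bound /F -/L; ring.
have h1 := cN_cvg; have h2 : (fun N => eps N * C) @ \oo --> 0 * C.
  by apply: cvgMl.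
have h3 := invN_cvg; rewrite /F.
repeat (first [exact: h1 | exact: h2 | exact: h3 | exact: cvg_cst | apply: cvgD | apply: cvgM]).
Qed.

Lemma near_avgerr2 z e : 0 < complex.Im z -> 0 < e ->
  \forall N \near \oo, good N /\ EN (@avgerr2 N z) <= e.
Proof.
move=> z0 e0; have /cvgrPdist_lt /(_ e e0) h := @err_bound_cvg z.
have g := near_good; near=> N; have gN : good N by near: N.
split => //; apply: le_trans (EN_avgerr2_le gN z0) _.
apply: le_trans (ler_norm _) _; rewrite -normrN -sub0r; apply: ltW; near: N; exact: h.
Unshelve. all: by end_near. Qed.

Lemma near_avgerr z e : 0 < complex.Im z -> 0 < e ->
  \forall N \near \oo, good N /\ EN (@avgerr N z) <= e.
Proof.
move=> z0 e0; have h := near_avgerr2 z0 (exprn_gt0 2 e0).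
near=> N; have [gN hN] : good N /\ EN (@avgerr2 N z) <= e ^+ 2 by near: N.
split => //; apply: le_trans (_ : EN (fun G : {set 'I_N * 'I_N} => e / 2 + (2 * e)^-1 * @avgerr2 N z G) <= _).
  by apply: EN_mono => // G _; exact: avgerr_le_avgerr2.
rewrite /EN ExD [X in _ + X]ExZ Ex_cst -/(EN _).
apply: le_trans (_ : e / 2 + (2 * e)^-1 * e ^+ 2 <= _).
  by rewrite lerD2l ler_wpM2l // invr_ge0 mulr_ge0 // ltW.
by rewrite le_eqVlt; apply/orP; left; apply/eqP; field; rewrite gt_eqF.
Unshelve. all: by end_near. Qed.

(** Convergence in mean, stronger than in probability: it is linear, and it survives errors bounded
    by [e * (1 + x^2)] because second moments are bounded in mean. Markov's inequality recovers
    probability at the end. *)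
Definition mconv (phi : R -> R) (l : R) := forall e, 0 < e ->
  \forall N \near \oo, good N /\ EN (fun G : {set 'I_N * 'I_N} => `|esd_int (HN G) phi - l|) <= e.

Definition mean_esd (phi : R -> R) N : R :=
  EN (fun G : {set 'I_N * 'I_N} => esd_int (HN G) phi).

(** The statistic at [N] is compared with the mean at [N']. This single bound yields both the Cauchy
    property of the means and the concentration at [N]. *)
Lemma mconv_of_cauchy phi :
  (forall e, 0 < e -> exists N0, forall N N', (N0 <= N)%N -> (N0 <= N')%N ->
     good N /\ EN (fun G : {set 'I_N * 'I_N} => `|esd_int (HN G) phi - mean_esd phi N'|) <= e) ->
  exists l, mconv phi l.
Proof.
move=> H.
have mc N N' e : good N ->
    EN (fun G : {set 'I_N * 'I_N} => `|esd_int (HN G) phi - mean_esd phi N'|) <= e ->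
    `|mean_esd phi N - mean_esd phi N'| <= e.
  move=> gN; apply: le_trans; apply: le_trans (EN_norm gN _).
  by rewrite /EN ExD Ex_cst.
have /cauchy_cvgP/cvg_ex [l ml] : cauchy (mean_esd phi @ \oo).
  apply: cauchy_exP => e e0.
  have [N0 HN0] := H _ (divr_gt0 e0 (ltr0n R 2)); exists (mean_esd phi N0).
  exists N0 => // N /= NN0; rewrite /ball /= distrC.
  apply: le_lt_trans (_ : e / 2 < e); last by lra.
  by have [gN h] := HN0 N N0 NN0 (leqnn _); apply: mc.
exists l => e e0; have [N0 HN0] := H _ (divr_gt0 e0 (ltr0n R 2)).
have /cvgrPdist_lt /(_ _ (divr_gt0 e0 (ltr0n R 2))) [N1 _ HN1] := ml.
exists N0 => // N /= NN0; pose N' := maxn N0 N1.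
have [gN h] := HN0 N N' NN0 (leq_maxl _ _); split=> //.
have h' : `|l - mean_esd phi N'| < e / 2 by apply: HN1; rewrite /= leq_maxr.
apply: le_trans (_ : EN (fun G : {set 'I_N * 'I_N} =>
   `|esd_int (HN G) phi - mean_esd phi N'| + e / 2) <= _).
  apply: EN_mono => // G _.
  have -> : esd_int (HN G) phi - l =
    (esd_int (HN G) phi - mean_esd phi N') - (l - mean_esd phi N') by ring.
  by apply: le_trans (ler_normB _ _) _; rewrite lerD2l ltW.
by rewrite /EN ExD Ex_cst [leRHS](splitr e) lerD2r.
Qed.

(** * Convergence of the Stieltjes transform far from the real axis *)

Section LargeSpectralParameter.
Variable z : K.
Hypothesis z_gt0 : 0 < complex.Im z.
Local Notation L := ((complex.Im z)^-1).
Hypothesis z_large : L ^+ 2 * C <= 2^-1.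

(** Deterministic in both graphs: vertices of either size are copied onto [N * N'] cells, and two
    vertices that share a cell have nearby grid points, so the kernels differ by at most [w]. *)
Lemma sN_coupling w : 0 < w -> exists N0, forall N N', (N0 <= N)%N -> (N0 <= N')%N ->
  forall (G : {set 'I_N * 'I_N}) (G' : {set 'I_N' * 'I_N'}),
  normc (sN z G - sN z G') <= 2 * L ^+ 2 * (w * L + avgerr z G + avgerr z G').
Proof.
move=> w0; have [d d0 fd] := f_unif w0.
have /cvgrPdist_lt /(_ d d0) [N1 _ H1] := invN_cvg.
exists N1.+1 => N N' hN hN' G G'.
have N0 : (0 < N)%N by apply: leq_trans hN.
have N'0 : (0 < N')%N by apply: leq_trans hN'.
have M0 : (0 < N * N')%N by rewrite muln_gt0 N0.
have lt1 (k : 'I_(N * N')) : (k %/ N' < N)%N by rewrite ltn_divLR.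
have lt2 (k : 'I_(N * N')) : (k %/ N < N')%N by rewrite ltn_divLR // [X in (_ < X)%N]mulnC.
pose a (k : 'I_(N * N')) := Ordinal (lt1 k); pose a' (k : 'I_(N * N')) := Ordinal (lt2 k).
have ud : uniform_map a by apply: (uniform_map_div (m := N')).
have ud' : uniform_map a' by apply: (uniform_map_div (m := N)) => //; rewrite mulnC.
have invd n : (N1.+1 <= n)%N -> n%:R^-1 < d.
  move=> hn; have : `|0 - n%:R^-1| < d by apply: H1; apply: ltnW.
  by rewrite sub0r normrN ger0_norm // invr_ge0.
have dist (k : 'I_(N * N')) : `|grid (a k) - grid (a' k)| < d.
  (* Vertex [i] sits at the right end [(i+1)/n] of its interval and the cell starts inside that
     interval, so both grid points lie shortly after the same point. *)
  have between (kk n m : nat) (i : 'I_n) : (0 < m)%N -> (0 < n)%N ->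
      i = (kk %/ m)%N :> nat -> (N * N' = n * m)%N ->
      (kk%:R / (N * N')%:R : R) < grid i <= kk%:R / (N * N')%:R + n%:R^-1.
    move=> m0 n0 iE ME; rewrite /grid ME natrM.
    have nR : 0 < n%:R :> R by rewrite ltr0n.
    have mR : 0 < m%:R :> R by rewrite ltr0n.
    have k1 : (kk%:R : R) < i.+1%:R * m%:R.
      by rewrite -natrM ltr_nat -ltn_divLR // iE.
    have k2 : (i%:R : R) * m%:R <= kk%:R by rewrite -natrM ler_nat iE leq_trunc_div.
    apply/andP; split.
      rewrite ltr_pdivrMr ?mulr_gt0 //.
      have -> // : i.+1%:R / n%:R * (n%:R * m%:R) = i.+1%:R * m%:R :> R.
      by field; rewrite gt_eqF.
    have -> : kk%:R / (n%:R * m%:R) + n%:R^-1 = (kk%:R / m%:R + 1) / n%:R :> R.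
      by field; rewrite !gt_eqF.
    by rewrite ler_wpM2r ?invr_ge0 ?(ltW nR) // -[i.+1]addn1 natrD lerD2r ler_pdivlMr.
  have /andP[h1 h2] := between k N N' (a k) N'0 N0 erefl erefl.
  have /andP[h3 h4] := between k N' N (a' k) N0 N'0 erefl (mulnC _ _).
  have i1 := invd N hN; have i2 := invd N' hN'.
  rewrite ltr_norml; move: h1 h2 h3 h4 i1 i2.
  set x := _ / _; set y := grid _; set y' := grid _; set t := _^-1; set t' := _^-1.
  by move=> *; apply/andP; split; lra.
apply: (@qve_contraction R N N' _ a a' (@fN N) (@fN N') z (greenN z G) (greenN z G') C L w
  N0 N'0 M0 ud ud' (@fN_bound N)) => //.
- by rewrite invr_ge0 ltW.
- by move=> k l; apply/ltW/fd => //; exact: gridP.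
- by move=> i; exact: greenN_neq0.
- by move=> i; exact: greenN_neq0.
- by move=> i; exact: greenN_le.
- by move=> i; exact: greenN_le.
Qed.

(** The coupling holds for all pairs of graphs. Averaging over [G'] with [G] fixed compares with
    [mean_esd]; averaging over [G] then leaves the expected defects, each at most [t]. *)
Lemma mconv_large_Im : exists l, mconv (fun x => complex.Im (toC x - z)^-1) l.
Proof.
pose phi := fun x : R => complex.Im (toC x - z)^-1; apply: (@mconv_of_cauchy phi) => e e0.
pose t := e / (2 * L ^+ 2 * (L + 2)).
have L0 : 0 < L by rewrite invr_gt0.
have t0 : 0 < t by rewrite divr_gt0 // !mulr_gt0 ?exprn_gt0 // addr_gt0.
have [N1 H1] := sN_coupling t0.
have [N2 _ H2] := near_avgerr z_gt0 t0.
exists (maxn N1 N2) => N N'; rewrite !geq_max => /andP[h1 h2] /andP[h1' h2'].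
have [gN aN] := H2 N h2; have [gN' aN'] := H2 N' h2'; split => //.
apply: le_trans (_ : EN (fun G : {set 'I_N * 'I_N} =>
   2 * L ^+ 2 * (avgerr z G + (t * L + t))) <= _); last first.
  rewrite /EN ExZ ExD Ex_cst -/(EN _).
  have -> : e = 2 * L ^+ 2 * (t + (t * L + t)).
    have -> : 2 * L ^+ 2 * (t + (t * L + t)) = t * (2 * L ^+ 2 * (L + 2)) by ring.
    by rewrite /t divfK // gt_eqF // !mulr_gt0 ?exprn_gt0 // addr_gt0.
  apply: ler_wpM2l; first by apply: mulr_ge0 => //; exact: sqr_ge0.
  by rewrite lerD2r.
apply: EN_mono => // G _.
have -> : esd_int (HN G) phi - mean_esd phi N' =
    EN (fun G' : {set 'I_N' * 'I_N'} => esd_int (HN G) phi + -1 * esd_int (HN G') phi).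
  by rewrite /EN ExD Ex_cst [X in _ = _ + X]ExZ mulN1r.
apply: le_trans (EN_norm gN' _) _.
apply: le_trans (_ : EN (fun G' : {set 'I_N' * 'I_N'} =>
   2 * L ^+ 2 * ((avgerr z G + t * L) + avgerr z G')) <= _); last first.
  rewrite /EN ExZ ExD Ex_cst -/(EN _).
  apply: ler_wpM2l; first by apply: mulr_ge0 => //; exact: sqr_ge0.
  by rewrite addrA lerD2l.
apply: EN_mono => // G' _; rewrite mulN1r !esd_Im // -ImN -ImD.
apply: le_trans (ler_Im_normc _) _; apply: le_trans (H1 _ _ h1 h1' G G') _.
by rewrite [avgerr z G + _]addrC.
Qed.

(* The reflected family -conj u solves the same equation when z is imaginary. *)
Lemma mconv_large_Re : complex.Re z = 0 -> mconv (fun x => complex.Re (toC x - z)^-1) 0.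
Proof.
move=> z_im e e0; have L0 : 0 < L by rewrite invr_gt0.
have t0 : 0 < e / (2 * L ^+ 2) by rewrite divr_gt0 // mulr_gt0 // exprn_gt0.
apply: filterS (near_avgerr z_gt0 t0) => N [gN aN]; split => //.
have N0 : (0 < N)%N by case: gN.
apply: le_trans (_ : 2 * L ^+ 2 * EN (@avgerr N z) <= _); last first.
  by rewrite mulrC -ler_pdivlMr // mulr_gt0 // exprn_gt0.
rewrite {2}/EN -ExZ -/(EN _); apply: EN_mono => // G _; rewrite subr0 esd_Re //.
pose u := greenN z G; pose u' i := - @complex.conjc R (u i).
have cM (x y : K) : complex.conjc (x * y) = complex.conjc x * complex.conjc y by rewrite -rmorphM.
have zc : - @complex.conjc R z = z.
  by case: (z) z_im => x y /= ->; apply/eqP; rewrite eq_complex /= oppr0 opprK !eqxx.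
have d' i : qve_defect (@fN N) z u' i = - @complex.conjc R (qve_defect (@fN N) z u i).
  rewrite /qve_defect /u' invrN opprK -conjc_inv !rmorphB /= rmorphN /= -[z in LHS]zc.
  rewrite rmorph_sum !opprB opprK addrC; congr (_ + _).
    rewrite -sumrN /=; apply: eq_bigr => j _.
    by rewrite cM conjc_real mulrN opprK.
  by rewrite opprK addrC.
have := @qve_contraction _ _ _ _ _ _ (@fN N) (@fN N) z u u' C L 0 N0 N0 N0
  (@uniform_map_id N) (@uniform_map_id N) (@fN_bound N) (ltW L0) z_large.
rewrite mul0r add0r => H.
have {}H : normc (toC N%:R^-1 * (\sum_i u i) - toC N%:R^-1 * (\sum_i u' i)) <=
   2 * L ^+ 2 * (avgerr z G + avgerr z G).
  apply: le_trans (H _ _ _ _ _) _.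
  - by move=> k l; rewrite subrr normr0.
  - by move=> i; exact: greenN_neq0.
  - by move=> i; rewrite oppr_eq0 conjc_eq0; exact: greenN_neq0.
  - by move=> i; exact: greenN_le.
  - by move=> i; rewrite normcN' normcJ; exact: greenN_le.
  - rewrite le_eqVlt; apply/orP; left; apply/eqP; congr (_ * (_ + _)).
    by congr (_ * _); apply: eq_bigr => i _; rewrite d' normcN' normcJ.
have hR : complex.Re (toC N%:R^-1 * (\sum_i u i) - toC N%:R^-1 * (\sum_i u' i)) =
    2 * complex.Re (sN z G).
  rewrite ReD ReN /sN !ReZ !Re_sum -mulrBr -sumrB mulrCA [2 * \sum_(_ < _) _]mulr_sumr.
  congr (_ * _); apply: eq_bigr => i _; rewrite ReN opprK /u.
  by case: (greenN z G i) => x y /=; ring.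
have := le_trans (ler_Re_normc _) H; rewrite hR normrM ger0_norm // => h.
move: h; set A := `|_|; set B := avgerr z G; set D := L ^+ 2; nra.
Qed.

End LargeSpectralParameter.

(** * Calculus of limits in mean *)

Lemma esd_int_lin N (G : {set 'I_N * 'I_N}) a b phi psi :
  esd_int (HN G) (fun x => a * phi x + b * psi x) =
  a * esd_int (HN G) phi + b * esd_int (HN G) psi.
Proof.
by rewrite /esd_int big_split /= -!mulr_sumr mulrDr [in RHS]mulrCA [b * (_ * _)]mulrCA.
Qed.

Lemma esd_int_cst N (G : {set 'I_N * 'I_N}) a : good N -> esd_int (HN G) (fun=> a) = a.
Proof.
move=> [N0 _]; rewrite /esd_int big_const_seq count_predT size_spectrum; last exact: scaled_adj_sym.
by rewrite iter_addr addr0 -[a *+ N]mulr_natl mulrA mulVf ?mul1r // pnatr_eq0 -lt0n.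
Qed.

Lemma esd_int_le N (G : {set 'I_N * 'I_N}) phi psi : (forall x, phi x <= psi x) ->
  esd_int (HN G) phi <= esd_int (HN G) psi.
Proof. by move=> h; rewrite ler_wpM2l ?invr_ge0 // ler_sum. Qed.

Lemma esd_int_norm_le N (G : {set 'I_N * 'I_N}) phi :
  `|esd_int (HN G) phi| <= esd_int (HN G) (fun x => `|phi x|).
Proof.
rewrite normrM ger0_norm ?invr_ge0 // ler_wpM2l ?invr_ge0 //.
exact: ler_norm_sum.
Qed.

Lemma EN_esd_close N phi psi e : good N -> 0 <= e ->
  (forall x, `|phi x - psi x| <= e * (1 + x ^+ 2)) ->
  EN (fun G : {set 'I_N * 'I_N} => `|esd_int (HN G) phi - esd_int (HN G) psi|) <= e * (1 + C).
Proof.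
move=> gN e0 h.
apply: le_trans (_ : EN (fun G : {set 'I_N * 'I_N} =>
   e * (1 + esd_int (HN G) (fun x => x ^+ 2))) <= _); last first.
  rewrite /EN ExZ ExD Ex_cst -/(EN _); apply: ler_wpM2l => //.
  by rewrite lerD2l; exact: EN_esd_sqr_le.
apply: EN_mono => // G _.
have -> : esd_int (HN G) phi - esd_int (HN G) psi = esd_int (HN G) (fun x => 1 * phi x + -1 * psi x).
  by rewrite esd_int_lin mul1r mulN1r.
apply: le_trans (esd_int_norm_le _ _) _.
have -> : e * (1 + esd_int (HN G) (fun x => x ^+ 2)) =
    esd_int (HN G) (fun x => e * 1 + e * x ^+ 2).
  by rewrite (esd_int_lin _ _ _ (fun=> 1)) esd_int_cst // mulrDr.
by apply: esd_int_le => x; rewrite mul1r mulN1r -mulrDr.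
Qed.

Lemma mconv_lin a b phi psi l m : mconv phi l -> mconv psi m ->
  mconv (fun x => a * phi x + b * psi x) (a * l + b * m).
Proof.
move=> hl hm e e0; pose t := e / (1 + `|a| + `|b|).
have p0 : 0 < 1 + `|a| + `|b| by rewrite -addrA ltr_pwDl // addr_ge0.
have t0 : 0 < t by rewrite divr_gt0.
apply: filterS2 (hl t t0) (hm t t0) => N [gN h1] [_ h2]; split => //.
apply: le_trans (_ : EN (fun G : {set 'I_N * 'I_N} =>
   `|a| * `|esd_int (HN G) phi - l| + `|b| * `|esd_int (HN G) psi - m|) <= _).
  apply: EN_mono => // G _; rewrite esd_int_lin -!normrM opprD addrACA -!mulrBr.
  exact: ler_normD.
rewrite /EN ExD !ExZ -!/(EN _).
apply: le_trans (_ : `|a| * t + `|b| * t <= _).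
  by apply: lerD; apply: ler_wpM2l.
have -> : e = (1 + `|a| + `|b|) * t by rewrite /t mulrC divfK // gt_eqF.
by rewrite -mulrDl; apply: ler_wpM2r; [exact: ltW|rewrite -addrA lerDr].
Qed.

Lemma mconv_cst a : mconv (fun=> a) a.
Proof.
move=> e e0; apply: filterS near_good => N gN; split=> //.
apply: le_trans (_ : EN (fun _ : {set 'I_N * 'I_N} => 0) <= _).
  by apply: EN_mono => // G _; rewrite esd_int_cst // subrr normr0.
by rewrite /EN Ex_cst ltW.
Qed.

(** Inequalities for approximate solutions pass to the limit at fixed [z]: the coefficients [K1] and
    [K2] may be huge for small [Im z], since the averages that they multiply vanish in mean. *)
Lemma mconv_err_le z phi l B K1 K2 : 0 < complex.Im z -> 0 <= K1 -> 0 <= K2 ->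
  (forall N, good N -> forall G : {set 'I_N * 'I_N},
     esd_int (HN G) phi <= B + (K1 * avgerr z G + K2 * avgerr2 z G)) ->
  mconv phi l -> l <= B.
Proof.
move=> z0 K10 K20 H hl; apply/ler_addgt0Pr => e e0.
pose t := e / (1 + K1 + K2).
have p0 : 0 < 1 + K1 + K2 by rewrite -addrA ltr_pwDl // addr_ge0.
have t0 : 0 < t by rewrite divr_gt0.
have [N [[gN h1] [[_ h2] [_ h3]]]] := @filter_ex _ \oo _ _
  (filterI (hl t t0) (filterI (near_avgerr z0 t0) (near_avgerr2 z0 t0))).
have : EN (fun _ : {set 'I_N * 'I_N} => l) <=
  EN (fun G : {set 'I_N * 'I_N} => B + (K1 * avgerr z G + (K2 * avgerr2 z G
     + `|esd_int (HN G) phi - l|))).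
  apply: EN_mono => // G _; have := H N gN G.
  have := ler_norm (- (esd_int (HN G) phi - l)); rewrite normrN; lra.
rewrite /EN Ex_cst ExD Ex_cst ExD [X in _ + (X + _)]ExZ ExD [X in _ + (_ + (X + _))]ExZ -!/(EN _).
move=> h; apply: le_trans h _; rewrite lerD2l.
have -> : e = K1 * t + (K2 * t + t).
  have -> : K1 * t + (K2 * t + t) = (1 + K1 + K2) * t by ring.
  by rewrite /t mulrC divfK // gt_eqF.
by apply: lerD; [exact: ler_wpM2l | apply: lerD => //; exact: ler_wpM2l].
Qed.

Lemma mconv_le phi l B : (forall x, phi x <= B) -> mconv phi l -> l <= B.
Proof.
move=> h; have z0 : 0 < complex.Im ('i%C : K) by rewrite /= ltr01.
apply: (@mconv_err_le _ _ _ _ 0 0 z0) => // N gN G.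
rewrite !mul0r !addr0 -[leRHS](esd_int_cst G B gN); exact: esd_int_le.
Qed.

Lemma mconv_ge phi l B : (forall x, B <= phi x) -> mconv phi l -> B <= l.
Proof.
move=> h hl; have := mconv_lin (-1) 0 hl (mconv_cst 0).
have -> : -1 * l + 0 * 0 = - l :> R by rewrite mul0r addr0 mulN1r.
move=> /mconv_le h'; rewrite -lerN2; apply: h' => x.
by rewrite mulN1r mulr0 addr0 lerN2.
Qed.

Lemma mconv_mono phi psi l m : (forall x, phi x <= psi x) ->
  mconv phi l -> mconv psi m -> l <= m.
Proof.
move=> h hl hm; have := mconv_lin 1 (-1) hm hl => /mconv_ge h'.
have : 0 <= 1 * m + -1 * l by apply: h' => x; rewrite mul1r mulN1r subr_ge0.
by rewrite mul1r mulN1r subr_ge0.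
Qed.

Lemma mconv_unique phi l m : mconv phi l -> mconv phi m -> l = m.
Proof.
by move=> hl hm; apply/eqP; rewrite eq_le (mconv_mono _ hl hm) ?(mconv_mono _ hm hl).
Qed.

Lemma mconv_tight phi l e : 0 <= e -> (forall x, `|phi x| <= e * (1 + x ^+ 2)) ->
  mconv phi l -> `|l| <= e * (1 + C).
Proof.
move=> e0 h hl; apply/ler_addgt0Pr => t t0.
have /filter_ex [N [gN hN]] := hl t t0.
have h0 : forall x, `|phi x - 0| <= e * (1 + x ^+ 2) by move=> x; rewrite subr0.
have h1 := EN_esd_close gN e0 h0.
have := lerD h1 hN; apply: le_trans; rewrite /EN -ExD -/(EN _) -[leLHS](Ex_cst
  (fun e : 'I_N * 'I_N => edge_prob f eps e.1 e.2)).
apply: EN_mono => // G _; rewrite esd_int_cst // subr0.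
rewrite [X in _ <= _ + X]distrC; apply: le_trans (ler_normD _ _) => /=.
by rewrite addrC subrK.
Qed.

(** The error of replacing [phi] by [psi] is uniform in [N] by [EN_esd_close], so the Cauchy
    criterion passes from [psi] to [phi]. *)
Lemma mconv_approx phi :
  (forall e, 0 < e -> exists psi, (exists l, mconv psi l) /\
     forall x, `|phi x - psi x| <= e * (1 + x ^+ 2)) -> exists l, mconv phi l.
Proof.
move=> H; apply: mconv_of_cauchy => e e0.
have C1 : 0 < 1 + C by rewrite addr_gt0.
pose t := e / (4 * (1 + C)); have t0 : 0 < t by rewrite divr_gt0 // mulr_gt0.
have [psi [[l hl] close]] := H t t0.
have e4 : 0 < e / 4 by rewrite divr_gt0.
have tE : t * (1 + C) = e / 4 by rewrite /t; field; rewrite gt_eqF.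
have [N0 _ H0] := hl _ e4.
exists N0 => N N' hN hN'; have [gN h1] := H0 N hN; have [gN' h2] := H0 N' hN'; split => //.
have c1 := EN_esd_close gN (ltW t0) close; have c2 := EN_esd_close gN' (ltW t0) close.
have m1 : `|mean_esd phi N' - l| <= e / 4 + e / 4.
  have -> : mean_esd phi N' - l = EN (fun G : {set 'I_N' * 'I_N'} => esd_int (HN G) phi - l).
    by rewrite /EN ExD Ex_cst.
  apply: le_trans (EN_norm gN' _) _.
  rewrite tE in c2; apply: le_trans (lerD c2 h2); rewrite /EN -ExD -/(EN _).
  apply: EN_mono => // G _; apply: le_trans (ler_normD _ _); by rewrite addrA subrK.
apply: le_trans (_ : EN (fun G : {set 'I_N * 'I_N} =>
  `|esd_int (HN G) phi - esd_int (HN G) psi| + (`|esd_int (HN G) psi - l| + (e / 4 + e / 4))) <= _).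
  apply: EN_mono => // G _.
  have -> : esd_int (HN G) phi - mean_esd phi N' = (esd_int (HN G) phi - esd_int (HN G) psi)
     + ((esd_int (HN G) psi - l) - (mean_esd phi N' - l)) by ring.
  apply: le_trans (ler_normD _ _) _; rewrite lerD2l; apply: le_trans (ler_normB _ _) _.
  by rewrite lerD2l.
rewrite /EN !ExD Ex_cst; rewrite tE in c1.
by apply: le_trans (lerD c1 (lerD h1 (lexx _))) _; lra.
Qed.

Lemma mconv0_approx phi :
  (forall e, 0 < e -> exists psi, mconv psi 0 /\
     forall x, `|phi x - psi x| <= e * (1 + x ^+ 2)) -> mconv phi 0.
Proof.
move=> H; have [l hl] : exists l, mconv phi l.
  apply: mconv_approx => e e0; have [psi [h1 h2]] := H e e0.
  by exists psi; split => //; exists 0.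
suff -> : 0 = l by [].
apply/eqP; rewrite eq_sym -normr_eq0.
have C1 : 0 < 1 + C by rewrite addr_gt0.
rewrite eq_le normr_ge0 andbT; apply/ler_addgt0Pr => e e0; rewrite add0r.
have t0 : 0 < e / (1 + C) by rewrite divr_gt0.
have [psi [h1 h2]] := H _ t0.
have := mconv_tight (ltW t0) _ (mconv_lin 1 (-1) hl h1).
rewrite mulr0 addr0 mul1r divfK ?gt_eqF //; apply => x.
by rewrite mul1r mulN1r.
Qed.

(** * Limiting bounds near the real axis *)

Lemma mconv_Im_upper z l : 0 < complex.Im z -> 24 * C <= normc z ^+ 2 ->
  mconv (fun x => complex.Im (toC x - z)^-1) l -> l <= complex.Im z / (3 * C).
Proof.
move=> z0 zC; set eta := complex.Im z; set L := eta^-1.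
have L0 : 0 <= L by rewrite invr_ge0 ltW.
have C0 := ltW C_gt0; have eta0 := ltW z0.
pose D := eta / (8 * C) + L / 8.
have D0 : 0 <= D by rewrite addr_ge0 ?divr_ge0 ?mulr_ge0.
(* Dividing [approx_Im_upper] by [3/4] produces the factors [4/3] and turns [eta / (4 C)] into
   [eta / (3 C)]. *)
apply: (@mconv_err_le z _ _ _ (4 / 3 * ((L + L ^+ 3 * C) * D + L ^+ 2)) (4 / 3 * (L ^+ 2 * D))) => //.
- by rewrite mulr_ge0 ?divr_ge0 // addr_ge0 ?mulr_ge0 ?exprn_ge0 // addr_ge0 ?mulr_ge0 ?exprn_ge0.
- by rewrite mulr_ge0 ?divr_ge0 // mulr_ge0 // exprn_ge0.
move=> N gN G; rewrite esd_Im //; have N0 : (0 < N)%N by case: gN.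
have := @approx_Im_upper _ N (@fN N) z (greenN z G) N0 z0 (fun i => greenN_Im G i z0)
  (fun i => greenN_neq0 G i z0) C C_gt0 (@fN_sym N) (@fN_bound N) zC.
rewrite /err_sum -/(avgerr z G) -/(avgerr2 z G) -/eta -/L -/D -/(sN z G).
have -> : eta / (4 * C) = (3 / 4) * (eta / (3 * C)) by field; rewrite gt_eqF.
set x := complex.Im _; set y := avgerr _ _; set w := avgerr2 _ _; set B := eta / _.
have p34 : 0 < 3 / 4 :> R by rewrite divr_gt0.
move=> h; rewrite -(ler_pM2r p34); apply: le_trans h _.
by rewrite le_eqVlt; apply/orP; left; apply/eqP; field.
Qed.

(** With [r = delta^(-1/2)], the cubic [X (delta X^2 - 1)] is at least [2 (X - r)] for [X > r], so
    an error [y] raises the bound only by [y / 2]. *)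
Lemma mconv_Im_bounded z l delta : 0 < complex.Im z -> 0 < delta ->
  (forall x y, x \in `[0, 1] -> y \in `[0, 1] -> delta <= f x y) ->
  mconv (fun x => complex.Im (toC x - z)^-1) l -> l <= (Num.sqrt delta)^-1.
Proof.
move=> z0 d0 df; set L := (complex.Im z)^-1.
apply: (@mconv_err_le z _ _ _ (L ^+ 2 / 2) 0) => //; first by rewrite divr_ge0 // sqr_ge0.
move=> N gN G; rewrite mul0r addr0 esd_Im //; have N0 : (0 < N)%N by case: gN.
have := @approx_Im_lower _ N (@fN N) z (greenN z G) N0 z0 (fun i => greenN_Im G i z0)
  (fun i => greenN_neq0 G i z0) delta (ltW d0) (fun i j => df _ _ (gridP i) (gridP j)).
rewrite -/(avgerr z G) -/L -/(sN z G); set X := complex.Im _; set y := L ^+ 2 * avgerr z G => h.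
have y0 : 0 <= y by rewrite mulr_ge0 ?sqr_ge0 // avgerr_ge0.
set r := (Num.sqrt delta)^-1.
have r0 : 0 < r by rewrite invr_gt0 sqrtr_gt0.
have dr : delta = r ^- 2 by rewrite exprVn invrK sqr_sqrtr // ltW.
rewrite mulrAC -/y; have [Xr|rX] := leP X r; first by apply: le_trans Xr _; rewrite lerDl divr_ge0.
have X0 : 0 < X by apply: lt_trans rX.
have h2 : X * (delta * X ^+ 2 - 1) <= y.
  apply: le_trans h; rewrite ler_wpM2l ?(ltW X0) // lerD2r ler_wpM2l ?(ltW d0) //.
  by rewrite normc2E lerDr sqr_ge0.
have h3 : 2 * (X - r) <= X * (delta * X ^+ 2 - 1).
  have -> : X * (delta * X ^+ 2 - 1) = (X - r) * (X / r * ((X / r) + 1)).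
    by rewrite dr; field; rewrite gt_eqF.
  rewrite mulrC ler_wpM2l ?subr_ge0 ?(ltW rX) //.
  have : 1 <= X / r by rewrite ler_pdivlMr // mul1r ltW.
  set w := X / r; nra.
have := le_trans h3 h2; lra.
Qed.

(** Markov's inequality. *)
Lemma mconv_graph_prob phi l delta : mconv phi l -> 0 < delta ->
  (fun N : nat => graph_prob f eps (fun G : {set 'I_N * 'I_N} =>
     delta < `|esd_int (HN G) phi - l|)) @ \oo --> (0 : R).
Proof.
move=> hl d0; apply/cvgrPdist_le => e e0.
have := hl (e * delta) (mulr_gt0 e0 d0); apply: filterS => N [gN h].
have w0 : forall G : {set 'I_N * 'I_N}, 0 <= graph_weight f eps G.
  move=> G; apply: (@wt_ge0 _ _ (fun e : 'I_N * 'I_N => edge_prob f eps e.1 e.2)) => e' _.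
  exact: q01.
rewrite sub0r normrN ger0_norm; last by apply: sumr_ge0.
rewrite -(ler_pM2r d0); apply: le_trans h; rewrite /graph_prob mulr_suml /EN /Ex.
rewrite [leRHS](bigID (fun G : {set 'I_N * 'I_N} => delta < `|esd_int (HN G) phi - l|)) /=.
rewrite -[leLHS]addr0 lerD //; last first.
  by apply: sumr_ge0 => G _; apply: mulr_ge0; [exact: w0|exact: normr_ge0].
by apply: ler_sum => G /andP[_ hG]; apply: ler_wpM2l; [exact: w0|exact: ltW].
Qed.

(** * From Cauchy kernels to all bounded continuous functions *)

Definition s_large : R := Num.max 1 (2 * C).

Let s_large1 : 1 <= s_large. Proof. by rewrite le_max lexx. Qed.

Definition imag_point (s : R) : K := Complex 0 (Num.sqrt s).

Lemma cauchy_fun_Im s x : 0 < s ->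
  complex.Im ((toC x - imag_point s)^-1) = Num.sqrt s * cauchy_fun s x.
Proof.
move=> s0; rewrite /cauchy_fun /= subr0 sub0r sqrrN sqr_sqrtr ?(ltW s0) //.
by rewrite mulNr opprK.
Qed.

Lemma cauchy_fun_Re s x : 0 < s ->
  complex.Re ((toC x - imag_point s)^-1) = x * cauchy_fun s x.
Proof.
by move=> s0; rewrite /cauchy_fun /= subr0 sub0r sqrrN sqr_sqrtr ?(ltW s0).
Qed.

(** [L^2 = 1/s] at this point, so [2 C] in [s_large] meets the contraction condition; the 1 there
    keeps the Cauchy kernels at most 1. *)
Lemma imag_point_large s : s_large <= s ->
  0 < complex.Im (imag_point s) /\ (complex.Im (imag_point s))^-1 ^+ 2 * C <= 2^-1.
Proof.
move=> h; have s1 : 1 <= s := le_trans s_large1 h.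
have s0 : 0 < s by apply: lt_le_trans ltr01 s1.
split; first by rewrite /= sqrtr_gt0.
rewrite /= exprVn sqr_sqrtr ?(ltW s0) // mulrC ler_pdivrMr // ler_pdivlMl //.
by apply: le_trans h; rewrite le_max lexx orbT.
Qed.

Lemma mconv_ext phi psi l : (forall x, phi x = psi x) -> mconv phi l -> mconv psi l.
Proof. by move=> h; have -> : phi = psi by apply/funext. Qed.

Lemma mconv_cauchy_fun s : s_large <= s -> exists l, mconv (cauchy_fun s) l.
Proof.
move=> h; have [z0 zC] := imag_point_large h.
have s0 : 0 < s by apply: lt_le_trans ltr01 (le_trans s_large1 h).
have q0 : Num.sqrt s != 0 by rewrite gt_eqF // sqrtr_gt0.
have [l hl] := mconv_large_Im z0 zC; exists ((Num.sqrt s)^-1 * l + 0 * 0).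
apply: mconv_ext (mconv_lin (Num.sqrt s)^-1 0 hl (mconv_cst 0)) => x.
by rewrite cauchy_fun_Im // mulKf // mul0r addr0.
Qed.

Lemma mconv_x_cauchy_fun s : s_large <= s -> mconv (fun x => x * cauchy_fun s x) 0.
Proof.
move=> h; have [z0 zC] := imag_point_large h.
have s0 : 0 < s by apply: lt_le_trans ltr01 (le_trans s_large1 h).
by apply: mconv_ext (mconv_large_Re z0 zC erefl) => x; rewrite cauchy_fun_Re.
Qed.

Let u := cauchy_fun s_large.
Let u_gt0 x : 0 < u x. Proof. exact: cauchy_fun_gt0. Qed.

(** The deviation is at most [delta / u x = delta * (x^2 + s_large)]: it grows quadratically, which
    is why approximations are weighted by [1 + x^2]. *)
Lemma damping_close delta x : 0 < delta ->
  `|1 - u x / (u x + delta)| <= delta * s_large * (1 + x ^+ 2).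
Proof.
move=> d0; have ud : 0 < u x + delta by rewrite addr_gt0.
have -> : 1 - u x / (u x + delta) = delta / (u x + delta) by field; rewrite gt_eqF.
rewrite ger0_norm ?divr_ge0 ?(ltW d0) ?(ltW ud) //.
apply: le_trans (_ : delta / u x <= _).
  by rewrite ler_wpM2l ?(ltW d0) // lef_pV2 ?posrE // lerDl ltW.
rewrite -mulrA ler_wpM2l ?(ltW d0) // /u /cauchy_fun invrK.
by have := sqr_ge0 x; have := s_large1; nra.
Qed.

Lemma mconv_even g : Cb g -> (forall x, g (- x) = g x) -> exists l, mconv g l.
Proof.
move=> [gc [B gB]] ge; apply: mconv_approx => e e0.
have B0 : 0 <= B by apply: le_trans (gB 0).
have B1 : 0 < B + 1 by rewrite ltr_wpDl.
have sl0 : 0 < s_large by apply: lt_le_trans ltr01 s_large1.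
(* Makes the damping error [(B + 1) * delta * s_large] equal to [e]; [B + 1] avoids division by
   0. *)
pose delta := e / ((B + 1) * s_large).
have d0 : 0 < delta by rewrite divr_gt0 // mulr_gt0.
exists (fun x => 1 * (g x * (u x / (u x + delta)))); split.
  apply: (@W_damped R (fun phi => exists l, mconv phi l) _ mconv_approx (fun=> 1) s_large) => //.
  - move=> a b phi psi [l hl] [m hm]; exists (a * l + b * m); exact: mconv_lin.
  - by move=> x; rewrite normr1 lerDl sqr_ge0.
  - move=> s hs; have [l hl] := mconv_cauchy_fun hs; exists l.
    by apply: mconv_ext hl => x; rewrite mul1r.
  - by exists B.
move=> x; rewrite mul1r -{1}[g x]mulr1 -mulrBr normrM.
apply: le_trans (_ : (B + 1) * (delta * s_large * (1 + x ^+ 2)) <= _).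
  apply: ler_pM; rewrite ?damping_close //; apply: le_trans (gB x) _.
  by rewrite lerDl.
rewrite le_eqVlt; apply/orP; left; apply/eqP; rewrite /delta; field.
by rewrite !gt_eqF.
Qed.

(** [g] is approximated by [x * h x] with [h = g x / (x^2 + rho)] even and bounded, so that the
    weight [w x = x] applies. The error [g rho / (x^2 + rho)] is small near 0 because [g 0 = 0], and
    elsewhere because [rho] is small. *)
Lemma mconv_odd g : Cb g -> (forall x, g (- x) = - g x) -> mconv g 0.
Proof.
move=> [gc [B gB]] go; apply: mconv0_approx => e e0.
have B0 : 0 <= B by apply: le_trans (gB 0).
have B1 : 0 < B + 1 by rewrite ltr_wpDl.
have sl0 : 0 < s_large by apply: lt_le_trans ltr01 s_large1.
have e2 : 0 < e / 2 by rewrite divr_gt0.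
have g0 : g 0 = 0.
  have := go 0; rewrite oppr0 => h; lra.
have [r r0 hr] : exists2 r, 0 < r & forall x, `|x| < r -> `|g x| < e / 2.
  have /cvgrPdist_lt /(_ _ e2) /nbhs_ballP [r /= r0 hr] := gc 0.
  exists r => // x xr; have := hr x; rewrite /ball /= sub0r normrN => /(_ xr).
  by rewrite g0 sub0r normrN.
(* Chosen so that [(B + 1) * rho = e / 2 * r^2], as needed where [|x| >= r]. *)
pose rho := e * r ^+ 2 / (2 * (B + 1)).
have rho0 : 0 < rho by rewrite divr_gt0 ?mulr_gt0 ?exprn_gt0.
have xr0 x : 0 < x ^+ 2 + rho by rewrite ltr_wpDl ?sqr_ge0.
pose delta := e / (2 * (B + 1) * s_large).
have d0 : 0 < delta by rewrite divr_gt0 // !mulr_gt0.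
pose h x := g x * (x / (x ^+ 2 + rho)).
exists (fun x => x * (h x * (u x / (u x + delta)))); split.
  apply: (@W_damped R (fun phi => mconv phi 0) _ mconv0_approx (fun x => x) s_large) => //.
  - move=> a b phi psi hl hm.
    have := mconv_lin a b hl hm; by rewrite !mulr0 addr0.
  - move=> x; rewrite -[x ^+ 2]real_normK ?num_real //; have := normr_ge0 x; nra.
  - exact: mconv_x_cauchy_fun.
  - move=> x; apply: cvgM; first exact: gc.
    apply: cvgM; first exact: cvg_id.
    apply: cvgV; first by rewrite gt_eqF.
    apply: cvgD; last exact: cvg_cst.
    exact: exprn_continuous.
  - by move=> x; rewrite /h go sqrrN; ring.
  - exists (B * (1 + rho^-1)) => x; rewrite /h normrM; apply: ler_pM => //.
    rewrite normrM normfV [`|x ^+ 2 + rho|]gtr0_norm // ler_pdivrMr //.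
    have -> : (1 + rho^-1) * (x ^+ 2 + rho) = x ^+ 2 + rho + x ^+ 2 / rho + 1.
      by field; rewrite gt_eqF.
    have : 0 <= x ^+ 2 / rho by rewrite divr_ge0 ?sqr_ge0 // ltW.
    rewrite -[x ^+ 2]real_normK ?num_real //; have := normr_ge0 x.
    by set y := `|x|; set z := y ^+ 2 / rho => *; nra.
move=> x; set v := u x / (u x + delta).
have -> : g x - x * (h x * v) = g x * (rho / (x ^+ 2 + rho))
    + g x * (x ^+ 2 / (x ^+ 2 + rho)) * (1 - v).
  by rewrite /h; field; rewrite gt_eqF.
apply: le_trans (ler_normD _ _) _.
have p1 : `|g x * (rho / (x ^+ 2 + rho))| <= e / 2.
  rewrite normrM [`|_ / _|]ger0_norm; last by rewrite divr_ge0 ?(ltW rho0) ?(ltW (xr0 x)).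
  have [xr|xr] := ltP `|x| r.
    apply: le_trans (_ : e / 2 * 1 <= _); last by rewrite mulr1.
    apply: ler_pM => //; [by rewrite divr_ge0 ?(ltW rho0) ?(ltW (xr0 x))|exact/ltW/hr|].
    by rewrite ler_pdivrMr // mul1r lerDr sqr_ge0.
  rewrite mulrA ler_pdivrMr //.
  apply: le_trans (_ : (B + 1) * rho <= _).
    by apply: ler_wpM2r; [exact: ltW|apply: le_trans (gB x) _; rewrite lerDl].
  have -> : (B + 1) * rho = e / 2 * r ^+ 2 by rewrite /rho; field; rewrite gt_eqF.
  apply: ler_wpM2l; first exact: ltW.
  apply: le_trans (_ : x ^+ 2 <= _); last by rewrite lerDl ltW.
  by rewrite -[leRHS]real_normK ?num_real // ler_pXn2r ?nnegrE // ltW.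
have p2 : `|g x * (x ^+ 2 / (x ^+ 2 + rho)) * (1 - v)| <= e / 2 * (1 + x ^+ 2).
  rewrite normrM.
  apply: le_trans (_ : (B + 1) * (delta * s_large * (1 + x ^+ 2)) <= _).
    apply: ler_pM; rewrite ?damping_close //.
    rewrite normrM -[leRHS]mulr1; apply: ler_pM => //.
      by apply: le_trans (gB x) _; rewrite lerDl.
    rewrite ger0_norm; last by rewrite divr_ge0 ?sqr_ge0 ?(ltW (xr0 x)).
    by rewrite ler_pdivrMr // mul1r lerDl ltW.
  rewrite le_eqVlt; apply/orP; left; apply/eqP; rewrite /delta; field.
  by rewrite !gt_eqF.
apply: le_trans (lerD p1 p2) _.
have := mulr_ge0 (ltW e2) (sqr_ge0 x); rewrite !mulrDr !mulr1; lra.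
Qed.

Lemma mconv_Cb g : Cb g -> exists l, mconv g l.
Proof.
move=> cg; have cr := Cb_reflect cg.
pose ge x := 2^-1 * g x + 2^-1 * g (- x); pose go x := 2^-1 * g x + - 2^-1 * g (- x).
have he x : ge (- x) = ge x by rewrite /ge opprK addrC.
have ho x : go (- x) = - go x by rewrite /go opprK; ring.
have [l hl] := mconv_even (Cb_lin 2^-1 2^-1 cg cr) he.
have {}ho := mconv_odd (Cb_lin 2^-1 (- 2^-1) cg cr) ho.
exists (1 * l + 1 * 0); apply: mconv_ext (mconv_lin 1 1 hl ho) => x.
by field.
Qed.

Definition limit_mean (g : R -> R) : R := xget 0 [set l | mconv g l].

Lemma limit_meanP g : Cb g -> mconv g (limit_mean g).
Proof. by move=> /mconv_Cb [l hl]; rewrite /limit_mean; case: xgetP => [m -> //|/(_ l)]. Qed.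

Lemma limit_mean_functional : mean_functional limit_mean.
Proof.
split.
- move=> a b phi psi c1 c2; apply: mconv_unique (limit_meanP (Cb_lin a b c1 c2)) _.
  exact: mconv_lin (limit_meanP c1) (limit_meanP c2).
- by move=> phi psi c1 c2 h; exact: mconv_mono h (limit_meanP c1) (limit_meanP c2).
- by apply: mconv_unique (mconv_cst 1); apply: limit_meanP; exact: Cb_cst.
Qed.

Lemma limit_mean_reflect g : Cb g -> limit_mean (fun x => g (- x)) = limit_mean g.
Proof.
move=> cg; have cr := Cb_reflect cg; have [lin _ _] := limit_mean_functional.
pose go x := 1 * g (- x) + -1 * g x.
have ho x : go (- x) = - go x by rewrite /go opprK; ring.
have {}ho := mconv_odd (Cb_lin 1 (-1) cr cg) ho.
have := mconv_unique ho (limit_meanP (Cb_lin 1 (-1) cr cg)).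
by rewrite lin // mul1r mulN1r => /esym/eqP; rewrite subr_eq0 => /eqP.
Qed.

Lemma limit_measure : exists mu : probability (measurableTypeR R) R,
  forall g, Cb g -> mconv g (prob_mean mu g).
Proof.
have C1 : 0 < 1 + C by rewrite addr_gt0.
have [mu hmu] := @riesz_mean R limit_mean (1 + C) limit_mean_functional C1
  (fun phi e cphi e0 h => mconv_tight e0 h (limit_meanP cphi)).
by exists mu => g cg; rewrite hmu //; exact: limit_meanP.
Qed.

Lemma Im_cauchyE E eta x : 0 < eta ->
  complex.Im ((toC x - Complex E eta)^-1) = eta / ((x - E) ^+ 2 + eta ^+ 2).
Proof. by move=> e0; rewrite /= sub0r sqrrN mulNr opprK. Qed.

Lemma Cb_Im_cauchy E eta : 0 < eta -> Cb (fun x => complex.Im ((toC x - Complex E eta)^-1)).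
Proof.
move=> e0; have d0 x : 0 < (x - E) ^+ 2 + eta ^+ 2.
  by rewrite ltr_wpDl ?sqr_ge0 // exprn_gt0.
under eq_fun => x do rewrite Im_cauchyE //.
split.
  move=> x; apply: cvgM; first exact: cvg_cst.
  apply: cvgV; first by rewrite gt_eqF.
  apply: cvgD; last exact: cvg_cst.
  apply: (@continuous_comp _ _ _ (fun x => x - E) (fun y => y ^+ 2)).
    by apply: cvgB; [exact: cvg_id|exact: cvg_cst].
  exact: exprn_continuous.
exists eta^-1 => x; rewrite ger0_norm ?divr_ge0 ?(ltW e0) ?(ltW (d0 x)) //.
rewrite ler_pdivrMr // mulrC ler_pdivlMr // -expr2 lerDr sqr_ge0 //.
Qed.

(** * Symmetry, support and density of the limit *)

Section Limit.
Variable mu : probability (measurableTypeR R) R.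
Hypothesis mu_lim : forall g, Cb g -> mconv g (prob_mean mu g).

(** At height [h / 2] above the midpoint, the Poisson kernel is at least [1 / h] on the whole
    interval, with equality at its ends. *)
Lemma cdf_increment a h : 0 < h ->
  prob_cdf mu (a + h) - prob_cdf mu a <=
  h * prob_mean mu (fun x => complex.Im ((toC x - Complex (a + h / 2) (h / 2))^-1)).
Proof.
move=> h0; have h2 : 0 < h / 2 by rewrite divr_gt0.
have ah : a <= a + h by rewrite lerDl ltW.
have [lin _ _] := prob_mean_functional mu.
set phi := fun x : R => complex.Im _.
have cphi : Cb phi by exact: Cb_Im_cauchy.
have -> : h * prob_mean mu phi = prob_mean mu (fun x => h * phi x + 0 * (fun=> 1) x).
  by rewrite lin ?mul0r ?addr0 //; exact: Cb_cst.
have -> : prob_cdf mu (a + h) - prob_cdf mu a = fine (mu `]a, (a + h)]%classic).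
  by rewrite prob_itvoc.
apply: le_prob_mean => //; first by apply: Cb_lin => //; exact: Cb_cst.
move=> x; rewrite mul0r addr0 indicE mem_setE in_itv /= /phi Im_cauchyE //.
have d0 : 0 < (x - (a + h / 2)) ^+ 2 + (h / 2) ^+ 2.
  by rewrite ltr_wpDl ?sqr_ge0 // exprn_gt0.
have [/andP[ax xa]|_] := boolP (a < x <= a + h); last first.
  by rewrite mulr0n mulr_ge0 ?(ltW h0) // divr_ge0 ?(ltW h2) ?(ltW d0).
rewrite mulr1n mulrA ler_pdivlMr // mul1r; nra.
Qed.

Lemma limit_reflect (A : set R) : measurable A -> mu [set - x | x in A] = mu A.
Proof.
apply: prob_reflect => g cg; apply: mconv_unique (mu_lim (Cb_reflect cg)) _.
rewrite (mconv_unique (mu_lim cg) (limit_meanP cg)) -limit_mean_reflect //.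
exact: limit_meanP (Cb_reflect cg).
Qed.

(** [M^2 = 25 C] exceeds the threshold [24 C] for every interval to the right of [M]. Increments
    there are at most [h^2 / (6 C)], so the right tail has no mass; the left one follows by
    symmetry. *)
Lemma limit_tail M : M = 5 * Num.sqrt C -> mu [set x : R | M < `|x|] = 0%E.
Proof.
move=> ME; have M0 : 0 <= M by rewrite ME mulr_ge0 // sqrtr_ge0.
have M2 : M ^+ 2 = 25 * C by rewrite ME exprMn sqr_sqrtr ?(ltW C_gt0) //; ring.
have right0 : mu `]M, +oo[%classic = 0%E.
  apply: (@prob_right_tail_eq0 _ _ _ (6 * C)^-1) => a h aM h0.
  have h2 : 0 < h / 2 by rewrite divr_gt0.
  apply: le_trans (cdf_increment a h0) _.
  have cphi := Cb_Im_cauchy (a + h / 2) h2.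
  apply: le_trans (_ : h * (h / 2 / (3 * C)) <= _).
    rewrite ler_wpM2l ?(ltW h0) //.
    apply: (@mconv_Im_upper (Complex (a + h / 2) (h / 2))) (mu_lim cphi) => //.
    rewrite normc2E /=; have := C_gt0; nra.
  rewrite le_eqVlt; apply/orP; left; apply/eqP; field; by rewrite gt_eqF.
have mB : measurable (`]M, +oo[%classic : set (measurableTypeR R)) by exact: measurable_itv.
have refl : mu [set - x | x in `]M, +oo[%classic] = 0%E by rewrite limit_reflect.
have mr : measurable ([set - x | x in `]M, +oo[%classic] : set (measurableTypeR R)).
  have -> : [set - x | x in `]M, +oo[%classic] = `]-oo, (- M)[%classic.
    apply/seteqP; split => [_ [x Mx <-]|x Mx]; move: Mx; rewrite /= !in_itv /= ?andbT.
      by rewrite ltrN2.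
    by move=> h; exists (- x); rewrite ?opprK //= in_itv /= andbT ltrNr.
  exact: measurable_itv.
have -> : [set x : R | M < `|x|] = `]M, +oo[%classic `|` [set - x | x in `]M, +oo[%classic].
  apply/seteqP; split => x /=; rewrite !in_itv /= andbT.
    rewrite lter_normr => /orP[h|h]; [by left|right].
    by exists (- x); rewrite ?opprK //= in_itv /= andbT.
  case=> [h|[y]]; first by apply: lt_le_trans h (ler_norm _).
  rewrite in_itv /= andbT => h <-; rewrite normrN; exact: lt_le_trans h (ler_norm _).
apply/eqP; rewrite eq_le measure_ge0 andbT; apply: le_trans (measureU2 mu mB mr) _.
have -> : 0%E = (0 + 0 : \bar R)%E by rewrite adde0.
have le0 (v : \bar R) : v = 0%E -> (v <= 0)%E by move=> ->.
by apply: leeD; apply: le0.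
Qed.

(** [cdf_increment] turns the uniform bound [delta^(-1/2)] into a Lipschitz constant of the
    distribution function. *)
Lemma limit_abs_continuous delta : 0 < delta ->
  (forall x y, x \in `[0, 1] -> y \in `[0, 1] -> delta <= f x y) ->
  mu `<< @lebesgue_measure R.
Proof.
move=> d0 df; apply: (@prob_abs_continuous _ _ (Num.sqrt delta)^-1).
  by rewrite invr_ge0 sqrtr_ge0.
move=> a b; rewrite le_eqVlt => /orP[/eqP ->|ab]; first by rewrite !subrr mulr0.
have h0 : 0 < b - a by rewrite subr_gt0.
have h2 : 0 < (b - a) / 2 by rewrite divr_gt0.
have := cdf_increment a h0; rewrite [a + (b - a)]addrC subrK => h.
apply: le_trans h _; rewrite mulrC ler_wpM2r ?(ltW h0) //.
apply: mconv_Im_bounded df (mu_lim (Cb_Im_cauchy _ h2)) => //.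
Qed.

End Limit.

End Model.
Unset Implicit Arguments.

Theorem theorem1p1 (R : realType) (f : R -> R -> R) (eps : nat -> R)
  (f_cont : {within [set p : R * R | p.1 \in `[0, 1] /\ p.2 \in `[0, 1]],
              continuous (fun p : R * R => f p.1 p.2)})
  (f_ge0 : forall x y, x \in `[0, 1] -> y \in `[0, 1] -> 0 <= f x y)
  (f_sym : forall x y, x \in `[0, 1] -> y \in `[0, 1] -> f x y = f y x)
  (eps_gt0 : forall N, 0 < eps N)
  (eps_to0 : eps @ \oo --> (0 : R))
  (Neps_toy : (fun N : nat => N%:R * eps N) @ \oo --> +oo) :
  exists mu : probability (measurableTypeR R) R,
    (exists M : R, mu [set x : R | M < `|x|] = 0%E) /\
    (forall A : set R, measurable A -> mu [set - x | x in A] = mu A) /\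
    (forall g : R -> R, continuous g -> (exists C : R, forall x, `|g x| <= C) ->
       forall delta : R, 0 < delta ->
       (fun N : nat =>
          graph_prob f eps
            (fun G : {set 'I_N * 'I_N} =>
               delta < `| esd_int (Num.sqrt (N%:R * eps N)^-1 *: adjacency R G) g
                          - fine (\int[mu]_x (g x)%:E) |)) @ \oo --> (0 : R)) /\
    ((forall x y, x \in `[0, 1] -> y \in `[0, 1] -> 0 < f x y) ->
       mu `<< (@lebesgue_measure R)).
Proof.
have [C C_gt0 f_le] := square_bounded f_cont.
have f_unif := fun e => @square_unif_cont R f f_cont e.
have [mu mu_lim] := limit_measure C_gt0 f_le f_ge0 f_sym f_unif eps_gt0 eps_to0 Neps_toy.
exists mu; split; last split; last split.
- exists (5 * Num.sqrt C).
  exact: (limit_tail C_gt0 f_le f_ge0 f_sym f_unif eps_gt0 eps_to0 Neps_toy mu_lim erefl).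
- exact: (limit_reflect C_gt0 f_le f_ge0 f_sym f_unif eps_gt0 eps_to0 Neps_toy mu_lim).
- move=> g gc gB delta d0; have cg : Cb g by split.
  exact: (mconv_graph_prob f_le f_ge0 eps_gt0 (mu_lim g cg) d0).
- move=> /(square_pos f_cont) [delta d0 df].
  exact: (limit_abs_continuous C_gt0 f_le f_ge0 f_sym eps_gt0 eps_to0 Neps_toy mu_lim d0 df).
Qed.
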